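(* For every integer $n\ge1$, write the Poincaré series of $H^*(W(n),\mathbb{F}_2)$ as $q_n(t)/(1-t^2)^{r}$ with $r=\binom{n+1}{2}$ and $q_n(t)=1+a_1t+a_2t^2+\dots+a_rt^r$. Then $$a_2=\frac{n(n+1)(n-1)}{3}\quad\text{and}\quad a_3=\frac{n(n^2-1)(3n-4)(n+3)}{60}.$$
   Context: $W(n)=F_n/F_n^4[F_n^2,F_n]$, where $F_n$ is the free group of rank $n$ and $F_n^4[F_n^2,F_n]$ is the subgroup generated by fourth powers and commutators $[a^2,b]$; $q_n(t)$ is a polynomial of degree $r$. *)

(* Defs.v *)
From HB Require Import structures.
From mathcomp Require Import all_boot all_order all_algebra all_fingroup.
Set Implicit Arguments. Unset Strict Implicit. Unset Printing Implicit Defensive.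
Import GRing.Theory.
Local Open Scope ring_scope.

Definition W_laws (hT : finGroupType) : Prop :=
  forall h h' : hT, (h ^+ 4 = 1)%g /\ commute (h ^+ 2)%g h'.

(* (gT, x) is the relatively free group F_n / F_n^4 [F_n^2, F_n] on the
   generators x 0, ..., x (n-1): it satisfies the laws, is generated by the
   x i, and has the universal property with respect to every (finite) group
   in the variety. *)
Definition is_W (n : nat) (gT : finGroupType) (x : 'I_n -> gT) : Prop :=
  [/\ W_laws gT,
      <<[set x i | i : 'I_n]>>%g = [set: gT]
    & forall (hT : finGroupType) (y : 'I_n -> hT), W_laws hT ->
        exists f : {morphism [set: gT] >-> hT}, forall i, f (x i) = y i].

(* Inhomogeneous (bar) cochains: C^k = functions G^k -> F_2, with basis the
   indicator functions of k-tuples.  The coboundary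
   (df)(g_1..g_{k+1}) = f(g_2..g_{k+1}) + sum_{i=1}^k f(..,g_i g_{i+1},..)
                        + f(g_1..g_k)
   (signs irrelevant in characteristic 2) is encoded by its matrix acting on
   row vectors, whose (s,t) entry is the number mod 2 of faces of t equal
   to s. *)

Definition face (T : finGroupType) (k i : nat) (t : {ffun 'I_k.+1 -> T})
  : {ffun 'I_k -> T} :=
  [ffun j : 'I_k =>
     let g (m : nat) := t (inord m) in
     if (j.+1 < i)%N then g j
     else if j.+1 == i then mulg (g j) (g j.+1)
     else g j.+1].

Definition cobd (T : finGroupType) (k : nat)
  : 'M['F_2]_(#|{ffun 'I_k -> T}|, #|{ffun 'I_k.+1 -> T}|) :=
  \matrix_(s, t)
     \sum_(i < k.+2) ((face i (enum_val t) == enum_val s) : nat)%:R.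

Definition coh_dim (T : finGroupType) (k : nat) : nat :=
  (#|{ffun 'I_k -> T}| - \rank (cobd T k)
     - (if k is k'.+1 then \rank (cobd T k') else 0))%N.

(* Coefficient of t^k in q(t) = P(t) (1 - t^2)^r, where
   P(t) = sum_k h k t^k is the Poincare series. *)
Definition qcoef (r : nat) (h : nat -> nat) (k : nat) : int :=
  \sum_(j < k.+1) ((1 - 'X^2 : {poly int}) ^+ r)`_j * (h (k - j)%N)%:Z.

(* Main.v *)
Require Import Defs.
From HB Require Import structures.
From mathcomp Require Import all_boot all_order all_algebra all_fingroup zify ring.
From mathcomp.multinomials Require Import mpoly.
Set Implicit Arguments. Unset Strict Implicit. Unset Printing Implicit Defensive.
Import GRing.Theory.
Local Open Scope ring_scope.

(** The elements of $W(n)$ carry coordinates $X_i$ ($i<n$) and $E_a$, where $a$ runs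
    over the $r$ pairs $lo(a)\le hi(a)$, such that $X_i$ is additive and
    $E_a(gh)=E_a(g)+E_a(h)+X_{lo(a)}(g)X_{hi(a)}(h)$.  Let $L_q$ be the space of forms of
    degree $q$ in variables $x_i$, $e_a$ over $\mathbb F_2$, and let $I_q$ be the
    coinduced module of functions from the group to $L_q$.  With right translations
    by the generators $u_i$ and the central elements $v_a$ one builds
    $D=H+T+Q:I_q\to I_{q+1}$, a Koszul differential in the $e$- and $x$-directions
    corrected by $Q\approx\sum_a x_{lo(a)}x_{hi(a)}\,\partial/\partial e_a$, and these maps begin
    a resolution of $\mathbb F_2$ by acyclic modules.  Dimension shifting gives
    $h_1,h_2,h_3$ in terms of the constants lying in images of $D$, and these have the
    dimension of the kernel of the derivation
    $\bar q=\sum_a x_{lo(a)}x_{hi(a)}\,\partial/\partial e_a$ of $L_q$.  Its rank is found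
    bidegree by bidegree; the point is that the syzygies between the quadratic monomials
    of a fixed multiple are generated by the obvious ones in the degrees that matter. *)

(** The generators [u_i] neither commute nor square to 1, so [T T] is not zero: it measures squares
    and commutators, each of which is some [v_a]. [Q] is designed to absorb this through
    [H Q + Q H = T T]. Together with [H H = 0] and [H T = T H] this leaves
    [D D = (T Q + Q T) + Q Q], which is zero on functions without [e]-variables but is not
    controlled beyond them. Hence exactness of [D] itself is used only at [I_0] and [I_1]; for $h_3$
    the next module is replaced by the quotient of [I_2] by the image of [D], whose invariants are
    computed by hand. For the same reason a constant in an image of [D] is compared with the kernel
    of $\bar q$ only through its parts of given [e]-degree, which yields equal dimensions rather
    than equal spaces. Degrees up to 3 suffice to make this work, because $\bar q$ is injective on
    forms of odd degree in the [e]-variables alone, which removes the only part of [e]-degree above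
    2. Since $(1-t^2)^r=1-rt^2+\dots$, the coefficients sought are $a_2=h_2-r$ and
    $a_3=h_3-r\,h_1$. *)

Lemma addFF (V : lmodType 'F_2) (v : V) : v + v = 0.
Proof.
by rewrite -mulr2n -scaler_nat (_ : 2%:R = 0) ?scale0r //; apply/val_inj.
Qed.

Lemma oppFF (V : lmodType 'F_2) (v : V) : - v = v.
Proof. by apply/eqP; rewrite eq_sym -addr_eq0 addFF. Qed.

Lemma addFK (V : lmodType 'F_2) (v w : V) : v + (v + w) = w.
Proof. by rewrite addrA addFF add0r. Qed.

Lemma lkerP (aT rT : vectType 'F_2) (f : 'Hom(aT, rT)) v :
  reflect (f v = 0) (v \in lker f).
Proof. by rewrite memv_ker; apply: eqP. Qed.

Lemma mem_capP (vT : vectType 'F_2) (A B : {vspace vT}) x :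
  reflect (x \in A /\ x \in B) (x \in (A :&: B)%VS).
Proof. by rewrite memv_cap; apply: andP. Qed.

Lemma F2_cases (a : 'F_2) : a = 0 \/ a = 1.
Proof. by case: a => [[|[|]]] // ?; [left | right]; apply/val_inj. Qed.

Lemma addF2 (x : 'F_2) : x + x = 0.
Proof. by have [->|->] := F2_cases x; apply/val_inj. Qed.

(** * Faces of tuples and appending a last entry *)

Section Tuples.
Variable T : finGroupType.

Definition snoc k (t : {ffun 'I_k -> T}) (h : T) : {ffun 'I_k.+1 -> T} :=
  [ffun j => oapp t h (unlift ord_max j)].

Lemma snoc_max k (t : {ffun 'I_k -> T}) h : snoc t h ord_max = h.
Proof. by rewrite ffunE unlift_none. Qed.

Lemma snoc_lift k (t : {ffun 'I_k -> T}) h j : snoc t h (lift ord_max j) = t j.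
Proof. by rewrite ffunE liftK. Qed.

Lemma inord_lift k (j : 'I_k) : inord j = lift ord_max j :> 'I_k.+1.
Proof. by apply/ord_inj; rewrite inordK ?lift_max // ltnS ltnW. Qed.

Lemma snocP k (t : {ffun 'I_k.+1 -> T}) (t' : {ffun 'I_k -> T}) h :
  t ord_max = h -> (forall j, t (lift ord_max j) = t' j) -> t = snoc t' h.
Proof.
move=> th tl; apply/ffunP => j; case: (unliftP ord_max j) => [j'|] ->.
  by rewrite snoc_lift tl.
by rewrite snoc_max.
Qed.

Lemma face_lt k i (t : {ffun 'I_k.+1 -> T}) (j : 'I_k) :
  (j.+1 < i)%N -> face i t j = t (inord j).
Proof. by move=> lt_ji; rewrite ffunE /= lt_ji. Qed.

Lemma face_eq k (t : {ffun 'I_k.+1 -> T}) (j : 'I_k) :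
  face j.+1 t j = (t (inord j) * t (inord j.+1))%g.
Proof. by rewrite ffunE /= ltnn eqxx. Qed.

Lemma face_gt k i (t : {ffun 'I_k.+1 -> T}) (j : 'I_k) :
  (i <= j)%N -> face i t j = t (inord j.+1).
Proof. by move=> le_ij; rewrite ffunE /= ltnNge (leqW le_ij) gtn_eqF. Qed.

Lemma face_last k (t : {ffun 'I_k.+1 -> T}) (j : 'I_k) :
  face k.+1 t j = t (lift ord_max j).
Proof. by rewrite face_lt ?inord_lift ?ltnS. Qed.

Lemma face_snoc_last k (t : {ffun 'I_k -> T}) h : face k.+1 (snoc t h) = t.
Proof. by apply/ffunP => j; rewrite face_last snoc_lift. Qed.

Lemma snoc_face_last k (t : {ffun 'I_k.+1 -> T}) :
  snoc (face k.+1 t) (t ord_max) = t.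
Proof. by apply/esym/snocP => // j; rewrite face_last. Qed.

Lemma inord_max k : inord k = ord_max :> 'I_k.+1.
Proof. by apply/ord_inj; rewrite inordK. Qed.

Lemma snoc_inord k (t : {ffun 'I_k.+1 -> T}) h m :
  (m < k.+1)%N -> snoc t h (inord m) = t (inord m).
Proof. by move=> lt_m; rewrite -(snoc_lift t h) -inord_lift inordK. Qed.

(** The only face that mixes the appended entry with the tuple; in the contraction below it produces
    the term with the group action. *)
Lemma face_snoc_mul k (t : {ffun 'I_k.+1 -> T}) h :
  face k.+1 (snoc t h) = snoc (face k.+1 t) (t ord_max * h)%g.
Proof.
apply: snocP => [|j].
  by rewrite (face_eq _ ord_max) snoc_inord // !inord_max snoc_max.
by rewrite face_lt ?lift_max ?ltnS // snoc_inord ?inord_lift ?face_last // ltnW // ltnS.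
Qed.

Lemma face_snoc k i (t : {ffun 'I_k.+1 -> T}) h : (i <= k)%N ->
  face i (snoc t h) = snoc (face i t) h.
Proof.
move=> le_ik; apply: snocP => [|j].
  by rewrite face_gt // inord_max snoc_max.
have lt_j := ltn_ord j; have lt_j' := ltnW lt_j.
by rewrite [LHS]ffunE [RHS]ffunE; cbv zeta; rewrite lift_max !snoc_inord.
Qed.

End Tuples.

(** * Bar cohomology with coefficients *)

Section Cochains.
Variables (T : finGroupType) (M : vectType 'F_2) (rho : T -> 'End(M)).

Local Notation C k := {ffun {ffun 'I_k -> T} -> M}.

(** The group acts in the last face, so [rho] stands for a right action, such as
    [ltr g f h = f (g * h)]. For the trivial action this is the coboundary encoded by [cobd]. *)
Definition dcoef_fun k (f : C k) : C k.+1 :=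
  [ffun t => \sum_(i < k.+1) f (face i t) + rho (t ord_max) (f (face k.+1 t))].

Lemma dcoef_is_linear k : linear (@dcoef_fun k).
Proof.
move=> a f g; apply/ffunP => t; rewrite !ffunE linearP scalerDr scaler_sumr.
rewrite addrACA -big_split; congr (_ + _).
by apply: eq_bigr => i _; rewrite !ffunE.
Qed.
HB.instance Definition _ k :=
  GRing.isLinear.Build 'F_2 (C k) (C k.+1) _ (@dcoef_fun k) (@dcoef_is_linear k).

(** Locking keeps unification from unfolding the matrix behind a linear map; several operators below
    are treated alike. *)
Fact dcoef_key : unit. Proof. by []. Qed.
Definition dcoef k : 'Hom(C k, C k.+1) :=
  locked_with dcoef_key (linfun (@dcoef_fun k)).

Lemma dcoefE k (f : C k) t :
  dcoef k f t
  = \sum_(i < k.+1) f (face i t) + rho (t ord_max) (f (face k.+1 t)).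
Proof. by rewrite /dcoef locked_withE lfunE ffunE. Qed.

End Cochains.

Section Post.
Variables (T : finGroupType) (M M' : vectType 'F_2) (D : 'Hom(M, M')).

Definition post_fun k (f : {ffun {ffun 'I_k -> T} -> M}) :
  {ffun {ffun 'I_k -> T} -> M'} := [ffun t => D (f t)].

Lemma post_is_linear k : linear (@post_fun k).
Proof. by move=> a f g; apply/ffunP => t; rewrite !ffunE linearP. Qed.
HB.instance Definition _ k :=
  GRing.isLinear.Build 'F_2 _ _ _ (@post_fun k) (@post_is_linear k).

Fact post_key : unit. Proof. by []. Qed.
Definition post k := locked_with post_key (linfun (@post_fun k)).

Lemma postE k (f : {ffun {ffun 'I_k -> T} -> M}) t : post k f t = D (f t).
Proof. by rewrite /post locked_withE lfunE ffunE. Qed.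

Lemma lker_postP k (f : {ffun {ffun 'I_k -> T} -> M}) :
  reflect (forall t, f t \in lker D) (f \in lker (post k)).
Proof.
rewrite memv_ker; apply: (iffP eqP) => [f0 t|f0].
  by rewrite memv_ker -postE f0 ffunE.
by apply/ffunP => t; rewrite postE ffunE; apply/eqP; rewrite -memv_ker.
Qed.

Lemma limg_postP k (f : {ffun {ffun 'I_k -> T} -> M'}) :
  reflect (forall t, f t \in limg D) (f \in limg (post k)).
Proof.
apply: (iffP memv_imgP) => [[g _ ->] t|fD]; first by rewrite postE memv_img ?memvf.
exists [ffun t => (D^-1)%VF (f t)]; rewrite ?memvf //.
by apply/ffunP => t; rewrite postE ffunE limg_lfunVK.
Qed.

Variables (rho : T -> 'End(M)) (rho' : T -> 'End(M')).
Hypothesis D_equi : forall g x, D (rho g x) = rho' g (D x).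

Lemma post_dcoef k (f : {ffun {ffun 'I_k -> T} -> M}) :
  post k.+1 (dcoef rho k f) = dcoef rho' k (post k f).
Proof.
apply/ffunP => t; rewrite postE !dcoefE linearD linear_sum /= D_equi postE.
by congr (_ + _); apply: eq_bigr => i _; rewrite postE.
Qed.

End Post.
Arguments post {T M M'} D k.

Lemma add_ffun2E (A B : finType) (V : zmodType) (f g : {ffun A -> {ffun B -> V}}) a b :
  (f + g) a b = f a b + g a b.
Proof. by rewrite !ffunE. Qed.

Lemma add_ffunE (A : finType) (V : zmodType) (f g : {ffun A -> V}) a :
  (f + g) a = f a + g a.
Proof. by rewrite ffunE. Qed.

Section Coinduced.
Variables (T : finGroupType) (L : vectType 'F_2).

Local Notation I := {ffun T -> L}.
Local Notation C k := {ffun {ffun 'I_k -> T} -> I}.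

Definition ltr_fun (g : T) (f : I) : I := [ffun h => f (g * h)%g].
Lemma ltr_is_linear g : linear (ltr_fun g).
Proof. by move=> a f f'; apply/ffunP => h; rewrite !ffunE. Qed.
HB.instance Definition _ g :=
  GRing.isLinear.Build 'F_2 I I _ (ltr_fun g) (ltr_is_linear g).
Fact ltr_key : unit. Proof. by []. Qed.
Definition ltr g : 'End(I) := locked_with ltr_key (linfun (ltr_fun g)).

Lemma ltrE g f h : ltr g f h = f (g * h)%g.
Proof. by rewrite /ltr locked_withE lfunE ffunE. Qed.

Local Notation d k := (dcoef ltr k).

(** The contracting homotopy of a coinduced module: the last entry of the tuple becomes the argument
    of the function. *)
Definition contr k (f : C k.+1) : C k := [ffun t => [ffun h => f (snoc t h) 1%g]].

Lemma contrE k f t h : @contr k f t h = f (snoc t h) 1%g.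
Proof. by rewrite !ffunE. Qed.

Lemma contr_d0 (f : C 0) t h : contr (d 0 f) t h = f t h + f t 1%g.
Proof.
have E i : face i (snoc t h) = t by apply/ffunP => -[].
by rewrite contrE dcoefE snoc_max big_ord_recl big_ord0 addr0 !E add_ffunE ltrE mulg1 addrC.
Qed.

(** The identity [s d + d s = 1] in characteristic 2: all faces of [snoc t h] but the last two
    commute with appending [h], the last one returns [f], and the one before it gives the action
    term. *)
Lemma contr_d k (f : C k.+1) : contr (d k.+1 f) = f + d k (contr f).
Proof.
apply/ffunP => t; apply/ffunP => h.
rewrite contrE dcoefE snoc_max face_snoc_last add_ffunE ltrE mulg1 addrC.
rewrite add_ffun2E; congr (_ + _).
rewrite big_ord_recr /= face_snoc_mul dcoefE !add_ffunE ltrE contrE.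
congr (_ + _); rewrite !sum_ffunE.
by apply: eq_bigr => i _; rewrite contrE face_snoc // -ltnS.
Qed.

Lemma contr0 k : contr (0 : C k.+1) = 0.
Proof. by apply/ffunP => t; apply/ffunP => h; rewrite contrE !ffunE. Qed.

Lemma d0_ker (f : C 0) :
  reflect (forall t h, f t h = f t 1%g) (f \in lker (d 0)).
Proof.
rewrite memv_ker; apply: (iffP eqP) => [f0 t h|f1].
  by apply/eqP; rewrite -subr_eq0 oppFF -contr_d0 f0 contr0 !ffunE.
apply/ffunP => t; apply/ffunP => h; rewrite dcoefE big_ord_recl big_ord0 addr0.
rewrite add_ffunE ltrE f1 [X in _ + X]f1 (_ : face 0 t = face 1 t); last first.
  by apply/ffunP => -[].
by rewrite addFF !ffunE.
Qed.

Lemma d_exact k (f : C k.+1) : f \in lker (d k.+1) -> f = d k (contr f).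
Proof.
rewrite memv_ker => /eqP f0; have := contr_d f; rewrite f0 contr0 => /esym/eqP.
by rewrite addr_eq0 oppFF => /eqP.
Qed.

Definition rtr_fun (u : T) (f : I) : I := [ffun h => f (h * u)%g].
Lemma rtr_is_linear u : linear (rtr_fun u).
Proof. by move=> a f f'; apply/ffunP => h; rewrite !ffunE. Qed.
HB.instance Definition _ u :=
  GRing.isLinear.Build 'F_2 I I _ (rtr_fun u) (rtr_is_linear u).

Lemma rtr_equi u g x : linfun (rtr_fun u) (ltr g x) = ltr g (linfun (rtr_fun u) x).
Proof. by apply/ffunP => h; rewrite lfunE ffunE !ltrE lfunE ffunE mulgA. Qed.

(* The contracting homotopy only sees the value at 1 in the last variable, so
   right translations are used to recover the other values. *)
Lemma dd0 k (f : C k) : d k.+1 (d k f) = 0.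
Proof.
elim: k f => [|k IHk] f.
  suff c0 (e : C 0) : contr (d 1 (d 0 e)) = 0.
    apply/ffunP => t; apply/ffunP => u.
    have := c0 (post (linfun (rtr_fun u)) 0 f).
    rewrite -!(post_dcoef (rtr_equi u)) => /ffunP/(_ (face 2 t))/ffunP/(_ (t ord_max)).
    by rewrite contrE snoc_face_last postE lfunE !ffunE mul1g.
  rewrite contr_d (_ : contr (d 0 e) = e + [ffun t => [ffun=> e t 1%g]]).
    rewrite linearD /= addrA addFF add0r; apply/eqP; rewrite -memv_ker.
    by apply/d0_ker => t h; rewrite !ffunE.
  by apply/ffunP => t; apply/ffunP => h; rewrite contr_d0 add_ffun2E !ffunE.
have c0 (e : C k.+1) : contr (d k.+2 (d k.+1 e)) = 0.
  by rewrite contr_d contr_d linearD /= IHk addr0 addFF.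
apply/ffunP => t; apply/ffunP => u.
have := c0 (post (linfun (rtr_fun u)) k.+1 f).
rewrite -!(post_dcoef (rtr_equi u)) => /ffunP/(_ (face k.+3 t))/ffunP/(_ (t ord_max)).
by rewrite contrE snoc_face_last postE lfunE !ffunE mul1g.
Qed.

Definition cst_fun (A : finType) (V : vectType 'F_2) (x : V) : {ffun A -> V} :=
  [ffun=> x].
Lemma cst_is_linear (A : finType) (V : vectType 'F_2) : linear (@cst_fun A V).
Proof. by move=> a x y; apply/ffunP => t; rewrite !ffunE. Qed.
HB.instance Definition _ (A : finType) (V : vectType 'F_2) :=
  GRing.isLinear.Build 'F_2 V {ffun A -> V} _ (@cst_fun A V) (@cst_is_linear A V).

Definition cst0 : 'Hom(L, C 0) := (linfun (@cst_fun _ _) \o linfun (@cst_fun _ _))%VF.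

Lemma cst0E x : cst0 x = [ffun=> [ffun=> x]].
Proof. by rewrite comp_lfunE !lfunE. Qed.

Lemma dim_cst0 (V : {vspace L}) : \dim (cst0 @: V) = \dim V.
Proof.
apply: limg_dim_eq; apply/eqP; rewrite -subv0; apply/subvP => x.
rewrite memv_cap memv_ker cst0E => /andP[_].
by move/eqP/ffunP/(_ [ffun=> 1%g])/ffunP/(_ 1%g); rewrite !ffunE => ->; exact: mem0v.
Qed.

(** Degree-0 cocycles are left-invariant functions, hence constants. With [d_exact] this is
    Shapiro's lemma for the trivial subgroup. *)
Lemma limg_cst0 : limg cst0 = lker (d 0).
Proof.
apply/vspaceP => f; apply/memv_imgP/d0_ker => [[x _ ->] t h|f1].
  by rewrite cst0E !ffunE.
exists (f [ffun=> 1%g] 1%g); rewrite ?memvf // cst0E.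
apply/ffunP => t; apply/ffunP => h; rewrite !ffunE f1; congr (f _ _).
by apply/ffunP => -[].
Qed.

Lemma dim_ker_d0 : \dim (lker (d 0)) = dim L.
Proof. by rewrite -limg_cst0 dim_cst0 dimvf. Qed.

End Coinduced.

(** * Dimension shifting along an equivariant map out of a coinduced module *)

Section Shift.
Variables (T : finGroupType) (L M : vectType 'F_2) (D : 'Hom({ffun T -> L}, M)).
Variable rho : T -> 'End(M).
Hypothesis D_equi : forall g x, D (@ltr T L g x) = rho g (D x).

Local Notation d k := (dcoef (@ltr T L) k).
Local Notation d' k := (dcoef rho k).
Local Notation K k := (lker (post (T := T) D k)).
Local Notation K' k := (limg (post (T := T) D k)).

Let post_d k f : post D k.+1 (d k f) = d' k (post D k f) := post_dcoef D_equi f.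

(** Let [U] be the cochains whose image under [D] is a cocycle, the domain of the connecting map.
    Its dimension is counted twice: through [d], whose kernel is the cocycles of the coinduced
    module, and through [post D], whose kernel is [K k]. *)
Lemma shift_cocycles k :
  (\dim (K k.+1 :&: lker (d k.+1)) + \dim (lker (d k))
   = \dim (K' k :&: lker (d' k)) + \dim (K k))%N.
Proof.
have [U UP] : exists U : {vspace {ffun {ffun 'I_k -> T} -> {ffun T -> L}}},
    forall f, f \in U <-> d' k (post D k f) = 0.
  exists (lker (d' k \o post D k)%VF) => f.
  by split=> [/lkerP|f0]; [|apply/lkerP]; rewrite comp_lfunE.
rewrite -(_ : d k @: U = K k.+1 :&: lker (d k.+1))%VS; last first.
  apply/vspaceP => f; rewrite memv_cap; apply/memv_imgP/andP => [[e /UP Ue ->]|].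
    by split; apply/lkerP; [rewrite post_d | exact: dd0].
  case=> /lkerP Kf /d_exact Zf; exists (contr f); last exact: Zf.
  by apply/UP; rewrite -post_d -Zf.
rewrite -(_ : post D k @: U = K' k :&: lker (d' k))%VS; last first.
  apply/vspaceP => f; rewrite memv_cap; apply/memv_imgP/andP => [[e /UP Ue ->]|].
    by split; [exact/memv_img/memvf | apply/lkerP].
  by case=> /memv_imgP[e _ ->] /lkerP Ze; exists e => //; apply/UP.
have <- : (U :&: lker (d k))%VS = lker (d k).
  apply/capv_idPr/subvP => f /lkerP f0; apply/UP.
  by rewrite -post_d f0 linear0.
have <- : (U :&: K k)%VS = K k.
  by apply/capv_idPr/subvP => f /lkerP f0; apply/UP; rewrite f0 linear0.
by rewrite addnC limg_ker_dim addnC limg_ker_dim.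
Qed.

Lemma dim_coboundaries k :
  (\dim (K k :&: lker (d k)) + \dim (d k @: K k) = \dim (K k))%N.
Proof. exact: limg_ker_dim. Qed.

(** A coboundary with values in the image of [D] is [D] of a coboundary, and in positive degree the
    coboundaries of a coinduced module are all its cocycles. *)
Lemma shift_coboundaries k :
  (\dim (K k.+1 :&: lker (d k.+1)) + \dim (d' k @: K' k)
   = \dim (lker (d k.+1)))%N.
Proof.
have <- : (post D k.+1 @: lker (d k.+1) = d' k @: K' k)%VS.
  apply/vspaceP => f; apply/memv_imgP/memv_imgP => [[e /d_exact Ze ->]|].
    exists (post D k (contr e)); first exact/memv_img/memvf.
    by rewrite -post_d -Ze.
  case=> _ /memv_imgP[e _ ->] ->; exists (d k e); last by rewrite post_d.
  by apply/lkerP; apply: dd0.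
by rewrite capvC limg_ker_dim.
Qed.

(** Cohomology of [lker D] in degree [k+2] has the dimension of that of [limg D] in degree [k+1],
    written additively to avoid truncated subtraction. *)
Lemma shift_pos k :
  (\dim (K k.+2 :&: lker (d k.+2)) + \dim (d' k @: K' k)
   = \dim (K' k.+1 :&: lker (d' k.+1)) + \dim (d k.+1 @: K k.+1))%N.
Proof.
have arith (A Zi Z' B Bk ZK Kk : nat) :
    (A + Zi = Z' + Kk -> ZK + Bk = Kk -> ZK + B = Zi -> A + B = Z' + Bk)%N by lia.
exact: arith (shift_cocycles k.+1) (dim_coboundaries k.+1) (shift_coboundaries k).
Qed.

(** The start of the long exact sequence, where the invariants of the coinduced module, a copy of
    [L], intervene: [h^1(ker D) = h^0(im D) - dim L + h^0(ker D)]. *)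
Lemma shift_zero :
  (\dim (K 1 :&: lker (d 1)) + dim L
   = \dim (K' 0 :&: lker (d' 0)) + \dim (K 0 :&: lker (d 0)) + \dim (d 0 @: K 0))%N.
Proof.
by rewrite -addnA dim_coboundaries -(dim_ker_d0 T L); apply: shift_cocycles.
Qed.

End Shift.

(** * The matrices of the statement as the bar complex with trivial coefficients *)

Section BarComplex.
Variable T : finGroupType.

Local Notation C k := {ffun {ffun 'I_k -> T} -> ('F_2)^o}.
Local Notation d k := (dcoef (fun _ : T => \1%VF : 'End(('F_2)^o)) k).

Lemma d_trivE k (f : C k) t : d k f t = \sum_(i < k.+2) f (face i t).
Proof. by rewrite dcoefE id_lfunE [RHS]big_ord_recr. Qed.

(** [row_base A] has the same row space as [A], and multiplication by it is injective on a space of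
    dimension [\rank A]. *)
Lemma rank_limg (m n : nat) (A : 'M['F_2]_(m, n)) :
  \rank A = \dim (limg (linfun (mulmxr A : {linear 'rV_m -> 'rV_n}))).
Proof.
have -> : limg (linfun (mulmxr A : {linear 'rV_m -> 'rV_n}))
  = limg (linfun (mulmxr (row_base A) : {linear 'rV_(\rank A) -> 'rV_n})).
  apply/vspaceP => v; apply/memv_imgP/memv_imgP => [] [u _ ->]; rewrite lfunE /=.
    have /submxP[w ->] : (u *m A <= row_base A)%MS by rewrite eq_row_base submxMl.
    by exists w; rewrite ?memvf // lfunE.
  have /submxP[w ->] : (u *m row_base A <= A)%MS by rewrite -(eq_row_base A) submxMl.
  by exists w; rewrite ?memvf // lfunE.
rewrite limg_dim_eq; first by rewrite dimvf dim_matrix mul1r.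
apply/eqP; rewrite -subv0; apply/subvP => u; rewrite memv_cap memvf memv_ker lfunE /=.
by rewrite mulmx_free_eq0 ?row_base_free // => /eqP->; apply: mem0v.
Qed.

Lemma dim_ffun_F2 (A : finType) : \dim {:{ffun A -> ('F_2)^o}} = #|A|.
Proof. by rewrite dimvf /dim /= muln1. Qed.

Definition row_of_fun (A : finType) (f : {ffun A -> ('F_2)^o}) : 'rV['F_2]_#|A| :=
  \row_i f (enum_val i).
Lemma row_of_fun_is_linear A : linear (@row_of_fun A).
Proof. by move=> a f g; apply/rowP => i; rewrite !mxE !ffunE. Qed.
HB.instance Definition _ A :=
  GRing.isLinear.Build 'F_2 _ _ _ (@row_of_fun A) (@row_of_fun_is_linear A).

Definition fun_of_row (A : finType) (r : 'rV['F_2]_#|A|) : {ffun A -> ('F_2)^o} :=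
  [ffun x => r 0 (enum_rank x)].

Lemma row_of_funK A : cancel (@row_of_fun A) (@fun_of_row A).
Proof. by move=> f; apply/ffunP => x; rewrite ffunE mxE enum_rankK. Qed.

Lemma fun_of_rowK A : cancel (@fun_of_row A) (@row_of_fun A).
Proof. by move=> r; apply/rowP => i; rewrite mxE ffunE enum_valK. Qed.

Lemma row_of_fun_cobd k (f : C k) : row_of_fun f *m cobd T k = row_of_fun (d k f).
Proof.
apply/rowP => j; rewrite !mxE d_trivE.
under eq_bigr do rewrite !mxE mulr_sumr.
rewrite exchange_big; apply: eq_bigr => i _ /=.
rewrite (bigD1 (enum_rank (face i (enum_val j)))) //= enum_rankK eqxx mulr1.
rewrite big1 ?addr0 // => s s_neq; rewrite (_ : (_ == _) = false) ?mulr0 //.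
by apply: contraNF s_neq => /eqP->; rewrite enum_valK.
Qed.

Lemma rank_cobd k : \rank (cobd T k) = \dim (limg (d k)).
Proof.
rewrite rank_limg -[RHS](@limg_dim_eq _ _ _ (linfun (@row_of_fun _))); last first.
  apply/eqP; rewrite -subv0; apply/subvP => f; rewrite memv_cap memv_ker lfunE /=.
  case/andP=> _ /eqP f0; rewrite memv0 -(row_of_funK f) f0 -[0 in X in _ == X](row_of_funK 0).
  by rewrite linear0.
congr (\dim _); apply/vspaceP => r.
apply/memv_imgP/memv_imgP => [[u _ ->]|[_ /memv_imgP[f _ ->] ->]].
  exists (d k (fun_of_row u)); first by rewrite memv_img ?memvf.
  by rewrite !lfunE /= -row_of_fun_cobd fun_of_rowK.
by exists (row_of_fun f); rewrite ?memvf // !lfunE /= row_of_fun_cobd.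
Qed.

Lemma dim_ker_bar k :
  \dim (lker (d k)) = (#|{ffun 'I_k -> T}| - \dim (limg (d k)))%N.
Proof.
have := limg_ker_dim (d k) fullv; rewrite capfv dim_ffun_F2 => <-.
by rewrite addnK.
Qed.

Lemma coh_dimS k : coh_dim T k.+1 = (\dim (lker (d k.+1)) - \dim (limg (d k)))%N.
Proof. by rewrite /coh_dim !rank_cobd dim_ker_bar. Qed.

Lemma coh_dim0 : coh_dim T 0 = 1.
Proof.
rewrite /coh_dim subn0 (_ : cobd T 0 = 0) ?mxrank0 ?card_ffun ?card_ord ?expn0 //.
apply/matrixP => s t; rewrite !mxE 2!big_ord_recl big_ord0 addr0.
rewrite (_ : face 0 _ = face 1 (enum_val t)) ?(addFF (_ : ('F_2)^o)) //.
by apply/ffunP => -[].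
Qed.

End BarComplex.

(** Cocycles and coboundaries are [z], [b] for the constants, [y], [c] for [limg D0], and [u1], [a1]
    for [limg D1]. The invariants of the successive images are [v1], [v2], [e]; [l1], [l2] are
    dimensions of coefficient spaces, and [m], [w] those of [limg D1] and [W]. *)
Fact low_degree_arith (z1 z2 z3 b1 b2 b3 y1 y2 c1 c2 u1 a1 e v1 v2 l1 l2 m w : nat) :
  (z1 + 1 = v1 + 1 + b1 -> z2 + c1 = y1 + b2 -> z3 + c2 = y2 + b3 ->
   y1 + l1 = v2 + v1 + c1 -> y2 + a1 = u1 + c2 -> u1 + l2 = e + v2 + a1 ->
   e + m = w -> b1 <= z1 -> b2 <= z2 -> b3 <= z3 ->
  [/\ z1 - b1 = v1, z2 - b2 + l1 = v2 + v1 & z3 - b3 + l2 + m = w + v2])%N.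
Proof. by move=> *; split; lia. Qed.

(** * Low cohomology from the beginning of a resolution by coinduced modules *)

Section LowDegree.
Variables (T : finGroupType) (L0 L1 L2 : vectType 'F_2).
Local Notation I L := {ffun T -> L}.
Variables (D0 : 'Hom(I L0, I L1)) (D1 : 'Hom(I L1, I L2)).
Hypothesis D0_equi : forall g f, D0 (ltr L0 g f) = ltr L1 g (D0 f).
Hypothesis D1_equi : forall g f, D1 (ltr L1 g f) = ltr L2 g (D1 f).
Hypothesis dimL0 : dim L0 = 1.
Hypothesis ker_D0 : forall f, reflect (exists c, f = [ffun=> c]) (f \in lker D0).
Hypothesis ker_D1 : lker D1 = limg D0.
Variables (V1 : {vspace L1}) (V2 : {vspace L2}) (W : {vspace I L2}).
Hypothesis V1P : forall c, (c \in V1) = ([ffun=> c] \in limg D0).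
Hypothesis V2P : forall c, (c \in V2) = ([ffun=> c] \in limg D1).
Hypothesis WP : forall w, reflect (forall g, ltr L2 g w + w \in limg D1) (w \in W).

Lemma lker_limg_post (A B E : vectType 'F_2) (f : 'Hom(A, B)) (g : 'Hom(B, E)) k :
  lker g = limg f -> lker (post (T := T) g k) = limg (post f k).
Proof.
by move=> fg; apply/vspaceP => e; apply/lker_postP/limg_postP; rewrite fg.
Qed.

Lemma dim_invariants (L L' : vectType 'F_2) (E : 'Hom(I L', I L)) (V : {vspace L}) :
    (forall c, (c \in V) = ([ffun=> c] \in limg E)) ->
  \dim (limg (post E 0) :&: lker (dcoef (@ltr T L) 0)) = \dim V.
Proof.
move=> VP; rewrite -limg_cst0 -(dim_cst0 T V); congr (\dim _).
apply/vspaceP => f; rewrite memv_cap.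
apply/andP/memv_imgP => [[/limg_postP fE /memv_imgP[c _ fc]]|[c cV ->]].
  by exists c; rewrite // VP; have := fE [ffun=> 1%g]; rewrite fc cst0E ffunE.
rewrite memv_img ?memvf //; split=> //; apply/limg_postP => t.
by rewrite cst0E ffunE -VP.
Qed.

Local Notation M2 := (limg D1).
(* The quotient of [I L2] by [M2], realised as a complement. *)
Let D2 : 'End(I L2) := (\1 - projv M2)%VF.
Let rho2 g : 'End(I L2) := (D2 \o ltr L2 g)%VF.

Let lker_D2 : lker D2 = M2.
Proof.
apply/vspaceP => w; rewrite memv_ker add_lfunE opp_lfunE id_lfunE subr_eq0.
by apply/eqP/idP => [->|/projv_id ->]; first exact: memv_proj.
Qed.

Let ltr_M2 g w : w \in M2 -> ltr L2 g w \in M2.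
Proof. by case/memv_imgP=> e _ ->; rewrite -D1_equi memv_img ?memvf. Qed.

Let D2_equi g w : D2 (ltr L2 g w) = rho2 g (D2 w).
Proof.
have DM x : x \in M2 -> D2 x = 0 by rewrite -lker_D2 memv_ker => /eqP.
rewrite comp_lfunE [D2 w]add_lfunE opp_lfunE id_lfunE linearB linearB /=.
by rewrite [X in _ - X]DM ?subr0 //; apply/ltr_M2/memv_proj.
Qed.

(** [W] maps onto the invariants of the quotient, and the kernel of this map is [M2]. *)
Let dim_quotient : (\dim (limg (post D2 0) :&: lker (dcoef rho2 0)) + \dim M2)%N = \dim W.
Proof.
pose psi : 'Hom(I L2, {ffun {ffun 'I_0 -> T} -> I L2}) := (linfun (@cst_fun _ _) \o D2)%VF.
have psiE w : psi w = [ffun=> D2 w] by rewrite comp_lfunE lfunE.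
have WM2 : (W :&: lker psi)%VS = M2.
  apply/vspaceP => w; rewrite memv_cap memv_ker psiE.
  apply/andP/idP => [[_ /eqP/ffunP/(_ [ffun=> 1%g])]|wM].
    by rewrite !ffunE => w0; rewrite -lker_D2 memv_ker w0.
  split; first by apply/WP => g; rewrite rpredD ?ltr_M2.
  by apply/eqP/ffunP => t; rewrite !ffunE; apply/eqP; rewrite -memv_ker lker_D2.
have dW w t : dcoef rho2 0 (psi w) t = D2 (ltr L2 (t ord_max) w + w).
  by rewrite dcoefE big_ord_recl big_ord0 addr0 psiE !ffunE -D2_equi linearD addrC.
rewrite -(limg_ker_dim psi W) WM2 addnC; congr (_ + \dim _)%N.
apply/vspaceP => f; rewrite memv_cap; apply/andP/memv_imgP.
  case=> /memv_imgP[e _ ->]; have -> : post D2 0 e = psi (e [ffun=> 1%g]).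
    apply/ffunP => t; rewrite postE psiE ffunE; congr (D2 (e _)).
    by apply/ffunP => -[].
  rewrite memv_ker => /eqP/ffunP d0; exists (e [ffun=> 1%g]) => //.
  apply/WP => g; have := d0 [ffun=> g].
  by rewrite dW ffunE ffunE -lker_D2 memv_ker => ->.
case=> w /WP wW ->; split.
  by apply/limg_postP => t; rewrite psiE ffunE memv_img ?memvf.
rewrite memv_ker; apply/eqP/ffunP => t; rewrite dW [RHS]ffunE; apply/eqP.
by rewrite -memv_ker lker_D2.
Qed.

Lemma quotient_module : exists (E : 'End(I L2)) (rho : T -> 'End(I L2)),
  [/\ lker E = M2, forall g w, E (ltr L2 g w) = rho g (E w) &
     (\dim (limg (post E 0) :&: lker (dcoef rho 0)) + \dim M2)%N = \dim W].
Proof. by exists D2, rho2. Qed.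

Local Notation d k := (dcoef (@ltr T L0) k).
Local Notation bar k := (dcoef (fun _ : T => \1%VF : 'End(('F_2)^o)) k).
Local Notation K k := (lker (post (T := T) D0 k)).

Lemma constants_model : exists eta : 'Hom(('F_2)^o, I L0),
  [/\ forall g a, eta a = ltr L0 g (eta a),
      forall a, eta a = 0 -> a = 0 & limg eta = lker D0].
Proof.
pose c0 := vpick {:L0}.
have c0_neq0 : c0 != 0 by rewrite vpick0 -dimv_eq0 dimvf dimL0.
have c0P c : exists a : 'F_2, c = a *: c0.
  apply/vlineP; rewrite (_ : <[c0]>%VS = fullv) ?memvf //; apply/eqP.
  by rewrite eqEdim subvf dim_vline c0_neq0 dimvf dimL0.
pose u (a : ('F_2)^o) : I L0 := [ffun=> a *: c0].
have u_lin : linear u by move=> a x y; apply/ffunP => h; rewrite !ffunE scalerDl scalerA.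
pose uM := GRing.isLinear.Build 'F_2 _ _ _ u u_lin.
pose uL : {linear ('F_2)^o -> I L0} := HB.pack u uM.
exists (linfun uL); split=> [g a|a|].
- by apply/ffunP => h; rewrite ltrE !lfunE /= !ffunE.
- rewrite lfunE /= => /ffunP/(_ 1%g)/eqP; rewrite !ffunE scaler_eq0 (negPf c0_neq0) orbF.
  by move/eqP.
apply/vspaceP => f; apply/memv_imgP/ker_D0 => [[a _ ->]|[c ->]].
  by exists (a *: c0); rewrite lfunE.
by have [a ->] := c0P c; exists a; rewrite ?memvf // lfunE.
Qed.

Lemma bar_constants k :
  [/\ \dim (lker (bar k)) = \dim (K k :&: lker (d k)),
      \dim (limg (bar k)) = \dim (d k @: K k)
    & (limg (bar k) <= lker (bar k.+1))%VS].
Proof.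
have [eta [eta_inv eta_inj eta_lim]] := constants_model.
have eta_bar m (f : {ffun {ffun 'I_m -> T} -> ('F_2)^o}) :
    d m (post eta m f) = post eta m.+1 (bar m f).
  rewrite (@post_dcoef _ _ _ _ _ (@ltr T L0)) // => g a.
  by rewrite id_lfunE -eta_inv.
have inj m (f : {ffun {ffun 'I_m -> T} -> ('F_2)^o}) : post eta m f = 0 -> f = 0.
  move/ffunP => f0; apply/ffunP => t; rewrite [RHS]ffunE; apply: eta_inj.
  by have := f0 t; rewrite postE => ->; rewrite ffunE.
have dim_post m (U : {vspace {ffun {ffun 'I_m -> T} -> ('F_2)^o}}) : \dim (post eta m @: U) = \dim U.
  apply/limg_dim_eq/eqP; rewrite -subv0; apply/subvP => f.
  by rewrite memv_cap memv0 => /andP[_ /lkerP f0]; apply/eqP; exact: inj f0.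
have Kk : K k = limg (post eta k) by apply: lker_limg_post; rewrite eta_lim.
split.
- rewrite Kk -(dim_post k); congr (\dim _); apply/vspaceP => f; rewrite memv_cap.
  apply/memv_imgP/andP => [[e /lkerP e0 ->]|[/memv_imgP[e _ ->] /lkerP]].
    by split; [exact/memv_img/memvf | apply/lkerP; rewrite eta_bar e0 linear0].
  by rewrite eta_bar => e0; exists e => //; apply/lkerP; exact: inj e0.
- rewrite Kk -(dim_post k.+1); congr (\dim _); rewrite -!limg_comp.
  by apply: eq_in_limg => f _; rewrite !comp_lfunE eta_bar.
apply/subvP => _ /memv_imgP[f _ ->]; apply/lkerP; apply: inj.
by rewrite -!eta_bar; apply: dd0.
Qed.

(** The degree is lowered along [H^3(F_2) = H^2(im D0) = H^1(im D1)], and the last term comes from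
    the invariants of [I L2] modulo [im D1]. Each call to [shift_zero] brings in the dimension of
    one coefficient space. *)
Theorem low_degree_cohomology :
  [/\ coh_dim T 1 = \dim V1,
       (coh_dim T 2 + dim L1 = \dim V2 + \dim V1)%N
     & (coh_dim T 3 + dim L2 + \dim (limg D1) = \dim W + \dim V2)%N].
Proof.
have dZ0 : \dim (K 0 :&: lker (d 0)) = 1.
  rewrite -dimL0 -(dim_ker_d0 T L0); congr (\dim _); apply/capv_idPr.
  apply/subvP => f; rewrite -limg_cst0 => /memv_imgP[c _ ->].
  by apply/lker_postP => t; apply/ker_D0; exists c; rewrite cst0E ffunE.
have [E [rho [ker_E E_equi dimE]]] := quotient_module.
have E1 k : lker (post (T := T) D1 k) = limg (post D0 k) by apply: lker_limg_post.
have E2 k : lker (post (T := T) E k) = limg (post D1 k) by apply: lker_limg_post.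
have s00 := shift_zero D0_equi; rewrite (dim_invariants V1P) dZ0 dimL0 in s00.
have s01 := shift_pos D0_equi 0; have s02 := shift_pos D0_equi 1.
have := shift_zero D1_equi; rewrite (E1 1%N) (E1 0%N) (dim_invariants V1P) (dim_invariants V2P) => s10.
have := shift_pos D1_equi 0; rewrite (E1 2%N) (E1 1%N) => s11.
have := shift_zero E_equi; rewrite (E2 1%N) (E2 0%N) (dim_invariants V2P) => s20.
have [_ b0' /dimvS le0] := bar_constants 0; have [b1 b1' /dimvS le1] := bar_constants 1.
have [b2 b2' /dimvS le2] := bar_constants 2; have [b3 _ _] := bar_constants 3.
rewrite !coh_dimS; move: le0 le1 le2; rewrite b1 b2 b3 b0' b1' b2'.
move: s00 s01 s02 s10 s11 s20 dimE.
exact: low_degree_arith.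
Qed.

End LowDegree.

(** * Koszul complexes over a polynomial ring *)

Section Division.
Variable N : nat.
Local Notation R := {mpoly 'F_2[N]}.
Implicit Types p : R.

Definition mfilter (P : pred 'X_{1..N}) p : R :=
  \sum_(m <- msupp p | P m) p@_m *: 'X_[m].

Lemma mcoeff_mfilter P p m : (mfilter P p)@_m = p@_m *+ P m.
Proof.
rewrite raddf_sum /= (eq_bigr (fun m' => p@_m *+ (m' == m))); last first.
  move=> m' _; rewrite mcoeffZ mcoeffX.
  by case: eqP => [->|]; rewrite ?mulr1 ?mulr0.
case: (boolP (m \in msupp p)) => [mp|mp]; last first.
  by rewrite (memN_msupp_eq0 mp) mul0rn big1 // => i _; rewrite mul0rn.
rewrite big_mkcond (bigD1_seq m) ?msupp_uniq //= eqxx mulr1n.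
rewrite big1 ?addr0 => [|m' /negPf ne]; last by rewrite ne mulr0n if_same.
by case: ifP.
Qed.

Definition mrem (k : 'I_N) p : R := mfilter (fun m => m k == 0) p.
Definition mquo (k : 'I_N) p : R := \sum_(m <- msupp p | m k != 0) p@_m *: 'X_[m - U_(k)].

Lemma mdiv_eq k p : p = 'X_k * mquo k p + mrem k p.
Proof.
rewrite {1}[p]mpolyE (bigID (fun m : 'X_{1..N} => m k != 0)) /= mulr_sumr; congr (_ + _).
  apply: eq_bigr => m mk; rewrite -scalerAr -mpolyXD addmC submK //.
  by rewrite lep1mP.
by apply: eq_bigl => m; rewrite negbK.
Qed.

Lemma mcoeff_mrem k p m : (mrem k p)@_m = p@_m *+ (m k == 0).
Proof. exact: mcoeff_mfilter. Qed.

Lemma mfilterD P : {morph mfilter P : p q / p + q}.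
Proof. by move=> p q; apply/mpolyP => m; rewrite mcoeffD !mcoeff_mfilter mcoeffD mulrnDl. Qed.

Lemma mfilter0 P : mfilter P 0 = 0.
Proof. by apply/mpolyP => m; rewrite mcoeff_mfilter mcoeff0 mul0rn. Qed.

Lemma mfilter_sum P I (s : seq I) (Q : pred I) F :
  mfilter P (\sum_(i <- s | Q i) F i) = \sum_(i <- s | Q i) mfilter P (F i).
Proof. exact: (big_morph _ (mfilterD P) (mfilter0 P)). Qed.
End Division.

(** For [m i = 0] the truncated difference [m - U_(i)] is [m] itself; the boolean factor discards
    that value. *)
Lemma mcoeff_mulX N (R : comNzRingType) (i : 'I_N) (p : {mpoly R[N]}) m :
  ('X_i * p)@_m = p@_(m - U_(i)) *+ (m i != 0).
Proof.
case: (boolP (m i != 0)) => mi.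
  have mE : m = (U_(i) + (m - U_(i)))%MM by rewrite addmC submK // lep1mP.
  by rewrite [in LHS]mE mulrC mcoeffMX mulr1n.
rewrite mulr0n [p]mpolyE mulr_sumr raddf_sum /= big1 // => k _.
rewrite -scalerAr -mpolyXD mcoeffZ mcoeffX; case: eqP => [mE|]; rewrite ?mulr0 //.
by case/eqP: mi; rewrite -mE mnmDE mnm1E eqxx.
Qed.

Section Koszul.
Variables (N m : nat) (iota : 'I_m -> 'I_N).
Hypothesis iota_inj : injective iota.
Local Notation R := {mpoly 'F_2[N]}.
Variables (Om : Type) (tau : 'I_m -> Om -> Om) (v : 'I_m -> Om -> 'F_2).
Hypothesis tauK : forall i w, tau i (tau i w) = w.
Hypothesis tauC : forall i j w, tau i (tau j w) = tau j (tau i w).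
Hypothesis v_tau : forall i j w, v i (tau j w) = v i w + (i == j)%:R.
Implicit Types f g s : Om -> R.

(** As [(tau_j + 1)^2 = 0], this squares to zero with polynomial variables. It is the complex behind
    the polynomial cohomology ring of an elementary abelian 2-group. *)
Definition koszul f w : R := \sum_j 'X_(iota j) * (f (tau j w) + f w).

Lemma koszulD f g w : koszul (fun u => f u + g u) w = koszul f w + koszul g w.
Proof.
rewrite -big_split; apply: eq_bigr => j _ /=; ring.
Qed.

Lemma koszulX i f w : koszul (fun u => 'X_(iota i) * f u) w = 'X_(iota i) * koszul f w.
Proof.
rewrite mulr_sumr; apply: eq_bigr => j _ /=; ring.
Qed.

Lemma koszul_tau i f w : koszul (fun u => f (tau i u)) w = koszul f (tau i w).
Proof. by apply: eq_bigr => j _; rewrite tauC. Qed.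

(** A Leibniz rule: [v i] changes, by 1, under [tau i] alone, and this jump leaves the extra term
    [X_i f]. *)
Lemma koszul_v i f w : (forall u, f (tau i u) = f u) ->
  koszul (fun u => v i u *: f u) w = v i w *: koszul f w + 'X_(iota i) * f w.
Proof.
move=> fi; rewrite /koszul scaler_sumr (bigD1 i) //= [in RHS](bigD1 i) //=.
rewrite v_tau eqxx fi addFF mulr0 scaler0 add0r addrC scalerDl scale1r.
rewrite [_ + f w]addrC -addrA addFF addr0; congr (_ + _).
apply: eq_bigr => j ji; rewrite v_tau eq_sym (negPf ji) addr0 -scalerDr.
by rewrite -scalerAr.
Qed.

Definition var_free k (p : R) :=
  forall (j : 'I_m) (mu : 'X_{1..N}), (j < k)%N -> mu (iota j) != 0 -> p@_mu = 0.

(** Only directions below [k] contribute, and each contributes a multiple of its own variable. *)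
Lemma koszul_coef k g w (mu : 'X_{1..N}) :
    (forall j : 'I_m, (k <= j)%N -> forall u, g (tau j u) = g u) ->
    (forall j : 'I_m, (j < k)%N -> mu (iota j) = 0) ->
  (koszul g w)@_mu = 0.
Proof.
move=> g_inv mu0; rewrite raddf_sum /= big1 // => j _.
case: (ltnP j k) => [/mu0 mu_j|/g_inv ->]; last by rewrite addFF mulr0 mcoeff0.
by rewrite mcoeff_mulX mu_j mulr0n.
Qed.

(* Induction on the number [k] of variables involved: writing
   [f = f0 + v_k * f1] with [f1 = tau_k f + f], both [f0] and [f1] are
   independent of the [k]-th coordinate. *)
Lemma koszul_exact_rec k f : (k <= m)%N ->
    (forall j : 'I_m, (k <= j)%N -> forall u, f (tau j u) = f u) ->
    (forall w, koszul f w = 0) ->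
  exists g s, [/\ forall w, f w = koszul g w + s w,
    forall j : 'I_m, (k <= j)%N -> forall u, g (tau j u) = g u,
    forall j u, s (tau j u) = s u & forall w, var_free k (s w)].
Proof.
elim: k f => [|k IHk] f le_km f_inv f0.
  exists (fun=> 0), f; split=> // [w|j u]; last exact: f_inv.
  by rewrite /koszul big1 ?add0r // => j _; rewrite mulr0.
pose i := Ordinal le_km; have lt_km := ltnW le_km.
pose f1 w := f (tau i w) + f w; pose f_0 w := f w + v i w *: f1 w.
have f1_i u : f1 (tau i u) = f1 u by rewrite /f1 tauK addrC.
have geq (j : 'I_m) : (k <= j)%N -> j = i \/ (k.+1 <= j)%N.
  by rewrite leq_eqVlt => /orP[/eqP kj|]; [left; apply/val_inj | right].
have f1_inv (j : 'I_m) : (k <= j)%N -> forall u, f1 (tau j u) = f1 u.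
  by case/geq => [-> //|le_kj] u; rewrite /f1 tauC !(f_inv j).
have v_inv (j : 'I_m) : (k.+1 <= j)%N -> forall u, v i (tau j u) = v i u.
  by move=> le_kj u; rewrite v_tau (_ : i == j = false) ?addr0 //; apply/ltn_eqF.
have Tf1 w : koszul f1 w = 0 by rewrite koszulD koszul_tau !f0 addr0.
have f_0_inv (j : 'I_m) : (k <= j)%N -> forall u, f_0 (tau j u) = f_0 u.
  case/geq => [-> u|le_kj u]; last by rewrite /f_0 f_inv // v_inv // f1_inv // ltnW.
  rewrite /f_0 f1_i v_tau eqxx scalerDl scale1r /f1.
  by rewrite [_ *: _ + _]addrC !addrA addFF add0r.
have Tf_0 w : koszul f_0 w = 'X_(iota i) * f1 w.
  by rewrite koszulD koszul_v // f0 Tf1 scaler0 !add0r.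
have [g1 [s1 [f1E g1_inv s1_inv s1_free]]] := IHk _ lt_km f1_inv Tf1.
(* Adding [X_i g1] cancels the boundary part of [X_i f1], so that [koszul h] is just [X_i s1]. *)
pose h w := f_0 w + 'X_(iota i) * g1 w.
have h_inv (j : 'I_m) : (k <= j)%N -> forall u, h (tau j u) = h u.
  by move=> le_kj u; rewrite /h f_0_inv // g1_inv.
have Th w : koszul h w = 'X_(iota i) * s1 w.
  by rewrite koszulD koszulX Tf_0 f1E mulrDr addrAC addFF add0r.
(* [X_i s1 = koszul h] lies in the ideal of the variables below [k], while [s1] contains none of
   them. *)
have s1_0 w : s1 w = 0.
  apply/mpolyP => mu; rewrite mcoeff0.
  case: (boolP [exists j : 'I_m, (j < k)%N && (mu (iota j) != 0)]) => [/existsP[j /andP[]]|].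
    exact: s1_free.
  move=> /existsPn mu0; have {mu0} mu0 (j : 'I_m) : (j < k)%N -> mu (iota j) = 0.
    by move=> lt_jk; have := mu0 j; rewrite lt_jk negbK => /eqP.
  have := @koszul_coef k h w (mu + U_(iota i))%MM h_inv; rewrite Th mcoeff_mulX.
  rewrite mnmDE mnm1E eqxx addn1 addmK mulr1n; apply => j lt_jk.
  rewrite mnmDE mu0 // mnm1E (inj_eq iota_inj) (_ : (i == j) = false) //.
  by apply/eqP => ij; rewrite -ij ltnn in lt_jk.
have Th0 w : koszul h w = 0 by rewrite Th s1_0 mulr0.
have [g0 [s0 [hE g0_inv s0_inv s0_free]]] := IHk _ lt_km h_inv Th0.
(* The summand with [mquo] makes a boundary of the multiples of [X_i] in the invariant [s0]; only
   the remainder, free of [X_i] too, stays outside. *)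
exists (fun w => (g0 w + v i w *: g1 w) + v i w *: mquo (iota i) (s0 w)).
exists (fun w => mrem (iota i) (s0 w)); split=> [w|j le_kj u|j u|w j mu].
- rewrite !koszulD !koszul_v => [||u]; [|by move=> u; rewrite s0_inv|exact: g1_inv].
  have -> : koszul (fun u => mquo (iota i) (s0 u)) w = 0.
    by rewrite /koszul big1 // => j _ /=; rewrite s0_inv addFF mulr0.
  rewrite scaler0 add0r -!addrA -mdiv_eq.
  have -> : f w = h w + 'X_(iota i) * g1 w + v i w *: f1 w.
    by rewrite /h /f_0 -!addrA addFK addFF addr0.
  rewrite hE f1E s1_0 addr0 -!addrA; congr (_ + _).
  by rewrite addrC [X in X + _]addrC -addrA.
- by rewrite g0_inv ?g1_inv ?v_inv ?s0_inv // ltnW.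
- by rewrite s0_inv.
move=> lt_jk mu_j; rewrite mcoeff_mrem; case: (mu (iota i) =P 0) => // mu_i.
rewrite mulr1n; move: lt_jk; rewrite ltnS leq_eqVlt => /orP[/eqP jk|lt_jk].
  by rewrite (_ : j = i) ?mu_i in mu_j; last exact/val_inj.
exact: s0_free mu_j.
Qed.

End Koszul.

Lemma mfilter_mulX N (P P' : pred 'X_{1..N}) i (p : {mpoly 'F_2[N]}) :
  (forall m, P (m + U_(i))%MM = P' m) -> mfilter P ('X_i * p) = 'X_i * mfilter P' p.
Proof.
move=> PP'; apply/mpolyP => m; rewrite mcoeff_mfilter !mcoeff_mulX mcoeff_mfilter.
case: (boolP (m i != 0)) => mi; rewrite ?mulr0n ?mul0rn // !mulr1n.
by rewrite -PP' submK ?lep1mP.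
Qed.

(** * Bidegrees in the x-variables and the e-variables *)

Section Bigrading.
Variables n r : nat.
Local Notation R := {mpoly 'F_2[n + r]}.
Local Notation x_ i := (lshift r i).
Local Notation e_ a := (rshift n a).
Implicit Types (f : R) (m : 'X_{1..n + r}).

Definition xdeg m := (\sum_(i < n) m (x_ i))%N.
Definition edeg m := (\sum_(a < r) m (e_ a))%N.

Lemma mdeg_bi m : mdeg m = (xdeg m + edeg m)%N.
Proof. by rewrite mdegE big_split_ord. Qed.

Lemma xdegD m m' : xdeg (m + m')%MM = (xdeg m + xdeg m')%N.
Proof. by rewrite -big_split; apply: eq_bigr => i _; rewrite mnmDE. Qed.
Lemma edegD m m' : edeg (m + m')%MM = (edeg m + edeg m')%N.
Proof. by rewrite -big_split; apply: eq_bigr => i _; rewrite mnmDE. Qed.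

Lemma xdeg_x i : xdeg U_(x_ i)%MM = 1.
Proof.
rewrite /xdeg (bigD1 i) //= mnm1E eqxx big1 // => j ji.
by rewrite mnm1E (inj_eq (@lshift_inj _ _)) eq_sym (negPf ji).
Qed.
Lemma xdeg_e a : xdeg U_(e_ a)%MM = 0.
Proof. by rewrite /xdeg big1 // => j _; rewrite mnm1E eq_rlshift. Qed.
Lemma edeg_x i : edeg U_(x_ i)%MM = 0.
Proof. by rewrite /edeg big1 // => j _; rewrite mnm1E eq_lrshift. Qed.
Lemma edeg_e a : edeg U_(e_ a)%MM = 1.
Proof.
rewrite /edeg (bigD1 a) //= mnm1E eqxx big1 // => b ba.
by rewrite mnm1E (inj_eq (@rshift_inj _ _)) eq_sym (negPf ba).
Qed.

Definition bideg (p q : nat) m := (xdeg m == p) && (edeg m == q).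
Definition bihom (p q : nat) f := forall m, f@_m != 0 -> bideg p q m.
Definition bipart (p q : nat) f := mfilter (bideg p q) f.

Lemma bihomP p q f : bihom p q f <-> bipart p q f = f.
Proof.
split=> [fh|<- m]; last by rewrite mcoeff_mfilter; case: (bideg p q m); rewrite ?mulr0n ?eqxx.
apply/mpolyP => m; rewrite mcoeff_mfilter; case: (boolP (bideg p q m)) => // fm.
by apply/eqP; rewrite eq_sym; apply: contraNT fm; apply: fh.
Qed.

Lemma bihom_bipart p q f : bihom p q (bipart p q f).
Proof.
by move=> m; rewrite mcoeff_mfilter; case: (bideg p q m); rewrite ?mulr0n ?eqxx.
Qed.

Lemma bihom0 p q : bihom p q 0.
Proof. by move=> m; rewrite mcoeff0 eqxx. Qed.

Lemma bihomD p q f g : bihom p q f -> bihom p q g -> bihom p q (f + g).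
Proof. by move/bihomP => fh /bihomP gh; apply/bihomP;
   rewrite /bipart mfilterD -!/(bipart _ _ _) fh gh. Qed.

Lemma bihom_sum p q I (s : seq I) (P : pred I) F :
  (forall i, P i -> bihom p q (F i)) -> bihom p q (\sum_(i <- s | P i) F i).
Proof. by move=> Fh; elim/big_rec: _ => [|i f /Fh]; [exact: bihom0 | exact: bihomD]. Qed.

Lemma bideg_x p q i m : bideg p.+1 q (m + U_(x_ i))%MM = bideg p q m.
Proof. by rewrite /bideg xdegD edegD xdeg_x edeg_x addn1 addn0 eqSS. Qed.
Lemma bideg_e p q a m : bideg p q.+1 (m + U_(e_ a))%MM = bideg p q m.
Proof. by rewrite /bideg xdegD edegD xdeg_e edeg_e addn1 addn0 eqSS. Qed.

Lemma bipart_x p q i f : bipart p.+1 q ('X_(x_ i) * f) = 'X_(x_ i) * bipart p q f.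
Proof. by apply: mfilter_mulX => m; rewrite bideg_x. Qed.
Lemma bipart_e p q a f : bipart p q.+1 ('X_(e_ a) * f) = 'X_(e_ a) * bipart p q f.
Proof. by apply: mfilter_mulX => m; rewrite bideg_e. Qed.
Lemma bipart_deriv p q a f : bipart p q f^`M(e_ a) = (bipart p q.+1 f)^`M(e_ a).
Proof.
apply/mpolyP => m; rewrite mcoeff_mfilter !mcoeff_deriv mcoeff_mfilter bideg_e.
by rewrite -!mulrnA mulnC.
Qed.

Lemma bihom_x p q i f : bihom p q f -> bihom p.+1 q ('X_(x_ i) * f).
Proof. by move/bihomP => fh; apply/bihomP; rewrite bipart_x fh. Qed.
Lemma bihom_e p q a f : bihom p q f -> bihom p q.+1 ('X_(e_ a) * f).
Proof. by move/bihomP => fh; apply/bihomP; rewrite bipart_e fh. Qed.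
Lemma bihom_deriv p q a f : bihom p q.+1 f -> bihom p q f^`M(e_ a).
Proof. by move/bihomP => fh; apply/bihomP; rewrite bipart_deriv fh. Qed.
Lemma bihom_deriv0 p a f : bihom p 0 f -> f^`M(e_ a) = 0.
Proof.
move=> fh; apply/mpolyP => m; rewrite mcoeff_deriv mcoeff0.
case: (eqVneq f@_(m + U_(e_ a)) 0) => [->|/fh]; rewrite ?mul0rn //.
by rewrite /bideg edegD edeg_e addn1 andbF.
Qed.
Lemma bihom_scale p q (c : 'F_2) f : bihom p q f -> bihom p q (c *: f).
Proof. by move=> fh m; rewrite mcoeffZ mulf_eq0 negb_or => /andP[_ /fh]. Qed.

Lemma bihom_homog p q f : bihom p q f -> f \is (p + q).-homog.
Proof.
move=> fh; apply/dhomogP => m; rewrite mcoeff_msupp => /fh /andP[/eqP xm /eqP em].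
by rewrite -xm -em; apply: mdeg_bi.
Qed.

Lemma bipart_homog d p q f : (p + q)%N != d -> f \is d.-homog -> bipart p q f = 0.
Proof.
move=> pqd fd; apply/mpolyP => m; rewrite mcoeff_mfilter mcoeff0.
case: (boolP (bideg p q m)) => [/andP[/eqP xm /eqP em]|]; last by rewrite mulr0n.
have md : mdeg m != d by rewrite mdeg_bi xm em.
by rewrite (dhomog_nemf_coeff fd md).
Qed.

Lemma bipart_sum d f : f \is d.-homog -> f = \sum_(q < d.+1) bipart (d - q)%N q f.
Proof.
move=> fd; apply/mpolyP => m; rewrite raddf_sum /=.
case: (eqVneq (mdeg m) d) => [md|md]; last first.
  rewrite (dhomog_nemf_coeff fd) // big1 // => q _.
  by rewrite mcoeff_mfilter (dhomog_nemf_coeff fd) // mul0rn.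
have lt_e : (edeg m < d.+1)%N by rewrite ltnS -md mdeg_bi leq_addl.
rewrite (bigD1 (Ordinal lt_e)) //= mcoeff_mfilter /bideg eqxx andbT.
have -> : (xdeg m == d - edeg m)%N by rewrite -md mdeg_bi addnK.
rewrite mulr1n big1 ?addr0 // => q.
rewrite -val_eqE /= mcoeff_mfilter /bideg eq_sym => /negPf ->.
by rewrite andbF mulr0n.
Qed.

End Bigrading.

Section KoszulBigraded.
Variables n r : nat.
Local Notation R := {mpoly 'F_2[n + r]}.

Lemma bipartD p q : {morph @bipart n r p q : f g / f + g}.
Proof. exact: mfilterD. Qed.

(** The invariant remainder of the general statement has no [e]-variable, so it dies in positive
    [e]-degree. *)
Lemma koszul_exact_e (Om : Type) (tau : 'I_r -> Om -> Om) (v : 'I_r -> Om -> 'F_2)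
    p q (f : Om -> R) :
    (forall i w, tau i (tau i w) = w) ->
    (forall i j w, tau i (tau j w) = tau j (tau i w)) ->
    (forall i j w, v i (tau j w) = v i w + (i == j)%:R) ->
    (forall w, bihom p q.+1 (f w)) ->
    (forall w, koszul (@rshift n r) tau f w = 0) ->
  exists2 g, forall w, bihom p q (g w) & forall w, f w = koszul (@rshift n r) tau g w.
Proof.
move=> tauK tauC v_tau fh f0.
have f_inv (j : 'I_r) : (r <= j)%N -> forall u, f (tau j u) = f u.
  by rewrite leqNgt ltn_ord.
have [g [s [fE _ _ s_free]]] :=
  koszul_exact_rec (@rshift_inj n r) tauK tauC v_tau (leqnn r) f_inv f0.
exists (fun w => bipart p q (g w)) => w; first exact: bihom_bipart.
have /bihomP fw := fh w; rewrite -[LHS]fw fE bipartD [X in _ + X](_ : _ = 0) ?addr0.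
  rewrite /bipart mfilter_sum; apply: eq_bigr => j _.
  by rewrite -bipartD -bipart_e.
apply/mpolyP => m; rewrite mcoeff_mfilter mcoeff0.
case: (boolP (bideg p q.+1 m)) => // /andP[_ /eqP em]; rewrite mulr1n.
have /existsP[a ma] : [exists a, m (rshift n a) != 0].
  apply: contra_eqT em => /existsPn m0; rewrite /edeg big1 // => a _.
  by apply/eqP; have := m0 a; rewrite negbK.
exact: s_free ma.
Qed.

Lemma koszul_exact_x (Om : Type) (tau : 'I_n -> Om -> Om) (v : 'I_n -> Om -> 'F_2)
    p q (f : Om -> R) :
    (forall i w, tau i (tau i w) = w) ->
    (forall i j w, tau i (tau j w) = tau j (tau i w)) ->
    (forall i j w, v i (tau j w) = v i w + (i == j)%:R) ->
    (forall w, bihom p.+1 q (f w)) ->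
    (forall w, koszul (@lshift n r) tau f w = 0) ->
  exists2 g, forall w, bihom p q (g w) & forall w, f w = koszul (@lshift n r) tau g w.
Proof.
move=> tauK tauC v_tau fh f0.
have f_inv (j : 'I_n) : (n <= j)%N -> forall u, f (tau j u) = f u.
  by rewrite leqNgt ltn_ord.
have [g [s [fE _ _ s_free]]] :=
  koszul_exact_rec (@lshift_inj n r) tauK tauC v_tau (leqnn n) f_inv f0.
exists (fun w => bipart p q (g w)) => w; first exact: bihom_bipart.
have /bihomP fw := fh w; rewrite -[LHS]fw fE bipartD [X in _ + X](_ : _ = 0) ?addr0.
  rewrite /bipart mfilter_sum; apply: eq_bigr => j _.
  by rewrite -bipartD -bipart_x.
apply/mpolyP => m; rewrite mcoeff_mfilter mcoeff0.
case: (boolP (bideg p.+1 q m)) => // /andP[/eqP xm _]; rewrite mulr1n.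
have /existsP[a ma] : [exists a, m (lshift r a) != 0].
  apply: contra_eqT xm => /existsPn m0; rewrite /xdeg big1 // => a _.
  by apply/eqP; have := m0 a; rewrite negbK.
exact: s_free ma.
Qed.

End KoszulBigraded.

(** All that the computation needs of the group. The fields force each [v a] to be central of order
    2: it is the square of a generator if [lo a = hi a], and a commutator of two generators
    otherwise. *)
Record coordinates (T : finGroupType) (n r : nat) := Coordinates {
  lo : 'I_r -> 'I_n;
  hi : 'I_r -> 'I_n;
  idx : 'I_n -> 'I_n -> 'I_r;
  X : 'I_n -> T -> 'F_2;
  E : 'I_r -> T -> 'F_2;
  u : 'I_n -> T;
  v : 'I_r -> T;
  lo_hi : forall a, (lo a <= hi a)%N;
  idxP : forall i j : 'I_n, (i <= j)%N -> lo (idx i j) = i /\ hi (idx i j) = j;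
  idxK : forall a, idx (lo a) (hi a) = a;
  XM : forall i g h, X i (g * h)%g = X i g + X i h;
  EM : forall a g h, E a (g * h)%g = E a g + E a h + X (lo a) g * X (hi a) h;
  XE_inj : forall g h, X^~ g =1 X^~ h -> E^~ g =1 E^~ h -> g = h;
  Xu : forall i j, X i (u j) = (i == j)%:R;
  Eu : forall a j, E a (u j) = 0;
  Xv : forall i a, X i (v a) = 0;
  Ev : forall a b, E a (v b) = (a == b)%:R }.

(** * The operators H, T and Q *)

Section Operators.
Variables (T : finGroupType) (n r : nat) (C : coordinates T n r).
Local Notation R := {mpoly 'F_2[n + r]}.
Local Notation V := {ffun T -> R}.
Local Notation x_ i := ('X_(lshift r i) : R).
Local Notation e_ a := ('X_(rshift n a) : R).
Local Notation lo := (lo C).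
Local Notation hi := (hi C).
Local Notation idx := (idx C).
Local Notation X := (X C).
Local Notation E := (E C).
Local Notation u := (u C).
Local Notation v := (v C).
Local Notation lo_hi := (lo_hi C).
Local Notation idxP := (idxP C).
Local Notation idxK := (idxK C).
Local Notation XM := (XM C).
Local Notation EM := (EM C).
Local Notation XE_inj := (XE_inj (c := C)).
Local Notation Xu := (Xu C).
Local Notation Eu := (Eu C).
Local Notation Xv := (Xv C).
Local Notation Ev := (Ev C).

Lemma sum_pairs (A : zmodType) (F : 'I_n -> 'I_n -> A) :
  \sum_i \sum_j F i j
  = \sum_a (F (lo a) (hi a) + if lo a == hi a then 0 else F (hi a) (lo a)).
Proof.
rewrite pair_big (bigID (fun p : 'I_n * 'I_n => p.1 <= p.2)%N) /= big_split /=.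
congr (_ + _).
  rewrite (reindex_onto (fun a => (lo a, hi a)) (fun p => idx p.1 p.2)) /=.
    by apply: eq_bigl => a; rewrite lo_hi idxK eqxx.
  by move=> [i j] /= /idxP[-> ->].
rewrite [RHS](bigID (fun a => lo a == hi a)) /= [X in _ = X + _]big1 ?add0r => [|a ->] //.
rewrite (reindex_onto (fun a => (hi a, lo a)) (fun p => idx p.2 p.1)) /=; last first.
  by move=> [i j] /=; rewrite -ltnNge => /ltnW /idxP[-> ->].
apply: eq_big => [a|a /andP[]].
  by rewrite -ltnNge idxK eqxx andbT ltn_neqAle lo_hi andbT -val_eqE.
by move=> lt_lo _; case: eqP lt_lo => // ->; rewrite leqnn.
Qed.

Let mulv g a : (g * v a = v a * g)%g.
Proof.
by apply: XE_inj => b; rewrite ?XM ?EM !Xv ?mulr0 ?mul0r ?addr0 ?add0r // addrC.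
Qed.

Let X1 i : X i 1%g = 0.
Proof. by have := XM i 1 1; rewrite mulg1 addF2. Qed.
Let E1 a : E a 1%g = 0.
Proof. by have := EM a 1 1; rewrite mulg1 X1 mul0r addr0 addF2. Qed.

Let vv a : (v a * v a = 1)%g.
Proof.
apply: XE_inj => b; first by rewrite XM Xv X1 addr0.
by rewrite EM Ev addF2 add0r Xv mul0r E1.
Qed.

(** Chosen so that [u_lo u_hi = swap a * v a] both on and off the diagonal. *)
Definition swap a : T := if lo a == hi a then 1%g else (u (hi a) * u (lo a))%g.

Lemma swap_diag a : lo a = hi a -> (u (lo a) * u (hi a) = v a)%g.
Proof.
move=> loE; apply: XE_inj => b; first by rewrite XM !Xu Xv loE addF2.
rewrite EM !Eu !add0r !Xu Ev -natrM mulnb; congr (_%:R); congr nat_of_bool.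
apply/andP/eqP => [[/eqP bl /eqP bh]|->]; last by rewrite !eqxx.
by rewrite -[b]idxK bl bh idxK.
Qed.

Lemma swap_offdiag a : lo a != hi a -> (u (lo a) * u (hi a) = u (hi a) * u (lo a) * v a)%g.
Proof.
move=> lo_neq; apply: XE_inj => b; first by rewrite !XM Xv addr0 addrC.
rewrite !EM !Eu !add0r !Xu Xv mulr0 addr0 Ev -!natrM !mulnb.
rewrite [X in (X : bool)%:R + _](_ : _ = false) ?add0r.
  congr (_%:R); congr nat_of_bool.
  apply/andP/eqP => [[/eqP bl /eqP bh]|->]; last by rewrite !eqxx.
  by rewrite -[b]idxK bl bh idxK.
apply/negbTE/andP => -[/eqP bh /eqP bl].
have := lo_hi b; rewrite bh bl => le_hl.
by case/eqP: lo_neq; apply/val_inj/anti_leq; rewrite lo_hi.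
Qed.

Definition opH (f : V) : V := [ffun h => koszul (@rshift n r) (fun a g => g * v a)%g f h].
Definition opT (f : V) : V := [ffun h => koszul (@lshift n r) (fun i g => g * u i)%g f h].
(** The translation by [swap a] is what makes [opHQ] exact on all functions; on constants it
    disappears and leaves [qbar]. *)
Definition opQ (f : V) : V :=
  [ffun h => \sum_a x_ (lo a) * x_ (hi a) * (f (h * swap a)%g)^`M(rshift n a)].

Lemma opHE f h : opH f h = \sum_a e_ a * (f (h * v a)%g + f h).
Proof. exact: ffunE. Qed.
Lemma opTE f h : opT f h = \sum_i x_ i * (f (h * u i)%g + f h).
Proof. exact: ffunE. Qed.
Lemma opQE f h : opQ f h
  = \sum_a x_ (lo a) * x_ (hi a) * (f (h * swap a)%g)^`M(rshift n a).
Proof. exact: ffunE. Qed.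

Lemma opHD : {morph opH : f g / f + g}.
Proof.
move=> f g; apply/ffunP => h; rewrite add_ffunE !opHE -big_split; apply: eq_bigr => a _.
by rewrite /= !add_ffunE -mulrDr addrACA.
Qed.
Lemma opTD : {morph opT : f g / f + g}.
Proof.
move=> f g; apply/ffunP => h; rewrite add_ffunE !opTE -big_split; apply: eq_bigr => a _.
by rewrite /= !add_ffunE -mulrDr addrACA.
Qed.
Lemma opQD : {morph opQ : f g / f + g}.
Proof.
move=> f g; apply/ffunP => h; rewrite add_ffunE !opQE -big_split; apply: eq_bigr => a _.
by rewrite /= !add_ffunE mderivD mulrDr.
Qed.

Lemma sum_sym0 (I : finType) (A : lmodType 'F_2) (F : I -> I -> A) :
  (forall i, F i i = 0) -> (forall i j, F i j = F j i) -> \sum_i \sum_j F i j = 0.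
Proof.
move=> F0 FC; pose k (p : I * I) := (enum_rank p.1 < enum_rank p.2)%N.
have sw_inj : injective (fun p : I * I => (p.2, p.1)) by move=> [i j] [i' j'] [-> ->].
rewrite pair_big /= (bigID k) /=.
rewrite [X in _ + X](bigID (fun p : I * I => p.1 == p.2)) /=.
rewrite [X in _ + (X + _)]big1 => [|p /andP[_ /eqP->]]; last exact: F0.
rewrite add0r [X in _ + X](reindex_inj sw_inj) /=.
rewrite [X in _ + X](eq_bigr (fun p => F p.1 p.2)) => [|p _]; last exact: FC.
rewrite [X in _ + X](eq_bigl k) ?addFF // => -[i j] /=.
by rewrite -leqNgt /k /= ltn_neqAle (inj_eq val_inj) (inj_eq enum_rank_inj) eq_sym andbC.
Qed.

Lemma opHH f : opH (opH f) = 0.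
Proof.
apply/ffunP => h; rewrite opHE [RHS]ffunE.
under eq_bigr => a _ do rewrite !opHE -big_split mulr_sumr.
apply: sum_sym0 => [a|a b] /=.
  by rewrite -mulgA vv mulg1 [f h + _]addrC addFF mulr0.
by rewrite -!mulgA [(v a * v b)%g]mulv -!mulrDr mulrCA addrACA.
Qed.

Lemma opHT f : opH (opT f) = opT (opH f).
Proof.
apply/ffunP => h; rewrite opHE [RHS]opTE.
under eq_bigr => a _ do rewrite !opTE -big_split mulr_sumr.
under [RHS]eq_bigr => a _ do rewrite !opHE -big_split mulr_sumr.
rewrite exchange_big; apply: eq_bigr => i _; apply: eq_bigr => a _ /=.
by rewrite -!mulrDr mulrCA -!mulgA [(u i * v a)%g]mulv addrACA.
Qed.

(** On the diagonal only [f (h u_i^2)] and [f h] survive. Off it, the terms for [(i, j)] and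
    [(j, i)] have all values in common but [f (h u_i u_j)] and [f (h u_j u_i)]. *)
Lemma opTT f h : opT (opT f) h
  = \sum_a x_ (lo a) * x_ (hi a) * (f (h * swap a * v a)%g + f (h * swap a)%g).
Proof.
rewrite opTE.
under eq_bigr => i _ do rewrite !opTE -big_split mulr_sumr.
rewrite sum_pairs; apply: eq_bigr => a _ /=; rewrite -!mulrDr -!mulgA /swap.
case: eqP => [loE|/eqP lo_neq].
  by rewrite addr0 mul1g mulg1 swap_diag // mulrA loE; congr (_ * _); rewrite -addrA addFK.
rewrite -(swap_offdiag lo_neq).
rewrite [in X in _ + X]mulrCA -!mulrDr mulrA; congr (_ * _).
rewrite -[f (h * (u (lo a) * _))%g + _ + _]addrA -[f (h * (u (hi a) * _))%g + _ + _]addrA.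
rewrite addrACA [X in _ + X](_ : _ = 0) ?addr0 //.
by rewrite [X in _ + X]addrCA addFF.
Qed.

(** In the product rule only the term where the derivative hits [e_a] itself fails to cancel; it is
    the difference along [v a] at [h * swap a], as in [opTT]. *)
Lemma opHQ f : opH (opQ f) + opQ (opH f) = opT (opT f).
Proof.
apply/ffunP => h; rewrite add_ffunE opTT opHE [opQ (opH f) h]opQE.
under eq_bigr => b _ do rewrite !opQE -big_split mulr_sumr.
rewrite exchange_big -big_split; apply: eq_bigr => a _ /=.
rewrite opHE raddf_sum /=.
under eq_bigr => b _ do rewrite -mulrDr mulrCA.
rewrite -mulr_sumr -mulrDr; congr (_ * _).
have dE b : ('X_(rshift n b) * (f (h * swap a * v b)%g + f (h * swap a)%g))^`M(rshift n a)
   = (if b == a then f (h * swap a * v a)%g + f (h * swap a)%g else 0)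
     + e_ b * ((f (h * v b * swap a)%g)^`M(rshift n a) + (f (h * swap a)%g)^`M(rshift n a)).
  rewrite mderivM mderivD mderivX mnm1E (inj_eq (@rshift_inj _ _)) -(mulgA h (v b)) -mulv mulgA.
  case: eqP => [->|_]; last by rewrite scale0r mul0r.
  have -> : (U_(rshift n a) - U_(rshift n a) = 0 :> 'X_{1..n + r})%MM.
    by apply/mnmP => i; rewrite mnmBE subnn mnm0E.
  by rewrite scale1r mpolyX0 mul1r.
under [X in _ + X]eq_bigr => b _ do rewrite dE.
by rewrite big_split /= addrCA addFF addr0 -big_mkcond big_pred1_eq.
Qed.

Definition bihomf p q (f : V) := forall h, bihom p q (f h).
Definition cst (c : R) : V := [ffun=> c].

Lemma bihomfD p q f g : bihomf p q f -> bihomf p q g -> bihomf p q (f + g).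
Proof. by move=> fh gh h; rewrite add_ffunE; apply: bihomD. Qed.
Lemma bihomf_H p q f : bihomf p q f -> bihomf p q.+1 (opH f).
Proof.
by move=> fh h; rewrite opHE; apply: bihom_sum => a _; apply/bihom_e/bihomD.
Qed.
Lemma bihomf_T p q f : bihomf p q f -> bihomf p.+1 q (opT f).
Proof.
by move=> fh h; rewrite opTE; apply: bihom_sum => a _; apply/bihom_x/bihomD.
Qed.
Lemma bihomf_Q p q f : bihomf p q.+1 f -> bihomf p.+2 q (opQ f).
Proof.
move=> fh h; rewrite opQE; apply: bihom_sum => a _; rewrite -mulrA.
exact/bihom_x/bihom_x/bihom_deriv.
Qed.
Lemma bihomf_Q0 p f : bihomf p 0 f -> opQ f = 0.
Proof.
move=> fh; apply/ffunP => h; rewrite opQE [RHS]ffunE big1 // => a _.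
by rewrite (bihom_deriv0 _ (fh _)) mulr0.
Qed.

Lemma addVV (f : V) : f + f = 0.
Proof. by apply/ffunP => h; rewrite add_ffunE addFF ffunE. Qed.
Lemma addV_eq (f g : V) : f + g = 0 -> f = g.
Proof. by move=> fg; rewrite -[f]addr0 -(addVV g) addrA fg add0r. Qed.

Lemma H_cst c : opH (cst c) = 0.
Proof.
by apply/ffunP => h; rewrite opHE [RHS]ffunE big1 // => a _; rewrite !ffunE addFF mulr0.
Qed.
Lemma T_cst c : opT (cst c) = 0.
Proof.
by apply/ffunP => h; rewrite opTE [RHS]ffunE big1 // => a _; rewrite !ffunE addFF mulr0.
Qed.
Lemma H_0 : opH 0 = 0. Proof. exact: (H_cst 0). Qed.
Lemma T_0 : opT 0 = 0. Proof. exact: (T_cst 0). Qed.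

Definition qbar (c : R) : R := \sum_a x_ (lo a) * x_ (hi a) * c^`M(rshift n a).

Lemma qbarD : {morph qbar : c d / c + d}.
Proof. by move=> c d; rewrite -big_split; apply: eq_bigr => a _; rewrite mderivD mulrDr. Qed.
Lemma qbar0 : qbar 0 = 0.
Proof. by rewrite /qbar big1 // => a _; rewrite mderiv0 mulr0. Qed.

Lemma Q_cst c : opQ (cst c) = cst (qbar c).
Proof.
by apply/ffunP => h; rewrite opQE ffunE; apply: eq_bigr => a _; rewrite ffunE.
Qed.

Lemma cst0P c : cst c = 0 -> c = 0.
Proof. by move/ffunP/(_ 1%g); rewrite !ffunE. Qed.

Lemma bihom_qbar p q c : bihom p q.+1 c -> bihom p.+2 q (qbar c).
Proof.
move=> ch; apply: bihom_sum => a _; rewrite -mulrA.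
exact/bihom_x/bihom_x/bihom_deriv.
Qed.
Lemma qbar_free p c : bihom p 0 c -> qbar c = 0.
Proof. by move=> ch; rewrite /qbar big1 // => a _; rewrite (bihom_deriv0 _ ch) mulr0. Qed.

Lemma qbar_e a c : qbar (e_ a * c) = x_ (lo a) * x_ (hi a) * c + e_ a * qbar c.
Proof.
rewrite /qbar mulr_sumr (bigD1 a) //= [in RHS](bigD1 a) //= addrA.
have dX b : (e_ a)^`M(rshift n b) = (a == b)%:R.
  rewrite mderivX mnm1E (inj_eq (@rshift_inj _ _)); case: eqP => [->|_]; last by rewrite scale0r.
  have -> : (U_(rshift n b) - U_(rshift n b) = 0 :> 'X_{1..n + r})%MM.
    by apply/mnmP => i; rewrite mnmBE subnn mnm0E.
  by rewrite scale1r mpolyX0.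
congr (_ + _); first by rewrite mderivM dX eqxx mul1r mulrDr [e_ a * (_ * _)]mulrCA.
apply: eq_bigr => b ba; rewrite mderivM dX eq_sym (negPf ba) mul0r add0r.
by rewrite mulrCA.
Qed.

(** The [v a] act by commuting involutions with dual coordinates [E a], so [H] is a Koszul operator
    on the whole group. *)
Lemma H_exact p q f : bihomf p q.+1 f -> opH f = 0 -> exists2 g, bihomf p q g & f = opH g.
Proof.
move=> fh /ffunP f0.
have [a g|a b g|a b g||h|g gh fE] := @koszul_exact_e n r T (fun a g => g * v a)%g E p q f.
- by rewrite -mulgA vv mulg1.
- by rewrite -!mulgA mulv.
- by rewrite EM Xv mulr0 addr0 Ev.
- exact: fh.
- by have := f0 h; rewrite !ffunE.
exists (finfun g) => [h|]; first by rewrite ffunE.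
by apply/ffunP => h; rewrite fE opHE; apply: eq_bigr => a _; rewrite !ffunE.
Qed.

Lemma sum_X_eq0 N m (iota : 'I_m -> 'I_N) (F : 'I_m -> {mpoly 'F_2[N]}) :
    injective iota ->
    (forall j k (mu : 'X_{1..N}), mu (iota k) != 0 -> (F j)@_mu = 0) ->
  \sum_j 'X_(iota j) * F j = 0 -> forall j, F j = 0.
Proof.
move=> iota_inj F_free F0 j; apply/mpolyP => mu; rewrite mcoeff0.
case: (boolP [exists k, mu (iota k) != 0]) => [/existsP[k] | /existsPn mu0].
  exact: F_free.
have := congr1 (mcoeff (mu + U_(iota j))%MM) F0.
rewrite mcoeff0 raddf_sum (bigD1 j) //= mcoeff_mulX addmK mnmDE mnm1E eqxx addn1 mulr1n.
rewrite big1 ?addr0 // => k kj; rewrite mcoeff_mulX mnmDE mnm1E (inj_eq iota_inj).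
have := mu0 k; rewrite [j == k]eq_sym (negPf kj) addn0 => /negPf->.
by rewrite mulr0n.
Qed.

Lemma H_inv p f : bihomf p 0 f -> opH f = 0 -> forall a h, f (h * v a)%g = f h.
Proof.
move=> fh /ffunP f0 a h; have := f0 h; rewrite opHE [RHS]ffunE => s0.
have := sum_X_eq0 (@rshift_inj n r) _ s0 a => /(_ _)/eqP; rewrite addr_eq0 oppFF => fE.
apply/eqP/fE => b k mu muk; apply/eqP/negPn/negP => muF.
have /andP[_ /eqP em] := bihomD (fh _) (fh _) muF.
have : (mu (rshift n k) <= edeg mu)%N by rewrite /edeg (bigD1 k) //= leq_addr.
by rewrite em leqn0 => mu0; case/negP: muk.
Qed.

Lemma XV g : X^~ g =1 (fun=> 0) -> g = (\prod_a v a ^+ (E a g != 0))%g.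
Proof.
move=> Xg.
have X_prod (s : seq 'I_r) : X^~ (\prod_(a <- s) v a ^+ (E a g != 0))%g =1 (fun=> 0).
  move=> i; elim: s => [|a s IHs]; first by rewrite big_nil X1.
  by rewrite big_cons XM IHs addr0; case: (_ != 0); rewrite ?expg0 ?X1 ?Xv.
have Enat (x : 'F_2) : x = (x != 0)%:R by case: x => [[|[|]]] // ?; apply/val_inj.
have E_prod b (s : seq 'I_r) :
    E b (\prod_(a <- s) v a ^+ (E a g != 0))%g = \sum_(a <- s | b == a) E a g.
  elim: s => [|a s IHs]; first by rewrite !big_nil E1.
  rewrite !big_cons EM IHs X_prod mulr0 addr0.
  rewrite [in RHS](Enat (E a g)); case: (E a g != 0); rewrite ?expg0 ?E1 ?expg1 ?Ev.
    by case: eqP; rewrite ?add0r.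
  by case: eqP; rewrite ?add0r.
apply: XE_inj => b; first by rewrite Xg X_prod.
by rewrite E_prod (big_pred1 b) // => a /=; rewrite eq_sym.
Qed.

(** Elements with equal [X]-coordinates differ by a product of the central [v a]. *)
Lemma V_inv (f : V) : (forall a h, f (h * v a)%g = f h) ->
  forall g h, X^~ g =1 X^~ h -> f g = f h.
Proof.
move=> f_inv g h gh; have Xgh : X^~ (g^-1 * h)%g =1 (fun=> 0).
  by move=> i /=; rewrite XM -gh -XM mulVg X1.
rewrite -[h](mulKVg g) (XV Xgh); elim/big_rec: _ => [|a k _ IHk]; first by rewrite mulg1.
case: (E a _ != 0); last by rewrite expg0 mul1g.
by rewrite expg1 -mulv mulgA f_inv.
Qed.

Definition lift_x (x : {ffun 'I_n -> 'F_2}) : T := (\prod_i u i ^+ (x i != 0%R))%g.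

Lemma X_lift i x : X i (lift_x x) = x i.
Proof.
have Enat (y : 'F_2) : y = (y != 0)%:R by case: y => [[|[|]]] // ?; apply/val_inj.
have XP (s : seq 'I_n) :
    X i (\prod_(j <- s) u j ^+ (x j != 0%R))%g = \sum_(j <- s | i == j) x j.
  elim: s => [|j s IHs]; first by rewrite !big_nil X1.
  rewrite !big_cons XM IHs [in RHS](Enat (x j)).
  case: (x j != 0); rewrite ?expg0 ?X1 ?expg1 ?Xu; case: eqP; rewrite ?add0r //.
by rewrite /lift_x XP (big_pred1 i) // => j /=; rewrite eq_sym.
Qed.

(** Right translations by the [u_i] become commuting involutions only on functions of the
    coordinates [X]. An [H]-closed function without [e]-variables is one, so the Koszul argument
    applies over [F_2^n]. *)
Lemma T_exact p f : bihomf p.+1 0 f -> opH f = 0 -> opT f = 0 ->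
  exists g, [/\ bihomf p 0 g, opH g = 0 & f = opT g].
Proof.
move=> fh Hf /ffunP Tf; have f_inv := V_inv (H_inv fh Hf).
pose tau i (x : {ffun 'I_n -> 'F_2}) : {ffun 'I_n -> 'F_2} :=
  [ffun j => x j + (j == i)%:R].
pose fx x := f (lift_x x).
have f_tau i x : f (lift_x x * u i)%g = fx (tau i x).
  by apply: f_inv => j; rewrite XM X_lift Xu X_lift ffunE.
have [i x|i j x|i j x|x|x|g gh fE] := @koszul_exact_x n r _ tau (fun i x => x i) p 0 fx.
- by apply/ffunP => j; rewrite !ffunE -addrA addF2 addr0.
- by apply/ffunP => k; rewrite !ffunE addrAC.
- by rewrite ffunE.
- exact: fh.
- have := Tf (lift_x x); rewrite opTE ffunE => Tx; rewrite -[RHS]Tx.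
  by apply: eq_bigr => i _; rewrite f_tau.
pose Xf h : {ffun 'I_n -> 'F_2} := [ffun i => X i h].
exists [ffun h => g (Xf h)]; split=> [h||].
- by rewrite ffunE.
- apply/ffunP => h; rewrite opHE [RHS]ffunE big1 // => a _; rewrite !ffunE.
  rewrite (_ : Xf (h * v a)%g = Xf h) ?addFF ?mulr0 //.
  by apply/ffunP => i; rewrite !ffunE XM Xv addr0.
apply/ffunP => h; rewrite opTE (f_inv h (lift_x (Xf h))) => [|i]; last by rewrite X_lift ffunE.
rewrite -/(fx _) fE; apply: eq_bigr => i _; rewrite !ffunE.
congr (_ * (g _ + _)); apply/ffunP => j; rewrite !ffunE XM Xu //.
Qed.

Definition ltrans g (f : V) : V := [ffun h => f (g * h)%g].

Lemma ltrans_H g f : ltrans g (opH f) = opH (ltrans g f).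
Proof. by apply/ffunP => h; rewrite ffunE !opHE; apply: eq_bigr => a _; rewrite !ffunE mulgA. Qed.
Lemma ltrans_T g f : ltrans g (opT f) = opT (ltrans g f).
Proof. by apply/ffunP => h; rewrite ffunE !opTE; apply: eq_bigr => a _; rewrite !ffunE mulgA. Qed.
Lemma ltrans_Q g f : ltrans g (opQ f) = opQ (ltrans g f).
Proof. by apply/ffunP => h; rewrite ffunE !opQE; apply: eq_bigr => a _; rewrite !ffunE mulgA. Qed.
Lemma ltrans_cst f : (forall g, ltrans g f = f) <-> f = cst (f 1%g).
Proof.
split=> [fT|-> g]; apply/ffunP => h; rewrite !ffunE //.
by rewrite -[in RHS](fT h) ffunE mulg1.
Qed.
Lemma bihomf_ltrans p q g f : bihomf p q f -> bihomf p q (ltrans g f).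
Proof. by move=> fh h; rewrite ffunE. Qed.

Lemma opHQ' f : opH (opQ f) = opT (opT f) + opQ (opH f).
Proof. by rewrite -opHQ -addrA addVV addr0. Qed.

(** With [w1 = H g], the defect [w0 + T g] is [T]-closed: [Q g = 0] gives
    [T T g = Q H g = Q w1 = T w0]. *)
Lemma exact_free p w1 w0 : bihomf p 1 w1 -> bihomf p.+1 0 w0 ->
    opH w1 = 0 -> opT w1 + opH w0 = 0 -> opQ w1 + opT w0 = 0 ->
  exists g, [/\ bihomf p 0 g, w1 = opH g & w0 = opT g].
Proof.
move=> w1h w0h Hw1 /addV_eq THw /addV_eq QTw.
have [g gh w1E] := H_exact w1h Hw1.
have bh : bihomf p.+1 0 (w0 + opT g) by apply: bihomfD => //; apply: bihomf_T.
have [||g' [g'h Hg' bE]] := T_exact bh.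
- by rewrite opHD opHT -w1E THw addVV.
- have := opHQ' g; rewrite (bihomf_Q0 gh) H_0 -w1E QTw => /esym/addV_eq TTg.
  by rewrite opTD TTg addVV.
exists (g + g'); split; first exact: bihomfD.
  by rewrite opHD -w1E Hg' addr0.
by rewrite opTD -bE addrC -addrA addVV addr0.
Qed.

(** For [H g] equal to the constant [c], [T T g = Q H g] is the constant [qbar c]; its vanishing
    lets a correction of [g] remove [T g]. *)
Lemma lift_one p c : bihom p.+1 1 c -> qbar c = 0 ->
  exists w, [/\ bihomf p.+1 0 w, opH w = cst c & opT w = 0].
Proof.
move=> ch qc; have ccst : bihomf p.+1 1 (cst c) by move=> h; rewrite ffunE.
have [g gh gE] := H_exact ccst (H_cst c).
have HTg : opH (opT g) = 0 by rewrite opHT -gE T_cst.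
have TTg : opT (opT g) = 0.
  have := opHQ g; rewrite (bihomf_Q0 gh) H_0 add0r -gE Q_cst qc => <-.
  by apply/ffunP => h; rewrite !ffunE.
have [g' [g'h Hg' TE]] := T_exact (bihomf_T gh) HTg TTg.
exists (g + g'); split; first exact: bihomfD.
  by rewrite opHD -gE Hg' addr0.
by rewrite opTD -TE addVV.
Qed.

(** Here the uncontrolled term [T Q + Q T] of [D D] appears as an obstruction. It turns out to be a
    constant [t], and it is absorbed by allowing a further constant [d] with [qbar d = t] in the
    boundary. *)
Lemma lift_two p c : bihom p 2 c -> qbar c = 0 ->
    (forall t, bihom p.+3 0 t -> exists2 d, bihom p.+1 1 d & qbar d = t) ->
  exists w1 w0 d, [/\ bihomf p 1 w1, bihomf p.+1 0 w0, opH w1 = cst c,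
    bihom p.+1 1 d /\ opT w1 + opH w0 = cst d & opQ w1 + opT w0 = 0].
Proof.
move=> ch qc qsurj; have ccst : bihomf p 2 (cst c) by move=> h; rewrite ffunE.
have [w1 w1h w1E] := H_exact ccst (H_cst c).
have HTw : opH (opT w1) = 0 by rewrite opHT -w1E T_cst.
have [e eh eE] := H_exact (bihomf_T w1h) HTw.
have Qcst : opQ (cst c) = 0 by rewrite Q_cst qc; apply/ffunP => h; rewrite !ffunE.
(* The last equation asks for [Y] to be [T]-exact. It is [H]-closed, but [T Y] equals
   [T Q w1 + Q T w1]. *)
pose Y := opQ w1 + opT e.
have Yh : bihomf p.+2 0 Y by apply: bihomfD; [exact: bihomf_Q | exact: bihomf_T].
have HY : opH Y = 0.
  by rewrite opHD opHQ' -w1E Qcst addr0 opHT -eE addVV.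
have TTe : opT (opT e) = opQ (opT w1) by rewrite -opHQ (bihomf_Q0 eh) H_0 add0r -eE.
have TY : opT Y = opT (opQ w1) + opQ (opT w1) by rewrite opTD TTe.
have TYh : bihomf p.+3 0 (opT Y) by apply: bihomf_T.
(* A left translation changes [w1] by some [H th], and [T Q + Q T] kills [H th], both terms being
   [T T T th]. So [T Y] is invariant. *)
have [t tE] : exists t, opT Y = cst t.
  exists (opT Y 1%g); apply/ltrans_cst => g; apply: addV_eq.
  have [th thh thE] : exists2 th, bihomf p 0 th & ltrans g w1 + w1 = opH th.
    apply: H_exact; first by apply: bihomfD; [exact: bihomf_ltrans | ].
    by rewrite opHD -ltrans_H -w1E; apply/ffunP => h; rewrite !ffunE addFF.
  rewrite TY; have -> : ltrans g (opT (opQ w1) + opQ (opT w1))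
      = opT (opQ (ltrans g w1)) + opQ (opT (ltrans g w1)).
    rewrite -!ltrans_T -!ltrans_Q -!ltrans_T.
    by apply/ffunP => h; rewrite ffunE !add_ffunE !ffunE.
  rewrite addrACA -opTD -!opQD -opTD thE -opHT.
  have QH x : opQ (opH x) = opT (opT x) + opH (opQ x).
    by rewrite -opHQ addrC addrA addVV add0r.
  by rewrite !QH (bihomf_Q0 thh) (bihomf_Q0 (bihomf_T thh)) H_0 !addr0 addVV.
have th : bihom p.+3 0 t by have := TYh 1%g; rewrite tE ffunE.
have [d dh qd] := qsurj _ th.
have dcst : bihomf p.+1 1 (cst d) by move=> h; rewrite ffunE.
have [x xh xE] := H_exact dcst (H_cst d).
(* As [Q x = 0], [T T x = Q H x] is the constant [qbar d = t], so adding [T x] makes [Y] closed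
   under [T]. *)
have TTx : opT (opT x) = cst t by rewrite -opHQ (bihomf_Q0 xh) H_0 add0r -xE Q_cst qd.
pose Y' := Y + opT x.
have [||| y [yh Hy YE]] := @T_exact p.+1 Y'.
- by apply: bihomfD => //; apply: bihomf_T.
- by rewrite opHD HY opHT -xE T_cst addr0.
- by rewrite opTD tE TTx addVV.
exists w1, (e + x + y), d; split=> //.
- by apply: bihomfD => //; apply: bihomfD.
- by split=> //; rewrite !opHD -eE Hy addr0 addrA addVV add0r xE.
by rewrite !opTD !addrA -/Y -/Y' YE addVV.
Qed.

Lemma const_exact p c : bihom p.+1 0 c ->
  exists w, [/\ bihomf p 0 w, opH w = 0 & opT w = cst c].
Proof.
move=> ch; have ccst : bihomf p.+1 0 (cst c) by move=> h; rewrite ffunE.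
by have [g [gh Hg gE]] := T_exact ccst (H_cst c) (T_cst c); exists g.
Qed.

(* Obstruction: the leading coefficient of a constant boundary is a
   [qbar]-cycle, because [H Q + Q H = T T]. *)
Lemma leading_cycle w w' w'' c c' c'' : opH w = cst c ->
    opT w + opH w' = cst c' -> opQ w + opT w' + opH w'' = cst c'' ->
  qbar c = 0.
Proof.
move=> Hw Tw Qw; apply: cst0P; rewrite -Q_cst -Hw.
have := congr1 opH Qw; rewrite H_cst !opHD opHH addr0 opHQ' opHT.
have -> : opH w' = opT w + cst c' by rewrite -Tw addrA addVV add0r.
by rewrite opTD T_cst addr0 addrAC addVV add0r.
Qed.

Lemma qbar_sum (I : Type) (s : seq I) (P : pred I) F :
  qbar (\sum_(i <- s | P i) F i) = \sum_(i <- s | P i) qbar (F i).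
Proof. exact: (big_morph _ qbarD qbar0). Qed.

Lemma qbarZ (a : 'F_2) c : qbar (a *: c) = a *: qbar c.
Proof.
by rewrite scaler_sumr; apply: eq_bigr => b _; rewrite mderivZ scalerAr.
Qed.

Lemma bihomX p q m : bideg p q m -> bihom p q ('X_[m] : R).
Proof. by move=> pqm m'; rewrite mcoeffX; case: (m =P m') => [<- //|_]; rewrite eqxx. Qed.

Lemma xdeg_gt0 (m : 'X_{1..n + r}) : xdeg m != 0%N -> exists i, m (lshift r i) != 0%N.
Proof.
move=> xm; apply/existsP; apply: contraNT xm => /existsPn m0.
by rewrite /xdeg big1 // => i _; apply/eqP; have := m0 i; rewrite negbK.
Qed.

Definition xx a : 'X_{1..n + r} := (U_(lshift r (lo a)) + U_(lshift r (hi a)))%MM.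

Lemma xxE a : 'X_[xx a] = x_ (lo a) * x_ (hi a).
Proof. exact: mpolyXD. Qed.

Lemma bideg_pair p m : bideg p.+2 0 m -> exists a m', bideg p 0 m' /\ m = (xx a + m')%MM.
Proof.
have ex k (m' : 'X_{1..n + r}) : bideg k.+1 0 m' ->
    exists i m'', bideg k 0 m'' /\ m' = (U_(lshift r i) + m'')%MM.
  move=> m'h; have [|i mi] := @xdeg_gt0 m'; first by case/andP: m'h => /eqP->.
  exists i, (m' - U_(lshift r i))%MM; rewrite addmC submK ?lep1mP //; split=> //.
  by rewrite -(bideg_x _ _ i) submK ?lep1mP.
move=> /ex[i [m1 [/ex[j [m2 [m2h ->]]] ->]]].
have [/idxP[E1' E2']|/ltnW/idxP[E1' E2']] := leqP i j.
  by exists (idx i j), m2; rewrite /xx E1' E2' addmA.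
by exists (idx j i), m2; rewrite /xx E1' E2' addmA [(U_(_) + U_(_))%MM]addmC.
Qed.

Lemma qbar_surj_monomial p m : bideg p.+2 0 m ->
  exists2 d, bihom p 1 d & qbar d = 'X_[m].
Proof.
move=> /bideg_pair[a [m' [m'h ->]]]; exists (e_ a * 'X_[m']); first exact/bihom_e/bihomX.
by rewrite qbar_e (@qbar_free p) ?mulr0 ?addr0 -?xxE -?mpolyXD //; exact: bihomX.
Qed.

Lemma qbar_surj p t : bihom p.+2 0 t -> exists2 d, bihom p 1 d & qbar d = t.
Proof.
move=> th; rewrite [t]mpolyE; rewrite big_seq; elim/big_rec: _ => [|m s ms [d dh ds]].
  by exists 0; [exact: bihom0 | exact: qbar0].
have [|d' dh' ds'] := @qbar_surj_monomial p m; first by apply: th; rewrite -mcoeff_msupp.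
exists (t@_m *: d' + d); first exact/bihomD/dh/bihom_scale.
by rewrite qbarD qbarZ ds ds'.
Qed.

Lemma bipart_qbar p q c : bipart p.+2 q (qbar c) = qbar (bipart p q.+1 c).
Proof.
rewrite /bipart mfilter_sum; apply: eq_bigr => a _.
by rewrite -mulrA -!/(bipart _ _ _) !bipart_x bipart_deriv mulrA.
Qed.

Lemma pair_eq a b : (forall i, (lo b == i) + (hi b == i) = (lo a == i) + (hi a == i))%N -> b = a.
Proof.
move=> ab; rewrite -[b]idxK -[a]idxK.
have := (ab (lo a), ab (hi a), ab (lo b), ab (hi b)); rewrite !eqxx -!val_eqE /= => -[[[]]].
have := lo_hi a; have := lo_hi b => le1 le2 e1 e2 e3 e4.
by congr (idx _ _); apply/val_inj => /=; lia.
Qed.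

(** The coefficients have no [x]-variable and different indices give different quadratic monomials,
    so the terms cannot interfere. *)
Lemma sum_xx_eq0 q (F : 'I_r -> R) : (forall a, bihom 0 q (F a)) ->
  \sum_a x_ (lo a) * x_ (hi a) * F a = 0 -> forall a, F a = 0.
Proof.
move=> Fh F0 a.
have F_free b (m : 'X_{1..n + r}) i : (F b)@_m != 0 -> m (lshift r i) = 0%N.
  move=> /Fh/andP[/eqP xm _].
  have : (m (lshift r i) <= xdeg m)%N by rewrite /xdeg (bigD1 i) //= leq_addr.
  by rewrite xm leqn0 => /eqP.
apply/mpolyP => m; rewrite mcoeff0; apply/eqP/negPn/negP => Fm.
have Fma := F_free _ _ ^~ Fm.
pose k := xx; have kE b p : x_ (lo b) * x_ (hi b) * p = p * 'X_[k b] by rewrite xxE mulrC.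
have kx b i : k b (lshift r i) = ((lo b == i) + (hi b == i))%N.
  by rewrite mnmDE !mnm1E !(inj_eq (@lshift_inj _ _)).
have := congr1 (mcoeff (k a + m)%MM) F0.
rewrite mcoeff0 raddf_sum (bigD1 a) //= kE mcoeffMX big1 ?addr0 => [Fm0|b ba].
  by rewrite Fm0 eqxx in Fm.
apply/eqP/negPn/negP; rewrite kE => Fb.
have [m' km Fm'] : exists2 m', (k a + m = k b + m')%MM & (F b)@_m' != 0.
  have : (k a + m)%MM \in msupp (F b * 'X_[k b]) by rewrite mcoeff_msupp.
  case/msuppM_le/allpairsP => -[m' k'] /= [m's]; rewrite msuppX inE => /eqP->.
  by move=> kmE; exists m'; [rewrite kmE addmC | rewrite -mcoeff_msupp].
case/eqP: ba; apply: pair_eq => i; rewrite -!kx.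
have := congr1 (fun m : 'X_{1..n + r} => m (lshift r i)) km; rewrite /= !mnmDE.
by rewrite (F_free _ _ i Fm) (F_free _ _ i Fm') !addn0.
Qed.

(** All partial derivatives vanish by [sum_xx_eq0], yet a monomial of odd degree has an odd
    exponent, and its derivative there survives modulo 2. *)
Lemma qbar_odd_inj q c : odd q -> bihom 0 q c -> qbar c = 0 -> c = 0.
Proof.
case: q => // q odd_q ch qc; apply/mpolyP => m; rewrite mcoeff0.
apply/eqP/negPn/negP => cm; have /andP[_ /eqP em] := ch _ cm.
have [a odd_a] : exists a, odd (m (rshift n a)).
  apply/existsP; apply: contraTT odd_q => /existsPn ev; rewrite -em /edeg.
  elim/big_rec: _ => // a s _ IHs; rewrite oddD (negPf IHs) addbF; exact: ev.
have dc := @sum_xx_eq0 q (fun a => c^`M(rshift n a)) (fun a => bihom_deriv (a := a) ch) qc a.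
have := congr1 (mcoeff (m - U_(rshift n a))%MM) dc; rewrite mcoeff0 mcoeff_deriv.
have ma : m (rshift n a) != 0%N by case: (m _) odd_a.
rewrite submK ?lep1mP // mnmBE mnm1E eqxx subn1 prednK ?lt0n //.
move/eqP; rewrite -mulr_natr.
have -> : (m (rshift n a))%:R = 1 :> 'F_2.
  rewrite -[m _]odd_double_half odd_a natrD -muln2 natrM.
  by rewrite (_ : 2%:R = 0) ?mulr0 ?addr0 //; apply/val_inj.
by rewrite mulr1 (negPf cm).
Qed.
Definition opD (F : V) : V := opH F + opT F + opQ F.

Lemma opDE F : opD F = opH F + opT F + opQ F. Proof. by []. Qed.
Lemma opDD : {morph opD : F G / F + G}.
Proof. by move=> F G; rewrite /opD opHD opTD opQD [opH F + _ + _]addrACA [LHS]addrACA. Qed.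

Lemma opD_ltrans g F : ltrans g (opD F) = opD (ltrans g F).
Proof.
rewrite /opD -ltrans_H -ltrans_T -ltrans_Q.
by apply/ffunP => h; rewrite ffunE !add_ffunE !(ffunE (fun h => _ (g * h)%g)).
Qed.

End Operators.

(** * The operators as linear maps between spaces of forms *)

Section Complex.
Variables (T : finGroupType) (n' r : nat).
Local Notation n := n'.+1.
Variable C : coordinates T n r.
Local Notation R := {mpoly 'F_2[n + r]}.
Local Notation V := {ffun T -> R}.

Definition poly_space q : vectType 'F_2 := dhomog (n' + r).+1 'F_2 q.
Local Notation L := poly_space.
Local Notation I q := {ffun T -> L q}.
Local Notation qbar := (qbar C).

Definition pol q (x : L q) : R := mpoly_of_dhomog x.

Lemma pol_is_linear q : linear (@pol q).
Proof. by move=> a x y. Qed.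
HB.instance Definition _ q := GRing.isLinear.Build 'F_2 (L q) R _ (@pol q) (@pol_is_linear q).

Lemma polP q a (f g : L q) : pol (a *: f + g) = a *: pol f + pol g.
Proof. exact: pol_is_linear. Qed.

Lemma pol_inj q : injective (@pol q). Proof. exact: val_inj. Qed.
Lemma pol_homog q (x : L q) : pol x \is q.-homog. Proof. exact: dhomog_is_dhomog. Qed.
(** [indhomog] falls back on a default value when [p] is not homogeneous of degree [q], so uses go
    through [mkpolK] and a proof of homogeneity. *)
Definition mkpol q (p : R) : L q := indhomog q p.
Lemma mkpolK q p : p \is q.-homog -> pol (mkpol q p) = p.
Proof. by move=> ph; rewrite /pol /mkpol /indhomog insubdK. Qed.

Definition polf q (f : I q) : V := [ffun h => pol (f h)].
Lemma polf_is_linear q : linear (@polf q).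
Proof. by move=> a f g; apply/ffunP => h; rewrite !ffunE linearP. Qed.
HB.instance Definition _ q :=
  GRing.isLinear.Build 'F_2 (I q) V _ (@polf q) (@polf_is_linear q).

Lemma polfP q a (f g : I q) : polf (a *: f + g) = a *: polf f + polf g.
Proof. exact: polf_is_linear. Qed.

Lemma polf_inj q : injective (@polf q).
Proof. by move=> f g /ffunP fg; apply/ffunP => h; apply: pol_inj; have := fg h; rewrite !ffunE. Qed.

Definition mkpolf q (F : V) : I q := [ffun h => mkpol q (F h)].
Lemma mkpolfK q (F : V) : (forall h, F h \is q.-homog) -> polf (mkpolf q F) = F.
Proof. by move=> Fh; apply/ffunP => h; rewrite !ffunE mkpolK. Qed.

Lemma polf_homog q (f : I q) h : polf f h \is q.-homog.
Proof. by rewrite ffunE pol_homog. Qed.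

Lemma homogXM q i (p : R) : p \is q.-homog -> 'X_i * p \is q.+1.-homog.
Proof. by move=> ph; rewrite -[q.+1]add1n; apply: dhomogM => //; rewrite dhomogX; apply/eqP/mdeg1. Qed.

Lemma homog_deriv q i (p : R) : p \is q.+1.-homog -> p^`M(i) \is q.-homog.
Proof.
move=> /dhomogP ph; apply/dhomogP => m; rewrite mcoeff_msupp mcoeff_deriv => pm.
have /ph mq : (m + U_(i))%MM \in msupp p.
  by rewrite mcoeff_msupp; apply: contraNneq pm => ->; rewrite mul0rn.
have : mdeg (m + U_(i))%MM = q.+1 := mq.
by rewrite mdegD mdeg1 addn1 => -[].
Qed.

Lemma homog_deriv0 i (p : R) : p \is 0.-homog -> p^`M(i) = 0.
Proof.
move=> ph; apply/mpolyP => m; rewrite mcoeff_deriv mcoeff0.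
have ne0 : mdeg (m + U_(i))%MM != 0%N by rewrite mdegD mdeg1 addn1.
by rewrite (dhomog_nemf_coeff ph ne0) mul0rn.
Qed.

Local Notation opD := (opD C).

Lemma homog_xxderiv q i j k (p : R) : p \is q.-homog ->
  'X_i * 'X_j * p^`M(k) \is q.+1.-homog.
Proof.
case: q => [|q] ph; first by rewrite homog_deriv0 // mulr0 rpred0.
by rewrite -mulrA; apply/homogXM/homogXM/homog_deriv.
Qed.

Lemma opD_homog q (F : V) : (forall h, F h \is q.-homog) -> forall h, opD F h \is q.+1.-homog.
Proof.
move=> Fh h; rewrite !add_ffunE opHE opTE opQE.
apply: rpredD; [apply: rpredD|]; apply: rpred_sum => i _.
- by apply: homogXM; apply: rpredD; apply: Fh.
- by apply: homogXM; apply: rpredD; apply: Fh.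
exact: homog_xxderiv.
Qed.

Definition diff_fun q (f : I q) : I q.+1 := mkpolf q.+1 (opD (polf f)).

Lemma diff_funE q (f : I q) : polf (diff_fun f) = opD (polf f).
Proof. by rewrite mkpolfK //; apply/opD_homog/polf_homog. Qed.

Lemma diff_is_linear q : linear (@diff_fun q).
Proof.
move=> a f g; apply: polf_inj.
rewrite diff_funE [in LHS]polfP [RHS]polfP.
apply: etrans (f_equal2 (fun x y : V => a *: x + y) (esym (diff_funE f)) (esym (diff_funE g))).
case: (F2_cases a) => ->; first by rewrite !scale0r !add0r.
by rewrite !scale1r opDD.
Qed.
HB.instance Definition _ q :=
  GRing.isLinear.Build 'F_2 (I q) (I q.+1) _ (@diff_fun q) (@diff_is_linear q).

Fact diff_key : unit. Proof. by []. Qed.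
Definition diff q : 'Hom(I q, I q.+1) := locked_with diff_key (linfun (@diff_fun q)).

Lemma diffE q (f : I q) : polf (diff q f) = opD (polf f).
Proof. by rewrite /diff locked_withE lfunE diff_funE. Qed.

Definition qb_fun q (c : L q) : L q.+1 := mkpol q.+1 (qbar (pol c)).
Lemma qb_funE q (c : L q) : pol (qb_fun c) = qbar (pol c).
Proof. by rewrite mkpolK // rpred_sum // => a _; apply/homog_xxderiv/pol_homog. Qed.

Lemma qb_is_linear q : linear (@qb_fun q).
Proof.
move=> a f g; apply: pol_inj; rewrite qb_funE [in LHS]polP [RHS]polP qbarD qbarZ.
exact: (f_equal2 (fun x y : R => a *: x + y) (esym (qb_funE f)) (esym (qb_funE g))).
Qed.
HB.instance Definition _ q :=
  GRing.isLinear.Build 'F_2 (L q) (L q.+1) _ (@qb_fun q) (@qb_is_linear q).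
Fact qb_key : unit. Proof. by []. Qed.
Definition qb q : 'Hom(L q, L q.+1) := locked_with qb_key (linfun (@qb_fun q)).
Lemma qbE q (c : L q) : pol (qb q c) = qbar (pol c).
Proof. by rewrite /qb locked_withE lfunE qb_funE. Qed.

Lemma polf_ltr q g (f : I q) : polf (ltr (L q) g f) = ltrans g (polf f).
Proof. by apply/ffunP => h; rewrite !ffunE ltrE. Qed.

Lemma diff_equi q g f : diff q (ltr (L q) g f) = ltr (L q.+1) g (diff q f).
Proof. by apply: polf_inj; rewrite diffE !polf_ltr diffE opD_ltrans. Qed.

Lemma polf_cst q (c : L q) : polf [ffun=> c] = cst T (pol c).
Proof. by apply/ffunP => h; rewrite !ffunE. Qed.

End Complex.

(** * Constants in the image of D, bidegree by bidegree *)

Section Components.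
Variables (T : finGroupType) (n r : nat) (C : coordinates T n r).
Local Notation R := {mpoly 'F_2[n + r]}.
Local Notation V := {ffun T -> R}.
Local Notation opH := (opH C).
Local Notation opT := (opT C).
Local Notation opQ := (opQ C).
Local Notation qbar := (qbar C).

Lemma bipart0 p q : bipart p q (0 : R) = 0.
Proof. exact: mfilter0. Qed.

Lemma bipart_id p q (f : R) : bihom p q f -> bipart p q f = f.
Proof. by move/bihomP. Qed.

Lemma bipart_ne p q p' q' (f : R) : bihom p q f -> q' != q -> bipart p' q' f = 0.
Proof.
move=> fh qq'; apply/mpolyP => m; rewrite mcoeff_mfilter mcoeff0.
case: (eqVneq f@_m 0) => [->|/fh /andP[_ /eqP em]]; first by rewrite mul0rn.
by rewrite /bideg em [q == _]eq_sym (negPf qq') andbF.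
Qed.

Definition bip p q (F : V) : V := [ffun h => bipart p q (F h)].

Lemma bipD p q : {morph bip p q : F G / F + G}.
Proof. by move=> F G; apply/ffunP => h; rewrite !ffunE bipartD. Qed.
Lemma bihomf_bip p q F : bihomf p q (bip p q F).
Proof. by move=> h; rewrite ffunE; apply: bihom_bipart. Qed.
Lemma bip_id p q F : bihomf p q F -> bip p q F = F.
Proof. by move=> Fh; apply/ffunP => h; rewrite ffunE bipart_id. Qed.
Lemma bip_ne p q p' q' F : bihomf p q F -> q' != q -> bip p' q' F = 0.
Proof. by move=> Fh qq'; apply/ffunP => h; rewrite !ffunE (bipart_ne _ (Fh h)). Qed.
Lemma bip_cst p q c : bip p q (cst T c) = cst T (bipart p q c).
Proof. by apply/ffunP => h; rewrite !ffunE. Qed.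

Lemma three_parts p (A2 A1 A0 F : V) : bihomf p 2 A2 -> bihomf p.+1 1 A1 -> bihomf p.+2 0 A0 ->
  A2 + A1 + A0 = F -> [/\ A2 = bip p 2 F, A1 = bip p.+1 1 F & A0 = bip p.+2 0 F].
Proof.
move=> h2 h1 h0 <-; rewrite !bipD (bip_id h2) (bip_id h1) (bip_id h0).
by split; rewrite ?(bip_ne _ h2) ?(bip_ne _ h1) ?(bip_ne _ h0) ?addr0 ?add0r.
Qed.

Lemma opD_parts p f1 f0 : bihomf p 1 f1 -> bihomf p.+1 0 f0 ->
  opD C (f1 + f0) = opH f1 + (opT f1 + opH f0) + (opQ f1 + opT f0).
Proof.
move=> h1 h0; rewrite /opD opHD opTD opQD (bihomf_Q0 _ h0) addr0.
by rewrite -!addrA; congr (_ + _); rewrite addrCA; congr (_ + (_ + _)); apply: addrC.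
Qed.

Lemma opD_partsP p f1 f0 F : bihomf p 1 f1 -> bihomf p.+1 0 f0 -> opD C (f1 + f0) = F ->
  [/\ opH f1 = bip p 2 F, opT f1 + opH f0 = bip p.+1 1 F
    & opQ f1 + opT f0 = bip p.+2 0 F].
Proof.
move=> h1 h0; rewrite (opD_parts h1 h0); apply: three_parts.
- exact: bihomf_H.
- by apply: bihomfD; [apply: bihomf_T | apply: bihomf_H].
by apply: bihomfD; [apply: bihomf_Q | apply: bihomf_T].
Qed.

(** For [p = 0] the sums [f1 + f0] are all of [I_1]; for [p = 1] they are the elements of [I_2] with
    no part quadratic in [e]. *)
Definition attain p c := exists f1 f0,
  [/\ bihomf p 1 f1, bihomf p.+1 0 f0 & opD C (f1 + f0) = cst T c].

Lemma attain_parts p c : attain p c ->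
  c = bipart p 2 c + bipart p.+1 1 c + bipart p.+2 0 c.
Proof.
case=> f1 [f0 [h1 h0 Df]]; have [e2 e1 e0] := opD_partsP h1 h0 Df.
have := opD_parts h1 h0; rewrite Df e2 e1 e0 !bip_cst => /ffunP/(_ 1%g).
by rewrite !ffunE.
Qed.

Lemma attain_top p c : attain p c -> qbar (bipart p 2 c) = 0.
Proof.
case=> f1 [f0 [h1 h0 Df]]; have [e2 e1 e0] := opD_partsP h1 h0 Df.
rewrite !bip_cst in e2 e1 e0; apply: (leading_cycle (w'' := 0) e2 e1).
by rewrite e0 H_0 addr0.
Qed.

(** The attained constant is [c] plus the correction [d] of [lift_two], which has [e]-degree 1 and
    is invisible in the leading part. *)
Lemma attain_topE p c : bihom p 2 c -> qbar c = 0 ->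
  exists2 c', attain p c' & bipart p 2 c' = c.
Proof.
move=> ch qc; have [w1 [w0 [d [h1 h0 e2 [dh e1] e0]]]] := lift_two ch qc (@qbar_surj _ _ _ C p.+1).
exists (c + d); last by rewrite bipartD bipart_id // (bipart_ne _ dh) ?addr0.
exists w1, w0; split=> //; rewrite (opD_parts h1 h0) e2 e1 e0 addr0.
by apply/ffunP => h; rewrite !ffunE.
Qed.

(** Now [f1 = H g], and adding [D g] replaces [f1 + f0] by [f0 + T g] without changing its image, so
    that [leading_cycle] applies one [e]-degree lower. *)
Lemma attain_low p c : bipart p 2 c = 0 -> attain p c -> qbar c = 0.
Proof.
move=> c2 cp; have cE := attain_parts cp; case: cp => f1 [f0 [h1 h0 Df]].
have [e2 e1 e0] := opD_partsP h1 h0 Df; rewrite !bip_cst in e2 e1 e0.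
have Hf1 : opH f1 = 0 by rewrite e2 c2; apply/ffunP => h; rewrite !ffunE.
have [g gh f1E] := H_exact h1 Hf1.
have TTg : opT (opT g) = opQ f1 by rewrite -(opHQ C g) (bihomf_Q0 _ gh) H_0 add0r -f1E.
rewrite cE c2 add0r qbarD (qbar_free C (@bihom_bipart _ _ p.+2 0 c)) addr0.
apply: (@leading_cycle _ _ _ C (f0 + opT g) 0 0 _ (bipart p.+2 0 c) 0).
- by rewrite opHD opHT -f1E addrC.
- by rewrite opTD TTg H_0 addr0 addrC.
have gh' : bihomf p.+1 0 (f0 + opT g) by apply: bihomfD => //; apply: bihomf_T.
by rewrite (bihomf_Q0 _ gh') T_0 H_0 !addr0; apply/ffunP => h; rewrite !ffunE.
Qed.

Lemma attain_lowE p c1 c0 : bihom p.+1 1 c1 -> bihom p.+2 0 c0 -> qbar c1 = 0 ->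
  attain p (c1 + c0).
Proof.
move=> h1 h0 q1; have [w [wh Hw Tw]] := lift_one h1 q1.
have [w' [wh' Hw' Tw']] := const_exact C h0.
have zh : bihomf p 1 (0 : V) by move=> h; rewrite ffunE; apply: bihom0.
have ww : bihomf p.+1 0 (w + w') by apply: bihomfD.
exists 0, (w + w'); split=> //; rewrite (opD_parts zh ww) H_0 T_0 opHD opTD Hw Hw' Tw Tw'.
rewrite !addr0 !add0r (_ : opQ 0 = 0) ?add0r; first by apply/ffunP => h; rewrite !ffunE.
by apply: (@bihomf_Q0 _ _ _ C p) => h; rewrite ffunE; apply: bihom0.
Qed.

End Components.

(** * Cohomology as kernels of a derivation *)

Section Cohomology.
Variables (T : finGroupType) (n' r : nat).
Local Notation n := n'.+1.
Variable C : coordinates T n r.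
Local Notation R := {mpoly 'F_2[n + r]}.
Local Notation V := {ffun T -> R}.
Local Notation L := (poly_space n' r).
Local Notation I q := {ffun T -> L q}.
Local Notation opH := (opH C).
Local Notation opT := (opT C).
Local Notation opQ := (opQ C).
Local Notation opD := (opD C).
Local Notation qbar := (qbar C).
Local Notation diff q := (diff C q).
Local Notation qb q := (qb C q).

Lemma qbP q (c : L q) : reflect (qbar (pol c) = 0) (c \in lker (qb q)).
Proof.
apply: (iffP (lkerP _ _)) => [qc|qc]; first by rewrite -qbE qc linear0.
by apply: pol_inj; rewrite qbE qc linear0.
Qed.

Lemma bipart_is_homog d p q (f : R) : (p + q)%N = d -> bipart p q f \is d.-homog.
Proof. by move=> <-; apply/bihom_homog/bihom_bipart. Qed.

(** The only other bidegree in positive [e]-degree would be [(0, 3)], occurring for [p = 1]; a cycle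
    has no such part by [qbar_odd_inj]. *)
Lemma ker_parts p (c : R) : (p <= 1)%N -> c \is p.+2.-homog -> qbar c = 0 ->
  c = bipart p 2 c + bipart p.+1 1 c + bipart p.+2 0 c.
Proof.
move=> le_p1 ch qc; have := bipart_sum ch.
case: p le_p1 ch => [|[|//]] _ ch; rewrite !big_ord_recr big_ord0 /= add0r => cE.
  by rewrite {1}cE -addrA addrC [X in X + _]addrC.
suff c3 : bipart 0 3 c = 0.
  by rewrite {1}cE c3 addr0 -addrA addrC [X in X + _]addrC.
apply: (@qbar_odd_inj _ _ _ C 3) => //; first exact: bihom_bipart.
by rewrite -bipart_qbar qc bipart0.
Qed.

Definition part_fun d p q (c : L d) : L d := mkpol d (bipart p q (pol c)).
Lemma part_funE d p q c : pol (@part_fun d p q c) = bipart p q (pol c).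
Proof.
rewrite mkpolK //; have [/bipart_is_homog-> //|pqd] := eqVneq (p + q)%N d.
by rewrite (bipart_homog pqd (pol_homog c)) dhomog0.
Qed.

Lemma part_is_linear d p q : linear (@part_fun d p q).
Proof.
move=> a f g; apply: pol_inj; rewrite part_funE polP [RHS]polP bipartD.
apply: etrans (f_equal2 (fun x y : R => a *: x + y) (esym (part_funE p q f)) (esym (part_funE p q g))).
congr (_ + _); apply/mpolyP => m; rewrite mcoeff_mfilter !mcoeffZ mcoeff_mfilter.
by rewrite mulrnAr.
Qed.
HB.instance Definition _ d p q :=
  GRing.isLinear.Build 'F_2 _ _ _ (@part_fun d p q) (@part_is_linear d p q).
Fact part_key : unit. Proof. by []. Qed.
Definition part d p q : 'End(L d) := locked_with part_key (linfun (@part_fun d p q)).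
Lemma partE d p q c : pol (part d p q c) = bipart p q (pol c).
Proof. by rewrite /part locked_withE lfunE part_funE. Qed.

Section DimAttain.
Variable p : nat.
Hypothesis le_p1 : (p <= 1)%N.
Local Notation top := (part p.+2 p 2).

(** The two spaces are compared only through the projection to [e]-degree 2: their images agree by
    [attain_top] and [attain_topE], and its kernels in them by [attain_low] and [attain_lowE]. *)
Lemma dim_attain (N : {vspace L p.+2}) :
  (forall c, c \in N <-> attain C p (pol c)) -> \dim N = \dim (lker (qb p.+2)).
Proof.
move=> NP; set K := lker (qb p.+2).
have KP c : c \in K <-> qbar (pol c) = 0 by split=> /qbP.
have topP c : c \in lker top <-> bipart p 2 (pol c) = 0.
  split=> [/lkerP t0|c2]; first by rewrite -partE t0 linear0.
  by apply/lkerP/pol_inj; rewrite partE c2 linear0.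
have eqK : (N :&: lker top = K :&: lker top)%VS; last have eqI : (top @: N = top @: K)%VS.
- apply/vspaceP => c; rewrite !memv_cap; apply: andb_id2r => /topP c2.
  apply/idP/idP => [/NP/(attain_low c2)/KP //|/KP qc].
  apply/NP; have cE := ker_parts le_p1 (pol_homog c) qc.
  rewrite cE c2 add0r; apply: attain_lowE; try exact: bihom_bipart.
  by rewrite -bipart_qbar qc bipart0.
- apply/vspaceP => c; apply/memv_imgP/memv_imgP => [[d /NP dN ->]|[d /KP dK ->]].
    exists (top d); first by apply/KP; rewrite partE (attain_top dN).
    by apply: pol_inj; rewrite !partE (bipart_id (@bihom_bipart _ _ p 2 (pol d))).
  have qt : qbar (bipart p 2 (pol d)) = 0 by rewrite -bipart_qbar dK bipart0.
  have [c' c'N c'E] := attain_topE (@bihom_bipart _ _ p 2 (pol d)) qt.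
  have c'h : c' \is p.+2.-homog.
    rewrite (attain_parts c'N); apply: rpredD; [apply: rpredD|]; apply: bipart_is_homog.
    - exact: addn2.
    - exact: addn1.
    exact: addn0.
  exists (mkpol p.+2 c'); first by apply/NP; rewrite mkpolK.
  by apply: pol_inj; rewrite !partE mkpolK // c'E.
by rewrite -(limg_ker_dim top N) eqK eqI limg_ker_dim.
Qed.

End DimAttain.

Lemma dim_poly_space q : dim (L q) = 'C(q + (n' + r), q).
Proof. by []. Qed.

Lemma bip_sum1 (F : V) : (forall h, F h \is 1.-homog) -> F = bip 0 1 F + bip 1 0 F.
Proof.
move=> Fh; apply/ffunP => h; have := bipart_sum (Fh h).
rewrite !big_ord_recr big_ord0 /= add0r add_ffunE !(ffunE (fun h => bipart _ _ _)) => {1}->.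
exact: addrC.
Qed.

Lemma bip_sum2 (F : V) : (forall h, F h \is 2.-homog) ->
  F = bip 0 2 F + (bip 1 1 F + bip 2 0 F).
Proof.
move=> Fh; apply/ffunP => h; have := bipart_sum (Fh h).
rewrite !big_ord_recr big_ord0 /= add0r !add_ffunE !(ffunE (fun h => bipart _ _ _)) => {1}->.
by rewrite addrC [X in _ + X]addrC.
Qed.

Lemma bip0 p q : bip p q (0 : V) = 0.
Proof. by apply/ffunP => h; rewrite !ffunE bipart0. Qed.

Lemma cst_0 : cst T (0 : R) = 0.
Proof. by apply/ffunP => h; rewrite !ffunE. Qed.

Lemma bihomf_homog d p q (F : V) : (p + q)%N = d -> bihomf p q F -> forall h, F h \is d.-homog.
Proof. by move=> <- Fh h; apply/bihom_homog/Fh. Qed.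

Lemma bihomf_00 (f : I 0) : bihomf 0 0 (polf f).
Proof.
move=> h m mF; have := dhomogP _ _ _ (polf_homog f h) m; rewrite mcoeff_msupp => /(_ mF) md.
have : mdeg m = 0%N := md; rewrite mdeg_bi => /eqP; rewrite addn_eq0.
by [].
Qed.

Lemma opD_free p (G : V) : bihomf p 0 G -> opD G = opH G + opT G.
Proof. by move=> Gh; rewrite opDE (bihomf_Q0 _ Gh) addr0. Qed.

(** Without [e]-variables the terms [T Q], [Q T] and [Q Q] of [D D] drop out. *)
Lemma dd_free p (G : V) : bihomf p 0 G -> opD (opD G) = 0.
Proof.
move=> Gh; rewrite (opD_free Gh) (opD_parts C (bihomf_H (C := C) Gh) (bihomf_T (C := C) Gh)).
rewrite opHH opHT addVV addr0 add0r.
by rewrite -(opHQ C G) (bihomf_Q0 _ Gh) H_0 add0r addVV.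
Qed.

Lemma free_parts p (G : V) c : bihomf p 0 G -> opD G = cst T c ->
  opH G = cst T (bipart p 1 c) /\ opT G = cst T (bipart p.+1 0 c).
Proof.
move=> Gh; rewrite (opD_free Gh) => Dc; rewrite -!bip_cst -Dc !bipD.
rewrite (bip_id (bihomf_H (C := C) Gh)) (bip_id (bihomf_T (C := C) Gh)).
by rewrite (bip_ne _ (bihomf_T (C := C) Gh)) // (bip_ne _ (bihomf_H (C := C) Gh)) // addr0 add0r.
Qed.

Lemma const_of_inv (F : V) : (forall a h, F (h * v C a)%g = F h) ->
  (forall i h, F (h * u C i)%g = F h) -> forall h, F h = F 1%g.
Proof.
move=> Fv Fu h; pose x : {ffun 'I_n -> 'F_2} := [ffun i => X C i h].
rewrite (V_inv Fv (h := lift_x C x)) => [|i]; last by rewrite X_lift ffunE.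
rewrite -[lift_x C x]mul1g; move: (1%g : T); rewrite /lift_x.
elim/big_rec: _ => [|i k _ IHk] g; first by rewrite mulg1.
by rewrite mulgA IHk; case: (_ != 0); rewrite ?expg1 ?expg0 ?mulg1.
Qed.

Lemma T_inv (F : V) : bihomf 0 0 F -> opT F = 0 -> forall i h, F (h * u C i)%g = F h.
Proof.
move=> Fh /ffunP T0 i h; have := T0 h; rewrite opTE [RHS]ffunE => s0.
have := sum_X_eq0 (@lshift_inj n r) _ s0 i => /(_ _)/eqP; rewrite addr_eq0 oppFF => fE.
apply/eqP/fE => b k mu muk; apply/eqP/negPn/negP => muF.
have /andP[/eqP xm _] := bihomD (Fh _) (Fh _) muF.
have : (mu (lshift r k) <= xdeg mu)%N by rewrite /xdeg (bigD1 k) //= leq_addr.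
by rewrite xm leqn0 => mu0; case/negP: muk.
Qed.

Lemma lker_diffP q (f : I q) : f \in lker (diff q) <-> opD (polf f) = 0.
Proof.
split=> [/lkerP f0|f0]; first by rewrite -diffE f0 linear0.
by apply/lkerP/polf_inj; rewrite diffE f0 linear0.
Qed.

Lemma limg_diffP q (f : I q.+1) :
  f \in limg (diff q) <-> exists2 G : V, (forall h, G h \is q.-homog) & polf f = opD G.
Proof.
split=> [/memv_imgP[g _ ->]|[G Gh fE]].
  by exists (polf g); [exact: polf_homog | rewrite diffE].
apply/memv_imgP; exists (mkpolf q G); first exact: memvf.
by apply: polf_inj; rewrite diffE mkpolfK.
Qed.

Lemma ker_diff0 (f : I 0) : reflect (exists c, f = [ffun=> c]) (f \in lker (diff 0)).
Proof.
apply: (iffP idP) => [/lker_diffP Df|[c ->]].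
  have fh := @bihomf_00 f; rewrite -[0 in RHS]cst_0 in Df.
  have [Hf Tf] := free_parts fh Df; rewrite !bipart0 !cst_0 in Hf Tf.
  exists (f 1%g); apply/ffunP => h; rewrite ffunE; apply: pol_inj.
  have := const_of_inv (H_inv fh Hf) (T_inv fh Tf) h.
  by rewrite !ffunE.
apply/lker_diffP; rewrite polf_cst (@opD_free 0).
  by rewrite H_cst T_cst addr0.
by rewrite -polf_cst; apply: bihomf_00.
Qed.

Lemma exact_diff : lker (diff 1) = limg (diff 0).
Proof.
apply/vspaceP => f; apply/idP/idP => [/lker_diffP Df|/limg_diffP[G Gh fE]]; last first.
  apply/lker_diffP; rewrite fE; have := @bihomf_00 (mkpolf 0 G); rewrite mkpolfK //.
  exact: dd_free.
have fE := bip_sum1 (polf_homog f).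
have h1 : bihomf 0 1 (bip 0 1 (polf f)) by apply: bihomf_bip.
have h0 : bihomf 1 0 (bip 1 0 (polf f)) by apply: bihomf_bip.
rewrite fE in Df; have [] := opD_partsP (C := C) h1 h0 Df; rewrite !bip0 => e2 e1 e0.
have [g [gh gE1 gE0]] := exact_free (C := C) h1 h0 e2 e1 e0.
apply/limg_diffP; exists g; first exact: bihomf_homog gh.
by rewrite (opD_free gh) -gE1 -gE0.
Qed.

Definition consts (q : nat) (U : {vspace I q}) : {vspace L q} :=
  (linfun (@cst_fun T (L q)) @^-1: U)%VS.
Lemma constsE q (U : {vspace I q}) c : (c \in consts U) = ([ffun=> c] \in U).
Proof. by rewrite -memv_preim lfunE. Qed.

(** In degree 1 the spaces do coincide: both consist of the linear forms in the [x]-variables. *)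
Lemma consts1 : consts (limg (diff 0)) = lker (qb 1).
Proof.
apply/vspaceP => c; rewrite constsE; apply/idP/idP => [/limg_diffP[G Gh]|/qbP qc].
  have Gh0 : bihomf 0 0 G by have := @bihomf_00 (mkpolf 0 G); rewrite mkpolfK.
  rewrite polf_cst => /esym/(free_parts Gh0)[HG TG].
  have q1 : qbar (bipart 0 1 (pol c)) = 0.
    apply: (leading_cycle (w' := 0) (w'' := 0) (c'' := 0) HG).
      by rewrite TG H_0 addr0.
    by rewrite (bihomf_Q0 _ Gh0) T_0 H_0 !addr0 cst_0.
  apply/qbP; have := bipart_sum (pol_homog c).
  rewrite !big_ord_recr big_ord0 /= add0r => ->.
  by rewrite qbarD q1 addr0 (qbar_free C (@bihom_bipart _ _ 1 0 _)).
have cE := bipart_sum (pol_homog c); rewrite !big_ord_recr big_ord0 /= add0r in cE.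
have c1 : bipart 0 1 (pol c) = 0.
  apply: (@qbar_odd_inj _ _ _ C 1) => //; first exact: bihom_bipart.
  by rewrite -bipart_qbar qc bipart0.
have [w [wh Hw Tw]] := const_exact C (@bihom_bipart _ _ 1 0 (pol c)).
apply/limg_diffP; exists w; first exact: bihomf_homog wh.
by rewrite (opD_free wh) Hw Tw add0r polf_cst {1}cE c1 addr0.
Qed.

Lemma consts2 c : c \in consts (limg (diff 1)) <-> attain C 0 (pol c).
Proof.
rewrite constsE; split=> [/limg_diffP[G Gh]|[f1 [f0 [h1 h0 Df]]]].
  rewrite polf_cst => GE; exists (bip 0 1 G), (bip 1 0 G).
  by split; [exact: bihomf_bip | exact: bihomf_bip | rewrite -bip_sum1].
apply/limg_diffP; exists (f1 + f0); last by rewrite polf_cst.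
by move=> h; rewrite add_ffunE rpredD //; apply: bihomf_homog; eauto.
Qed.

Local Notation M2 := (limg (diff 1)).

(** The preimage in [I_2] of the invariants of the quotient by [M2]. *)
Definition invariants_mod : {vspace I 2} :=
  (\bigcap_(g : T) ((ltr (L 2) g + \1) @^-1: M2))%VS.
Local Notation W := invariants_mod.

Lemma invariants_modP w : reflect (forall g, ltr (L 2) g w + w \in M2) (w \in W).
Proof.
apply: (iffP idP) => [|wW].
  rewrite memvE => /subv_bigcapP wW g; have := wW g isT.
  by rewrite -memvE -memv_preim add_lfunE id_lfunE.
rewrite memvE; apply/subv_bigcapP => g _.
by rewrite -memvE -memv_preim add_lfunE id_lfunE.
Qed.

Lemma limg_diff1_parts (f : I 2) : f \in M2 -> exists f1 f0 : V,
  [/\ bihomf 0 1 f1, bihomf 1 0 f0, bip 0 2 (polf f) = opH f1,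
      bip 1 1 (polf f) = opT f1 + opH f0 & bip 2 0 (polf f) = opQ f1 + opT f0].
Proof.
case/limg_diffP=> G Gh fE; exists (bip 0 1 G), (bip 1 0 G).
have h1 : bihomf 0 1 (bip 0 1 G) by apply: bihomf_bip.
have h0 : bihomf 1 0 (bip 1 0 G) by apply: bihomf_bip.
have Df : opD (bip 0 1 G + bip 1 0 G) = polf f by rewrite fE -bip_sum1.
by have [e2 e1 e0] := opD_partsP h1 h0 Df; split.
Qed.

(** Exactness of [D] at [I_2], available where the part quadratic in [e] is absent. *)
Lemma limg_diff1_low (f : I 2) : bip 0 2 (polf f) = 0 ->
  f \in M2 <-> opD (polf f) = 0.
Proof.
move=> f2; have fE := bip_sum2 (polf_homog f); rewrite f2 add0r in fE.
split=> [/limg_diff1_parts[f1 [f0 [h1 h0 e2 e1 e0]]]|Df].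
  have [g gh f1E] := H_exact (C := C) h1 (etrans (esym e2) f2).
  have TTg : opT (opT g) = opQ f1 by rewrite -(opHQ C g) (bihomf_Q0 _ gh) H_0 add0r -f1E.
  have kh : bihomf 1 0 (f0 + opT g) by apply: bihomfD => //; apply: bihomf_T.
  suff -> : polf f = opD (f0 + opT g) by apply: dd_free kh.
  rewrite fE e1 e0 (opD_free kh) opHD opTD opHT -f1E TTg.
  by rewrite [opT f1 + _]addrC [opQ f1 + _]addrC.
have h1 : bihomf 1 1 (bip 1 1 (polf f)) by apply: bihomf_bip.
have h0 : bihomf 2 0 (bip 2 0 (polf f)) by apply: bihomf_bip.
rewrite fE in Df; have [] := opD_partsP (C := C) h1 h0 Df; rewrite !bip0 => e2 e1 e0.
have [g [gh gE1 gE0]] := exact_free (C := C) h1 h0 e2 e1 e0.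
apply/limg_diffP; exists g; first exact: bihomf_homog gh.
by rewrite (opD_free gh) -gE1 -gE0.
Qed.

Lemma bip_ltrans p q g (F : V) : bip p q (ltrans g F) = ltrans g (bip p q F).
Proof. by apply/ffunP => h; rewrite !ffunE. Qed.

Lemma ltransD g (F G : V) : ltrans g (F + G) = ltrans g F + ltrans g G.
Proof. by apply/ffunP => h; rewrite !ffunE. Qed.

(** Translation changes [w] by a boundary, so the components of [D w] in bidegrees [(0, 3)],
    [(1, 2)] and [(2, 1)] are constants. By [leading_cycle] the first is a [qbar]-cycle, hence zero
    as its [e]-degree is odd. *)
Lemma invariant_top w : w \in W -> opH (bip 0 2 (polf w)) = 0.
Proof.
move=> /invariants_modP wW.
set w2 := bip 0 2 (polf w); set w1 := bip 1 1 (polf w); set w0 := bip 2 0 (polf w).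
have inv (F : V) : (forall g, ltrans g F + F = 0) -> exists c, F = cst T c.
  by move=> Fi; exists (F 1%g); apply/ltrans_cst => g; apply/addV_eq/Fi.
have pE g : polf (ltr (L 2) g w + w) = ltrans g (polf w) + polf w.
  by rewrite raddfD /= polf_ltr.
have dW g : exists f1 f0 : V, [/\ ltrans g w2 + w2 = opH f1,
    ltrans g w1 + w1 = opT f1 + opH f0 & ltrans g w0 + w0 = opQ f1 + opT f0].
  have [f1 [f0 [_ _]]] := limg_diff1_parts (wW g); rewrite pE !bipD !bip_ltrans => e2 e1 e0.
  by exists f1, f0.
have [c3 E3] : exists c, opH w2 = cst T c.
  apply: inv => g; have [f1 [f0 [e2 _ _]]] := dW g.
  by rewrite ltrans_H -opHD e2 opHH.
have [c2 E2] : exists c, opT w2 + opH w1 = cst T c.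
  apply: inv => g; have [f1 [f0 [e2 e1 _]]] := dW g.
  rewrite ltransD ltrans_H ltrans_T addrACA -opTD -opHD e2 e1.
  by rewrite opHD opHH addr0 opHT addVV.
have [c1 E1] : exists c, opQ w2 + opT w1 + opH w0 = cst T c.
  apply: inv => g; have [f1 [f0 [e2 e1 e0]]] := dW g.
  rewrite !ltransD ltrans_H ltrans_T ltrans_Q [LHS]addrACA [X in X + _]addrACA.
  rewrite -opQD -opTD -opHD e2 e1 e0 opTD opHD -(opHQ C f1) opHT.
  rewrite [opH _ + opQ _]addrC -[opQ _ + _ + opT _]addrA [X in X + _](addrA (opQ _)).
  by rewrite addVV add0r addVV.
have q3 := leading_cycle E3 E2 E1.
have c3h : bihom 0 3 c3.
  have := bihomf_H (C := C) (@bihomf_bip _ _ _ 0 2 (polf w)); rewrite -/w2 E3 => /(_ 1%g).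
  by rewrite ffunE.
by rewrite E3 (qbar_odd_inj _ c3h q3) // cst_0.
Qed.

Definition topf_fun (f : I 2) : I 2 := mkpolf 2 (bip 0 2 (polf f)).
Lemma topf_funE f : polf (topf_fun f) = bip 0 2 (polf f).
Proof. by rewrite mkpolfK // => h; rewrite ffunE bipart_is_homog. Qed.

Lemma topf_is_linear : linear topf_fun.
Proof.
move=> a f g; apply: polf_inj; rewrite topf_funE polfP [RHS]polfP bipD.
apply: etrans (f_equal2 (fun x y : V => a *: x + y) (esym (topf_funE f)) (esym (topf_funE g))).
congr (_ + _); case: (F2_cases a) => ->; first by rewrite !scale0r bip0.
by rewrite !scale1r.
Qed.
HB.instance Definition _ := GRing.isLinear.Build 'F_2 _ _ _ topf_fun topf_is_linear.
Fact topf_key : unit. Proof. by []. Qed.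
Definition topf : 'End(I 2) := locked_with topf_key (linfun topf_fun).
Lemma topfE f : polf (topf f) = bip 0 2 (polf f).
Proof. by rewrite /topf locked_withE lfunE topf_funE. Qed.

Lemma lker_topfP f : f \in lker topf <-> bip 0 2 (polf f) = 0.
Proof.
split=> [/lkerP t0|f2]; first by rewrite -topfE t0 linear0.
by apply/lkerP/polf_inj; rewrite topfE f2 linear0.
Qed.

Lemma limg_diff1_inv : (M2 <= W)%VS.
Proof.
apply/subvP => f fM; apply/invariants_modP => g; apply: rpredD => //.
by case/memv_imgP: fM => e _ ->; rewrite -diff_equi memv_img ?memvf.
Qed.

(** The leading part of [w] is some [H g], which is also the leading part of [D g]. *)
Lemma limg_topf_inv : (topf @: W = topf @: M2)%VS.
Proof.
apply/eqP; rewrite eqEsubv (limgS _ limg_diff1_inv) andbT; apply/subvP => _ /memv_imgP[w wW ->].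
have [g gh gE] := H_exact (C := C) (@bihomf_bip _ _ _ 0 2 (polf w)) (invariant_top wW).
have gh1 : forall h, g h \is 1.-homog by apply: bihomf_homog gh.
have z0 : bihomf 1 0 (0 : V) by move=> h; rewrite ffunE; apply: bihom0.
apply/memv_imgP; exists (diff 1 (mkpolf 1 g)); first exact/memv_img/memvf.
apply: polf_inj; rewrite !topfE diffE mkpolfK //.
by have [] := opD_partsP (C := C) gh z0 (erefl _); rewrite addr0 -gE => <-.
Qed.

(** The differences [g w + w] have no leading part, so they lie in [M2] exactly when [D] kills them,
    that is, when [D w] is invariant. *)
Lemma invariant_lowP (w : I 2) : bip 0 2 (polf w) = 0 ->
  w \in W <-> exists c : L 3, opD (polf w) = cst T (pol c).
Proof.
move=> w2; have low g : bip 0 2 (polf (ltr (L 2) g w + w)) = 0.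
  by rewrite raddfD /= polf_ltr bipD bip_ltrans w2 addr0; apply/ffunP => h; rewrite !ffunE.
have DE g : opD (polf (ltr (L 2) g w + w)) = ltrans g (opD (polf w)) + opD (polf w).
  by rewrite raddfD /= polf_ltr opDD opD_ltrans.
split=> [/invariants_modP wW|[c cE]].
  exists (diff 2 w 1%g).
  have -> : pol (diff 2 w 1%g) = opD (polf w) 1%g by rewrite -diffE ffunE.
  by apply/ltrans_cst => g; apply: addV_eq; rewrite -DE; apply/(limg_diff1_low (low g)).
apply/invariants_modP => g; apply/(limg_diff1_low (low g)).
by rewrite DE cE; apply/ffunP => h; rewrite !ffunE addFF.
Qed.

Lemma dim_consts q (U : {vspace I q}) :
  (forall f, f \in U -> exists c, f = [ffun=> c]) -> \dim (consts U) = \dim U.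
Proof.
move=> Uc; pose k := linfun (@cst_fun T (L q)).
have k_inj : lker k == 0%VS.
  rewrite -subv0; apply/subvP => c /lkerP; rewrite lfunE memv0 => /ffunP/(_ 1%g).
  by rewrite !ffunE => ->.
rewrite -[LHS](limg_dim_eq (f := k)); last by rewrite (eqP k_inj) capv0.
rewrite lpreimK //; apply/subvP => f /Uc[c ->]; apply/memv_imgP; exists c; first exact: memvf.
by rewrite lfunE.
Qed.

Let low_homog (f1 f0 : V) : bihomf 1 1 f1 -> bihomf 2 0 f0 ->
  (forall h, (f1 + f0) h \is 2.-homog) /\ bip 0 2 (f1 + f0) = 0.
Proof.
move=> h1 h0; split=> [h|].
  by rewrite add_ffunE; apply: rpredD; [exact: (bihomf_homog _ h1) | exact: (bihomf_homog _ h0)].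
by rewrite bipD (bip_ne (q' := 2) 0 h1 isT) (bip_ne (q' := 2) 0 h0 isT) addr0.
Qed.

(** On this subspace [D] takes constant values, namely those attained for [p = 1], and its kernel is
    the part of [M2] without leading term. *)
Let W0 : {vspace I 2} := (W :&: lker topf)%VS.

Let W0P w : w \in W0 <-> w \in W /\ bip 0 2 (polf w) = 0.
Proof.
split=> [/mem_capP[wW /lker_topfP]|[wW w2]] //.
by apply/mem_capP; split=> //; apply/lker_topfP.
Qed.

Let W0_kernel : (W0 :&: lker (diff 2) = M2 :&: lker topf)%VS.
Proof.
apply/vspaceP => w; apply/idP/idP => /mem_capP[].
  move=> /W0P[wW w2] /lker_diffP Dw; apply/mem_capP; split.
    exact/(limg_diff1_low w2).
  exact/lker_topfP.
move=> wM /lker_topfP w2; apply/mem_capP; split.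
  by apply/W0P; split=> //; apply: (subvP limg_diff1_inv).
exact/lker_diffP/(limg_diff1_low w2).
Qed.

Let W0_image c : c \in consts (diff 2 @: W0) <-> attain C 1 (pol c).
Proof.
rewrite constsE; split=> [/memv_imgP[w /W0P[wW w2] cE]|[f1 [f0 [h1 h0 Df]]]].
  exists (bip 1 1 (polf w)), (bip 2 0 (polf w)); split; [exact: bihomf_bip | exact: bihomf_bip|].
  have wE := bip_sum2 (polf_homog w); rewrite w2 add0r in wE.
  by rewrite -wE -polf_cst -diffE cE.
have [fh f2] := low_homog h1 h0.
have wE : polf (mkpolf 2 (f1 + f0)) = f1 + f0 := mkpolfK fh.
have w2 : bip 0 2 (polf (mkpolf 2 (f1 + f0))) = 0 := etrans (f_equal (bip 0 2) wE) f2.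
have wD : opD (polf (mkpolf 2 (f1 + f0))) = cst T (pol c) := etrans (f_equal opD wE) Df.
have wW : mkpolf 2 (f1 + f0) \in W := (invariant_lowP w2).2 (ex_intro _ c wD).
apply/memv_imgP; exists (mkpolf 2 (f1 + f0)); first exact/W0P/(conj wW w2).
by apply: polf_inj; rewrite diffE wD polf_cst.
Qed.

Let dim_W0_image : \dim (diff 2 @: W0) = \dim (lker (qb 3)).
Proof.
apply: etrans (@dim_attain 1 isT _ W0_image); apply: esym; apply: dim_consts.
move=> _ /memv_imgP[w /W0P[wW w2] ->].
have /(invariant_lowP w2)[c cE] := wW; exists c.
by apply: polf_inj; rewrite diffE cE polf_cst.
Qed.

(** [W] and [M2] have the same leading parts, so they differ only by the image of [W0] under
    [diff 2]. *)
Lemma dim_invariants_mod : \dim W = (\dim (lker (qb 3)) + \dim M2)%N.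
Proof.
have := limg_ker_dim topf W; rewrite limg_topf_inv -/W0 => <-.
have := limg_ker_dim (diff 2) W0; rewrite W0_kernel dim_W0_image => <-.
have := limg_ker_dim topf M2 => <-.
by rewrite addnAC addnC.
Qed.

(** The dimension of [M2] enters once from the quotient and once from [dim_invariants_mod], and
    cancels. *)
Theorem cohomology_dims :
  [/\ coh_dim T 1 = \dim (lker (qb 1)),
      (coh_dim T 2 + 'C(1 + (n' + r), 1) = \dim (lker (qb 2)) + \dim (lker (qb 1)))%N
    & (coh_dim T 3 + 'C(2 + (n' + r), 2) = \dim (lker (qb 3)) + \dim (lker (qb 2)))%N].
Proof.
have [] := low_degree_cohomology (@diff_equi _ _ _ C 0) (@diff_equi _ _ _ C 1) _ ker_diff0
  exact_diff (constsE _) (constsE _) invariants_modP.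
  by rewrite dim_poly_space bin0.
rewrite !dim_poly_space consts1 dim_invariants_mod.
rewrite (@dim_attain 0 isT (consts M2)); last exact: consts2.
move=> -> -> e3; split; [exact: erefl | exact: erefl | apply/eqP; rewrite -(eqn_add2r (\dim M2)) e3].
by apply/eqP; apply: addnAC.
Qed.

End Cohomology.

Lemma mcoeff_euler N i (f : {mpoly 'F_2[N]}) m : ('X_i * f^`M(i))@_m = f@_m *+ m i.
Proof.
rewrite mcoeff_mulX; have [->|mi] := eqVneq (m i) 0%N; first by rewrite mulr0n.
by rewrite mcoeff_deriv submK ?lep1mP // mnmBE mnm1E eqxx subn1 prednK ?lt0n.
Qed.

Lemma bihom_euler n r p (c : {mpoly 'F_2[n + r]}) : bihom p 1 c ->
  c = \sum_a 'X_(rshift n a) * c^`M(rshift n a).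
Proof.
move=> ch; apply/mpolyP => m; rewrite raddf_sum /=.
rewrite (eq_bigr (fun a => c@_m *+ m (rshift n a))) => [|a _]; last exact: mcoeff_euler.
rewrite sumrMnr -/(edeg m); have [->|/ch/andP[_ /eqP->]] := eqVneq c@_m 0; last by [].
by rewrite mul0rn.
Qed.

Lemma comp_mpoly_homog (K : fieldType) k N q (lq : k.-tuple {mpoly K[N]}) p :
  (forall i, tnth lq i \is 1.-homog) -> p \is q.-homog -> p \mPo lq \is q.-homog.
Proof.
move=> lqh /dhomogP ph; rewrite comp_mpolyEX big_seq; apply: rpred_sum => m /ph mq.
apply: rpredZ; rewrite comp_mpolyX.
have <- : (\sum_(i < k) m i)%N = q by rewrite -mdegE; exact: mq.
elim/big_rec2: _ => [|i d s _ IHs]; first exact: dhomog1.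
apply: dhomogM => //; elim: (m i) => [|e IHe]; first exact: dhomog1.
by rewrite exprS -[e.+1]add1n; apply: dhomogM.
Qed.

(** * Ranks of the derivation *)

Section Embedding.
Variables (K : fieldType) (k N : nat) (iota : 'I_k -> 'I_N).
Hypothesis iota_inj : injective iota.

Definition supported (g : {mpoly K[N]}) :=
  forall m, g@_m != 0 -> forall j, m j != 0%N -> exists i, j = iota i.

Definition embed (f : {mpoly K[k]}) : {mpoly K[N]} := f \mPo [tuple 'X_(iota i) | i < k].
Definition unembed (g : {mpoly K[N]}) : {mpoly K[k]} :=
  g \mPo [tuple (if [pick i | iota i == j] is Some i then 'X_i else 0) | j < N].

Lemma embedX i : embed 'X_i = 'X_(iota i).
Proof. by rewrite /embed comp_mpolyXU -tnth_nth tnth_mktuple. Qed.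

Lemma unembedX i : unembed 'X_(iota i) = 'X_i.
Proof.
rewrite /unembed comp_mpolyXU -tnth_nth tnth_mktuple.
by case: pickP => [j /eqP/iota_inj-> //|/(_ i)]; rewrite eqxx.
Qed.

Lemma embedXm m : embed 'X_[m] = \prod_(i < k) 'X_(iota i) ^+ m i.
Proof. by rewrite /embed comp_mpolyX; apply: eq_bigr => i _; rewrite tnth_mktuple. Qed.

Lemma embedK : cancel embed unembed.
Proof.
move=> f; rewrite {1}/embed comp_mpolyEX /unembed raddf_sum [RHS]mpolyE.
apply: eq_bigr => m _; rewrite [LHS]linearZ; congr (_ *: _).
rewrite -/(embed _) embedXm rmorph_prod mpolyXE_id; apply: eq_bigr => i _.
by rewrite rmorphXn /= -/(unembed _) unembedX.
Qed.

Lemma unembedK g : supported g -> embed (unembed g) = g.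
Proof.
move=> gs; rewrite {1}/unembed comp_mpolyEX /embed raddf_sum [RHS]mpolyE big_seq [RHS]big_seq.
apply: eq_bigr => m mg; rewrite [LHS]linearZ; congr (_ *: _).
rewrite comp_mpolyX rmorph_prod mpolyXE_id; apply: eq_bigr => j _.
case: (eqVneq (m j) 0%N) => [->|mj]; first by rewrite !expr0 rmorph1.
rewrite mcoeff_msupp in mg; have [i ->] := gs _ mg _ mj.
rewrite rmorphXn /= tnth_mktuple; case: pickP => [i' /eqP/iota_inj->|/(_ i)]; last by rewrite eqxx.
by rewrite -/(embed _) embedX.
Qed.

Lemma supported_embed f : supported (embed f).
Proof.
move=> m; rewrite /embed comp_mpolyEX raddf_sum /= => sm j mj.
suff /existsP[i /eqP->] : [exists i, j == iota i] by exists i.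
apply: contraNT sm => /existsPn nj; apply/eqP/big1 => m' _.
rewrite mcoeffZ comp_mpolyX -/(embed _).
have -> : \prod_(i < k) tnth [tuple 'X_(iota i) | i < k] i ^+ m' i
    = 'X_[\sum_(i < k) (U_(iota i) *+ m' i)] :> {mpoly K[N]}.
  elim/big_rec2: _ => [|i u v _ ->]; first by rewrite mpolyX0.
  by rewrite mpolyXD -mpolyXn tnth_mktuple.
rewrite mcoeffX; case: eqP => [mE|_]; last by rewrite mulr0.
case/eqP: mj; rewrite -mE mnm_sumE big1 // => i _; rewrite mulmnE mnm1E.
by have := nj i; rewrite eq_sym => /negPf->; rewrite mul0n.
Qed.

Lemma embed_homog q f : f \is q.-homog -> embed f \is q.-homog.
Proof.
by apply: comp_mpoly_homog => i; rewrite tnth_mktuple dhomogX; apply/eqP/mdeg1.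
Qed.

Lemma unembed_homog q g : g \is q.-homog -> unembed g \is q.-homog.
Proof.
apply: comp_mpoly_homog => j; rewrite tnth_mktuple.
by case: pickP => [i _|_]; [rewrite dhomogX; apply/eqP/mdeg1 | exact: dhomog0].
Qed.

End Embedding.

Lemma embedP (K : fieldType) k N (iota : 'I_k -> 'I_N) a f g :
  embed iota (a *: f + g) = a *: embed iota f + embed iota g :> {mpoly K[N]}.
Proof. exact: linearP. Qed.

Lemma mpoly_of_dhomogP (K : fieldType) N q a (f g : dhomog N.+1 K q) :
  mpoly_of_dhomog (a *: f + g) = a *: mpoly_of_dhomog f + mpoly_of_dhomog g.
Proof. by []. Qed.

Section DimSupported.
Variables (k N q : nat) (iota : 'I_k.+1 -> 'I_N.+1).
Hypothesis iota_inj : injective iota.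
Local Notation A := (dhomog k.+1 'F_2 q).
Local Notation B := (dhomog N.+1 'F_2 q).

Definition embed_fun (c : A) : B := indhomog q (embed iota (mpoly_of_dhomog c)).
Lemma embed_funE c : mpoly_of_dhomog (embed_fun c) = embed iota (mpoly_of_dhomog c).
Proof.
by rewrite /embed_fun /indhomog insubdK //; apply: embed_homog; exact: dhomog_is_dhomog.
Qed.
Lemma embed_fun_is_linear : linear embed_fun.
Proof.
move=> a c d; apply: val_inj; apply: etrans (embed_funE _) _.
apply: etrans (embedP iota a (mpoly_of_dhomog c) (mpoly_of_dhomog d)) _.
apply: etrans (f_equal2 (fun x y => a *: x + y) (esym (embed_funE c)) (esym (embed_funE d))) _.
exact: esym (mpoly_of_dhomogP _ _ _).
Qed.
HB.instance Definition _ := GRing.isLinear.Build 'F_2 A B _ embed_fun embed_fun_is_linear.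

Lemma dim_supported (U : {vspace B}) :
  (forall c : B, c \in U <-> supported iota (mpoly_of_dhomog c)) -> \dim U = 'C(q + k, q).
Proof.
move=> UP; pose F := linfun embed_fun.
have FE c : mpoly_of_dhomog (F c) = embed iota (mpoly_of_dhomog c) by rewrite lfunE embed_funE.
have -> : U = limg F.
  apply/vspaceP => c; apply/idP/memv_imgP => [/UP cs|[d _ ->]]; last first.
    by apply/UP; rewrite FE; exact: supported_embed.
  exists (indhomog q (unembed iota (mpoly_of_dhomog c))); first exact: memvf.
  apply: val_inj; rewrite /= FE /indhomog insubdK ?unembedK //.
  exact/unembed_homog/dhomog_is_dhomog.
rewrite limg_dim_eq; first by rewrite dimvf.
apply/eqP; rewrite -subv0; apply/subvP => c /memv_capP[_ /lkerP/(congr1 (@mpoly_of_dhomog _ _ _))].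
rewrite FE linear0 => /(congr1 (unembed iota)); rewrite (embedK iota_inj) [RHS]linear0 => c0.
by rewrite (_ : c = 0) ?mem0v //; apply: val_inj; rewrite /= c0.
Qed.
End DimSupported.

Section BidegreeSpaces.
Variables (n' r' : nat).
Local Notation n := n'.+1.
Local Notation r := r'.+1.
Local Notation R := {mpoly 'F_2[n + r]}.
Local Notation L := (poly_space n' r).

Definition bispace d p q : {vspace L d} := limg (part n' r d p q).

Lemma bispaceP d p q (c : L d) : reflect (bihom p q (pol c)) (c \in bispace d p q).
Proof.
apply: (iffP idP) => [/memv_imgP[b _ ->]|ch].
  by rewrite partE; exact: bihom_bipart.
by apply/memv_imgP; exists c; [exact: memvf | apply: pol_inj; rewrite partE bipart_id].
Qed.

Lemma supported_x p m : bideg p 0 m -> forall j : 'I_(n + r), m j != 0%N -> exists i, j = lshift r i.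
Proof.
case/andP=> _ /eqP em j; case: (split_ordP j) => [i -> _|a ->]; first by exists i.
have : (m (rshift n a) <= edeg m)%N by rewrite /edeg (bigD1 a) //= leq_addr.
by rewrite em leqn0 => /eqP->.
Qed.

Lemma supported_e q m : bideg 0 q m -> forall j : 'I_(n + r), m j != 0%N -> exists a, j = rshift n a.
Proof.
case/andP=> /eqP xm _ j; case: (split_ordP j) => [i ->|a -> _]; last by exists a.
have : (m (lshift r i) <= xdeg m)%N by rewrite /xdeg (bigD1 i) //= leq_addr.
by rewrite xm leqn0 => /eqP->.
Qed.

Lemma dim_bispace_x p : \dim (bispace p p 0) = 'C(p + n', p).
Proof.
apply: (@dim_supported n' (n' + r) p (@lshift n r) (@lshift_inj _ _)) => c.
split=> [/bispaceP ch m /ch /supported_x //|cs]; apply/bispaceP => m cm.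
have em : edeg m = 0%N.
  apply: big1 => a _; apply/eqP/negPn/negP => /(cs m cm)[i] /(congr1 (@nat_of_ord _)) /=.
  by have := ltn_ord i; lia.
have /dhomogP ch := pol_homog c.
have : mdeg m = p by apply: ch; rewrite mcoeff_msupp.
by rewrite mdeg_bi em addn0 /bideg em => ->; rewrite !eqxx.
Qed.

Lemma dim_bispace_e q : \dim (bispace q 0 q) = 'C(q + r', q).
Proof.
apply: (@dim_supported r' (n' + r) q (@rshift n r) (@rshift_inj n r)) => c.
split=> [/bispaceP ch m /ch /supported_e //|cs]; apply/bispaceP => m cm.
have xm : xdeg m = 0%N.
  apply: big1 => i _; apply/eqP/negPn/negP => /(cs m cm)[a] /(congr1 (@nat_of_ord _)) /=.
  by have := ltn_ord i; lia.
have /dhomogP ch := pol_homog c.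
have : mdeg m = q by apply: ch; rewrite mcoeff_msupp.
by rewrite mdeg_bi xm add0n /bideg xm => ->; rewrite !eqxx.
Qed.

Local Notation F0 p := {ffun 'I_r -> subvs_of (bispace p p 0)}.

Lemma bihom_vsval p (u : subvs_of (bispace p p 0)) : bihom p 0 (pol (vsval u)).
Proof. exact/bispaceP/subvsP. Qed.

Definition attach_fun p (k : F0 p) : L p.+1 :=
  mkpol p.+1 (\sum_a 'X_(rshift n a) * pol (vsval (k a))).
Lemma attach_funE p (k : F0 p) : pol (attach_fun k) = \sum_a 'X_(rshift n a) * pol (vsval (k a)).
Proof. by rewrite mkpolK //; apply: rpred_sum => a _; apply/homogXM/pol_homog. Qed.
Lemma attach_is_linear p : linear (@attach_fun p).
Proof.
move=> a f g; apply: pol_inj; rewrite attach_funE [RHS]polP.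
apply: etrans (f_equal2 (fun x y : R => a *: x + y) (esym (attach_funE f)) (esym (attach_funE g))).
rewrite scaler_sumr -big_split; apply: eq_bigr => b _ /=.
rewrite !ffunE; have -> : vsval (a *: f b + g b) = a *: vsval (f b) + vsval (g b) by exact: linearP.
by rewrite polP mulrDr scalerAr.
Qed.
HB.instance Definition _ p :=
  GRing.isLinear.Build 'F_2 (F0 p) (L p.+1) _ (@attach_fun p) (@attach_is_linear p).

Lemma deriv_attach p (k : F0 p) b : (pol (attach_fun k))^`M(rshift n b) = pol (vsval (k b)).
Proof.
rewrite attach_funE raddf_sum (bigD1 b) //= big1 ?addr0 => [|a ab].
  rewrite mderivM (bihom_deriv0 _ (@bihom_vsval _ _)) mulr0 addr0 mderivX mnm1E eqxx.
  have -> : (U_(rshift n b) - U_(rshift n b) = 0 :> 'X_{1..n + r})%MM.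
    by apply/mnmP => i; rewrite mnmBE subnn mnm0E.
  by rewrite scale1r mpolyX0 mul1r.
rewrite mderivM (bihom_deriv0 _ (@bihom_vsval _ _)) mulr0 addr0 mderivX mnm1E.
by rewrite (inj_eq (@rshift_inj _ _)) (negPf ab) scale0r mul0r.
Qed.

(** By Euler's relation a form linear in [e] amounts to the family of its [r] derivatives, which are
    arbitrary forms in [x]. *)
Lemma dim_bispace_xe p : \dim (bispace p.+1 p 1) = (r * 'C(p + n', p))%N.
Proof.
pose F := linfun (@attach_fun p); have FE k : F k = attach_fun k by rewrite lfunE.
have -> : bispace p.+1 p 1 = limg F.
  apply/vspaceP => c; apply/bispaceP/memv_imgP => [ch|[k _ ->]]; last first.
    rewrite FE attach_funE; apply: bihom_sum => a _; apply: bihom_e; exact: bihom_vsval.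
  pose d a := mkpol p (pol c)^`M(rshift n a).
  have dE a : pol (d a) = (pol c)^`M(rshift n a) by rewrite mkpolK // homog_deriv // pol_homog.
  exists [ffun a => vsproj (bispace p p 0) (d a)]; first exact: memvf.
  apply: pol_inj; rewrite FE attach_funE; apply: etrans (bihom_euler ch) _.
  apply: eq_bigr => a _; rewrite ffunE vsprojK ?dE //; apply/bispaceP.
  by rewrite dE; apply: bihom_deriv.
rewrite limg_dim_eq.
  by rewrite dimvf /dim /= card_ord; congr (_ * _)%N; exact: dim_bispace_x.
apply/eqP; rewrite -subv0; apply/subvP => k /mem_capP[_ /lkerP]; rewrite FE => k0.
rewrite (_ : k = 0) ?mem0v //; apply/ffunP => a; apply/val_inj/pol_inj.
by rewrite -deriv_attach k0 ffunE !linear0.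
Qed.
End BidegreeSpaces.

(** * Syzygies between the quadratic monomials in x *)

Section Syzygies.
Variables (T : finGroupType) (n r : nat) (C : coordinates T n r).
Local Notation R := {mpoly 'F_2[n + r]}.
Local Notation x_ i := ('X_(lshift r i) : R).
Local Notation e_ a := ('X_(rshift n a) : R).
Local Notation lo := (lo C).
Local Notation hi := (hi C).
Local Notation qbar := (qbar C).

Lemma addRR (f : R) : f + f = 0. Proof. exact: addFF. Qed.

Lemma qbar_x i c : qbar (x_ i * c) = x_ i * qbar c.
Proof.
rewrite /qbar mulr_sumr; apply: eq_bigr => a _; rewrite mderivM.
have -> : (x_ i)^`M(rshift n a) = 0.
  by rewrite mderivX mnm1E eq_lrshift scale0r.
by rewrite mul0r add0r mulrCA.
Qed.

Lemma deriv2 i (c : R) : c^`M(i)^`M(i) = 0.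
Proof.
apply/mpolyP => m; rewrite mcoeff0 !mcoeff_deriv -mulrnA mnmDE mnm1E eqxx addn1.
rewrite -mulr_natr (_ : _%:R = 0) ?mulr0 //; apply/val_inj; rewrite /= val_Fp_nat //.
by rewrite modn2 oddM /=; case: (odd _).
Qed.

(** Mixed second derivatives cancel in pairs, and repeated ones vanish in characteristic 2. *)
Lemma qbar_qbar c : qbar (qbar c) = 0.
Proof.
rewrite {2}/qbar qbar_sum.
rewrite (eq_bigr (fun a => \sum_b (x_ (lo a) * x_ (hi a)) * ((x_ (lo b) * x_ (hi b)) *
    c^`M(rshift n a)^`M(rshift n b)))) => [|a _].
  apply: sum_sym0 => [a|a b]; first by rewrite deriv2 !mulr0.
  by rewrite mderiv_comm mulrCA.
by rewrite -mulrA !qbar_x mulrA /qbar mulr_sumr.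
Qed.

Lemma bihom1 : bihom 0 0 (1 : R).
Proof.
rewrite -mpolyX0; apply: bihomX.
by rewrite /bideg /xdeg /edeg !big1 // => i _; rewrite mnm0E.
Qed.

Lemma qbar_square a : qbar (e_ a ^+ 2) = 0.
Proof.
have e1 : qbar (e_ a) = x_ (lo a) * x_ (hi a).
  by rewrite -[e_ a]mulr1 qbar_e (qbar_free _ bihom1) mulr0 addr0 !mulr1.
by rewrite expr2 qbar_e e1 mulrC addRR.
Qed.

Lemma edeg_gt0 (m : 'X_{1..n + r}) : edeg m != 0%N -> exists a, m (rshift n a) != 0%N.
Proof.
move=> em; apply/existsP; apply: contraNT em => /existsPn m0.
by rewrite /edeg big1 // => a _; apply/eqP; have := m0 a; rewrite negbK.
Qed.

(** All derivatives vanish, so all exponents are even, and in degree 2 only squares remain. *)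
Lemma ker_qbar_squares c : bihom 0 2 c -> qbar c = 0 ->
  exists k : 'I_r -> 'F_2, c = \sum_a k a *: e_ a ^+ 2.
Proof.
move=> ch qc; have dc a : c^`M(rshift n a) = 0.
  by apply: (@sum_xx_eq0 _ _ _ C 1 (fun a => c^`M(rshift n a)) _ qc) => b; apply: bihom_deriv.
pose sq a := (U_(rshift n a) *+ 2 : 'X_{1..n + r})%MM.
have sqE a : e_ a ^+ 2 = 'X_[sq a] by rewrite mpolyXn.
exists (fun a => c@_(sq a)); apply/mpolyP => m; rewrite raddf_sum /=.
under eq_bigr do rewrite sqE mcoeffZ mcoeffX.
have sq_e a b : sq a (rshift n b) = ((a == b) * 2)%N.
  by rewrite mulmnE mnm1E (inj_eq (@rshift_inj _ _)).
have [b /eqP<-|nb] := pickP (fun a => sq a == m).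
  rewrite (bigD1 b) //= eqxx mulr1 big1 ?addr0 // => a ab.
  case: eqP => [/(congr1 (fun m : 'X_{1..n + r} => m (rshift n b)))|]; last by rewrite mulr0.
  by rewrite !sq_e eqxx (negPf ab).
rewrite big1 => [|a _]; last by rewrite (nb a) mulr0.
apply/eqP/negPn/negP => cm; have /andP[/eqP xm' /eqP em'] := ch _ cm.
have [xm em] : xdeg m = 0%N /\ edeg m = 2%N := conj xm' em'.
have ev a : ~~ odd (m (rshift n a)).
  apply: contra cm => odd_a; have := mcoeff_euler (rshift n a) c m.
  rewrite dc mulr0 mcoeff0 -mulr_natr (_ : _%:R = 1) ?mulr1 => [<- //|].
  by apply/val_inj; rewrite /= val_Fp_nat // modn2 odd_a.
have [|b mb] := @edeg_gt0 m; first by rewrite em.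
have := nb b; case/eqP; apply/mnmP => j.
have leE a : a != b -> (m (rshift n a) + m (rshift n b) <= 2)%N.
  by move=> ab; rewrite -em /edeg (bigD1 b) //= (bigD1 a) //=; lia.
have mb2 : m (rshift n b) = 2%N.
  have : (m (rshift n b) <= 2)%N by rewrite -em /edeg (bigD1 b) //= leq_addr.
  by have := ev b; move: (m _) mb => [|[|[|k]]].
case: (split_ordP j) => [i ->|a ->].
  rewrite mulmnE mnm1E eq_rlshift; apply/esym/eqP; rewrite -leqn0 -xm.
  by rewrite /xdeg (bigD1 i) //= leq_addr.
rewrite sq_e eq_sym; case: eqP => [->|/eqP/leE]; first by rewrite mb2.
by rewrite mb2 => le2; have -> : m (rshift n a) = 0%N by lia.
Qed.

Local Notation xx := (xx C).

Lemma bideg_xx a : bideg 2 0 (xx a).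
Proof. by rewrite /bideg /xx xdegD edegD !xdeg_x !edeg_x. Qed.

Lemma bidegD p q p' q' (m m' : 'X_{1..n + r}) :
  bideg p q m -> bideg p' q' m' -> bideg (p + p')%N (q + q')%N (m + m')%MM.
Proof.
by rewrite /bideg xdegD edegD => /andP[/eqP-> /eqP->] /andP[/eqP-> /eqP->]; rewrite !eqxx.
Qed.

Lemma bidegB p q p' q' (m m' : 'X_{1..n + r}) : (m' <= m)%MM ->
  bideg p q m -> bideg p' q' m' -> bideg (p - p')%N (q - q')%N (m - m')%MM.
Proof.
move=> /submK mE; rewrite /bideg -[in X in X -> _ -> _]mE xdegD edegD.
by move=> /andP[/eqP<- /eqP<-] /andP[/eqP-> /eqP->]; rewrite !addnK !eqxx.
Qed.

Lemma mnm_le_xx p m : bideg p.+2 0 m -> exists a, (xx a <= m)%MM.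
Proof. by case/(bideg_pair C) => a [m' [_ ->]]; exists a; apply: lem_addr. Qed.

(** Here [b] is an exponent, not an index: for [b] without [e]-variables and divisible by [xx a],
    this is a [qbar]-preimage of the monomial. *)
Definition syz a b : R := e_ a * 'X_[b - xx a].

(** The Koszul syzygy: [d] is [e_a e_b] times the cofactor of the two quadratic monomials, and the
    product rule gives the two terms. *)
Lemma syz_direct p a b m : bideg p.+4 0 m -> (xx a + xx b <= m)%MM ->
  exists2 d, bihom p 2 d & qbar d = syz a m + syz b m.
Proof.
move=> mh le_m; exists (e_ a * (e_ b * 'X_[m - (xx a + xx b)])).
  do 2!apply: bihom_e; apply: bihomX; have := bidegB le_m mh (bidegD (bideg_xx a) (bideg_xx b)).
  by rewrite !addn0 subn0 -addn2 -[p.+2]addn2 -addnA addnK.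
rewrite !qbar_e (@qbar_free _ _ _ _ p).
  rewrite mulr0 addr0 mulrCA addrC -!xxE /syz -!mpolyXD.
  by congr ('X_[_] + 'X_[_]); apply/mnmP => i; have /mnm_lepP/(_ i) := le_m;
     rewrite !(mnmDE, mnmBE); lia.
apply: bihomX; have := bidegB le_m mh (bidegD (bideg_xx a) (bideg_xx b)).
by rewrite !addn0 subn0 -addn2 -[p.+2]addn2 -addnA addnK.
Qed.

(** If the two monomials do not fit side by side in [m], their lcm has degree at most 3. As [m] has
    degree at least 5, the cofactor contains a third quadratic monomial [c], to which both [a] and
    [b] are directly related. In degree 4 there might be no room for [c]. *)
Lemma syz_qbar p a b m : bideg p.+1.+4 0 m -> (xx a <= m)%MM -> (xx b <= m)%MM ->
  exists2 d, bihom p.+1 2 d & qbar d = syz a m + syz b m.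
Proof.
move=> mh /mnm_lepP am /mnm_lepP bm.
have [/(syz_direct mh) //|/forallPn[j abj]] := boolP (xx a + xx b <= m)%MM.
pose l := mlcm (xx a) (xx b).
have lE i : l i = maxn (xx a i) (xx b i) by rewrite mnmE.
have lm : (l <= m)%MM by apply/mnm_lepP => i; rewrite lE geq_max am bm.
have [xa ea] := andP (bideg_xx a); have [xb eb] := andP (bideg_xx b).
(* Where the sum of exponents exceeds that of [m], the maximum is strictly below the sum, so the lcm
   loses at least one degree. *)
have xl : (xdeg l + 1 <= xdeg (xx a + xx b)%MM)%N.
  have lel i : (l i <= (xx a + xx b)%MM i)%N by rewrite lE mnmDE; lia.
  case: (split_ordP j) abj => [i ->|c ->] abj.
    rewrite /xdeg (bigD1 i) //= [X in (_ <= X)%N](bigD1 i) //= -addnA [X in (_ + X)%N]addnC addnA.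
    apply: leq_add; last exact: leq_sum.
    have := am (lshift r i); have := bm (lshift r i); move: abj; rewrite lE mnmDE; lia.
  have : (xx a (rshift n c) <= edeg (xx a))%N by rewrite /edeg (bigD1 c) //= leq_addr.
  have : (xx b (rshift n c) <= edeg (xx b))%N by rewrite /edeg (bigD1 c) //= leq_addr.
  by move: abj; rewrite mnmDE (eqP ea) (eqP eb); lia.
have el : edeg l = 0%N.
  apply/eqP; rewrite -leqn0 -(eqP ea) -[edeg (xx a)]addn0 -(eqP eb) -edegD.
  by apply: leq_sum => c _; rewrite lE mnmDE; lia.
have xm : xdeg m = p.+1.+4 by case/andP: mh => /eqP.
have ll : bideg (xdeg l) (edeg l) l by rewrite /bideg !eqxx.
have [c cl] : exists c, (xx c <= m - l)%MM.
  have xl3 : (xdeg l <= 3)%N.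
    move: xl; rewrite xdegD (eqP xa) (eqP xb); lia.
  apply: (@mnm_le_xx (p.+3 - xdeg l)%N); have := bidegB lm mh ll; rewrite el subn0.
  by have -> : (p.+1.+4 - xdeg l = (p.+3 - xdeg l).+2)%N by lia.
have le_xx d : (forall i, xx d i <= l i)%N -> (xx d + xx c <= m)%MM.
  move=> dl; apply/mnm_lepP => i; have /mnm_lepP/(_ i) := cl; have /mnm_lepP/(_ i) := lm.
  by have := dl i; rewrite mnmBE mnmDE; lia.
have [d1 d1h d1E] := syz_direct mh (le_xx a (fun i => leq_trans (leq_maxl _ _) (eq_leq (esym (lE i))))).
have [d2 d2h d2E] := syz_direct mh (le_xx b (fun i => leq_trans (leq_maxr _ _) (eq_leq (esym (lE i))))).
exists (d1 + d2); first exact: bihomD.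
by rewrite qbarD d1E d2E addrACA addRR addr0.
Qed.

(** Each monomial is sent to one chosen preimage, with 0 as default if no quadratic monomial divides
    it. Summing over all exponents of degree below [N], and not over the support of [f], makes
    linearity immediate. *)
Definition solve N (f : R) : R := \sum_(m : bmultinom (n + r) N)
  f@_m *: (if [pick a | (xx a <= m)%MM] is Some a then syz a m else 0).

Lemma solveD N : {morph solve N : f g / f + g}.
Proof. by move=> f g; rewrite -big_split; apply: eq_bigr => m _; rewrite mcoeffD scalerDl. Qed.

Lemma solveZ N (k : 'F_2) f : solve N (k *: f) = k *: solve N f.
Proof. by rewrite scaler_sumr; apply: eq_bigr => m _; rewrite mcoeffZ scalerA. Qed.

Lemma solve0 N : solve N 0 = 0.
Proof. by apply: big1 => m _; rewrite mcoeff0 scale0r. Qed.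

Lemma solveX N m a : (mdeg m < N)%N -> (xx a <= m)%MM ->
  exists2 b, (xx b <= m)%MM & solve N 'X_[m] = syz b m.
Proof.
move=> mN am; have E : solve N 'X_[m] = if [pick a | (xx a <= m)%MM] is Some a then syz a m else 0.
  rewrite /solve (bigD1 (BMultinom mN)) //= mcoeffX eqxx scale1r big1 ?addr0 // => m' mm'.
  rewrite mcoeffX; case: eqP => [mE|_]; last by rewrite scale0r.
  by case/eqP: mm'; apply/val_inj; rewrite /= mE.
by rewrite E; case: pickP => [b bm|/(_ a)]; [exists b | rewrite am].
Qed.

(* [solve] is a section of [qbar] up to syzygies, so a cycle [c] is
   [c + solve (qbar c)], a boundary. *)
Lemma qbar_exact p c : bihom p.+3 1 c -> qbar c = 0 ->
  exists2 d, bihom p.+1 2 d & qbar d = c.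
Proof.
(* [qbar c] has degree [p + 5], just below this bound. *)
pose N := p.+4.+2; move=> ch qc.
suff [d dh dE] : exists2 d, bihom p.+1 2 d & qbar d = c + solve N (qbar c).
  by exists d; rewrite // dE qc solve0 addr0.
rewrite [c]mpolyE; rewrite big_seq; elim/big_rec: _ => [|m s ms [d dh ds]].
  by exists 0; [exact: bihom0 | rewrite qbar0 solve0 addr0].
rewrite mcoeff_msupp in ms; have mh := ch _ ms.
suff [d' d'h d'E] : exists2 d', bihom p.+1 2 d' & qbar d' = 'X_[m] + solve N (qbar 'X_[m]).
  exists (c@_m *: d' + d); first exact/bihomD/dh/bihom_scale.
  by rewrite !(qbarD, qbarZ) solveD solveZ d'E ds scalerDr addrACA.
have [|a ma] := @edeg_gt0 m; first by case/andP: mh => _ /eqP->.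
pose g := (m - U_(rshift n a))%MM.
have mE : m = (U_(rshift n a) + g)%MM by rewrite addmC submK // lep1mP.
have gh : bideg p.+3 0 g by rewrite -(bideg_e _ _ a) addmC -mE.
have XE : 'X_[m] = syz a (xx a + g)%MM by rewrite /syz [m]mE mpolyXD addmC addmK.
have qE : qbar 'X_[m] = 'X_[xx a + g].
  by rewrite mE !mpolyXD qbar_e (@qbar_free _ _ _ _ p.+3) ?mulr0 ?addr0 ?xxE //; exact: bihomX.
have bh : bideg p.+1.+4 0 (xx a + g)%MM by have := bidegD (bideg_xx a) gh.
have [||b bm sE] := @solveX N (xx a + g)%MM a.
- by case/andP: bh => /eqP xE /eqP eE; rewrite mdeg_bi xE eE addn0; exact: leqnn.
- exact: lem_addr.
rewrite qE XE sE; exact: (syz_qbar bh (lem_addr _ _) bm).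
Qed.
End Syzygies.

(** * The three ranks as sums over bidegrees *)

Section Ranks.
Variables (T : finGroupType) (n' r' : nat).
Local Notation n := n'.+1.
Local Notation r := r'.+1.
Variable C : coordinates T n r.
Local Notation R := {mpoly 'F_2[n + r]}.
Local Notation L := (poly_space n' r).
Local Notation B := (bispace n' r').
Local Notation qb q := (qb C q).

Lemma bispace_image d p q (c : L d) : c \in B d p q.+1 -> bihom p.+2 q (pol (qb d c)).
Proof. by move/bispaceP; rewrite qbE; exact: bihom_qbar. Qed.

Lemma dim_add_bispace d p q (W : {vspace L d}) :
  (forall w, w \in W -> bipart p q (pol w) = 0) ->
  \dim (B d p q + W) = (\dim (B d p q) + \dim W)%N.
Proof.
move=> W0; apply: dimv_disjoint_sum; apply/eqP; rewrite -subv0; apply/subvP => c.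
move=> /mem_capP[/bispaceP ch /W0]; rewrite bipart_id // => c0.
by rewrite (_ : c = 0) ?mem0v //; apply: pol_inj; rewrite c0 linear0.
Qed.

Lemma qb_inj d : odd d -> \dim (qb d @: B d 0 d) = \dim (B d 0 d).
Proof.
move=> odd_d; apply: limg_dim_eq; apply/eqP; rewrite -subv0; apply/subvP => c.
move=> /mem_capP[/bispaceP ch /qbP qc].
rewrite (_ : c = 0) ?mem0v //; apply: pol_inj; rewrite linear0.
exact: qbar_odd_inj odd_d ch qc.
Qed.

Lemma sum_parts d (c : L d) : c = \sum_(q < d.+1) part n' r d (d - q)%N q c.
Proof.
apply: pol_inj; rewrite raddf_sum {1}(bipart_sum (pol_homog c)) /=.
by apply: eq_bigr => q _; rewrite partE.
Qed.

Lemma part_bispace d p q (c : L d) : part n' r d p q c \in B d p q.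
Proof. exact/memv_img/memvf. Qed.

Lemma qb_part0 d p (c : L d) : qb d (part n' r d p 0 c) = 0.
Proof.
by apply: pol_inj; rewrite qbE partE (qbar_free _ (@bihom_bipart _ _ p 0 _)) linear0.
Qed.

Lemma limg_qb1 : limg (qb 1) = (qb 1 @: B 1 0 1)%VS.
Proof.
apply: subv_anti; rewrite (limgS _ (subvf (B 1 0 1))) andbT; apply/subvP => _ /memv_imgP[c _ ->].
rewrite [c]sum_parts !big_ord_recr big_ord0 /= add0r linearD /= qb_part0 add0r.
exact/memv_img/part_bispace.
Qed.

Lemma bispace_img_surj p : (B p.+3 p.+3 0 <= limg (qb p.+2))%VS.
Proof.
apply/subvP => c /bispaceP/(qbar_surj C)[d dh dE].
have dhom : d \is p.+2.-homog by have := bihom_homog dh; rewrite addn1.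
apply/memv_imgP; exists (mkpol p.+2 d); first exact: memvf.
by apply: pol_inj; rewrite qbE mkpolK.
Qed.

Lemma limg_qb2 : limg (qb 2) = (B 3 3 0 + qb 2 @: B 2 0 2)%VS.
Proof.
apply: subv_anti; rewrite subv_add bispace_img_surj (limgS _ (subvf (B 2 0 2))) /= andbT.
apply/subvP => _ /memv_imgP[c _ ->].
rewrite [c]sum_parts !big_ord_recr big_ord0 /= add0r !linearD /= qb_part0 add0r.
apply: memv_add; last exact/memv_img/part_bispace.
by apply/bispaceP/bispace_image/part_bispace.
Qed.

(** The summands come from [e]-degrees 1, 2 and 3 of the source. For the middle one, [qbar_exact]
    says that the image from [e]-degree 2 is the full space of cycles. *)
Lemma limg_qb3 : limg (qb 3) = (B 4 4 0 + ((B 4 3 1 :&: lker (qb 4)) + qb 3 @: B 3 0 3))%VS.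
Proof.
apply: subv_anti; rewrite !subv_add bispace_img_surj (limgS _ (subvf (B 3 0 3))) /= !andbT.
apply/andP; split; apply/subvP => c; last first.
  move=> /mem_capP[/bispaceP ch /qbP qc]; have [d dh dE] := qbar_exact ch qc.
  apply/memv_imgP; exists (mkpol 3 d); first exact: memvf.
  by apply: pol_inj; rewrite qbE mkpolK // (bihom_homog dh).
case/memv_imgP=> {}c _ ->.
rewrite [c]sum_parts !big_ord_recr big_ord0 /= add0r !linearD /= qb_part0 add0r -addrA.
apply: memv_add; first by apply/bispaceP/bispace_image/part_bispace.
apply: memv_add; last exact/memv_img/part_bispace.
apply/mem_capP; split; first by apply/bispaceP/bispace_image/part_bispace.
by apply/qbP; rewrite qbE qbar_qbar.
Qed.

Lemma rank_qb1 : \dim (limg (qb 1)) = r.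
Proof. by rewrite limg_qb1 qb_inj // dim_bispace_e bin1 add1n. Qed.

Local Notation e_ a := ('X_(rshift n a) : R).

Definition squares_fun (k : {ffun 'I_r -> ('F_2)^o}) : L 2 :=
  mkpol 2 (\sum_a (k a : 'F_2) *: e_ a ^+ 2).
Lemma bihom_square a : bihom 0 2 (e_ a ^+ 2).
Proof.
by rewrite expr2 -[X in _ * X]mulr1; do 2!apply: bihom_e; exact: bihom1.
Qed.
Lemma bihom_squares (k : 'I_r -> 'F_2) : bihom 0 2 (\sum_a k a *: e_ a ^+ 2).
Proof. by apply: bihom_sum => a _; apply/bihom_scale/bihom_square. Qed.
Lemma squares_funE k : pol (squares_fun k) = \sum_a (k a : 'F_2) *: e_ a ^+ 2.
Proof. by rewrite mkpolK //; exact: (bihom_homog (@bihom_squares (fun a => k a))). Qed.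
Lemma squares_is_linear : linear squares_fun.
Proof.
move=> a f g; apply: pol_inj; rewrite squares_funE [RHS]polP.
apply: etrans (f_equal2 (fun x y : R => a *: x + y) (esym (squares_funE f)) (esym (squares_funE g))).
rewrite scaler_sumr -big_split; apply: eq_bigr => b _ /=.
by rewrite !ffunE scalerA -scalerDl.
Qed.
HB.instance Definition _ :=
  GRing.isLinear.Build 'F_2 {ffun 'I_r -> ('F_2)^o} (L 2) _ squares_fun squares_is_linear.

Lemma dim_squares : \dim (B 2 0 2 :&: lker (qb 2)) = r.
Proof.
pose F := linfun squares_fun; have FE k : F k = squares_fun k by rewrite lfunE.
have -> : (B 2 0 2 :&: lker (qb 2))%VS = limg F.
  apply/vspaceP => c; apply/mem_capP/memv_imgP => [[/bispaceP ch /qbP qc]|[k _ ->]].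
    have [k cE] := ker_qbar_squares ch qc; exists [ffun a => k a]; first exact: memvf.
    by apply: pol_inj; rewrite FE squares_funE cE; apply: eq_bigr => a _; rewrite ffunE.
  split; first by apply/bispaceP; rewrite FE squares_funE; exact: bihom_squares.
  apply/qbP; rewrite FE squares_funE qbar_sum big1 // => a _.
  by rewrite qbarZ qbar_square scaler0.
rewrite limg_dim_eq; first by rewrite dimvf /dim /= card_ord muln1.
apply/eqP; rewrite -subv0; apply/subvP => k /mem_capP[_ /lkerP]; rewrite FE => k0.
rewrite (_ : k = 0) ?mem0v //; apply/ffunP => a; rewrite ffunE.
have /(congr1 (mcoeff (U_(rshift n a) *+ 2)%MM)) := congr1 (@pol _ _ _) k0.
rewrite squares_funE (linear0 (@pol n' r 2)) mcoeff0 raddf_sum /= (bigD1 a) //= big1 ?addr0 => [|b ba].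
  by rewrite mcoeffZ mpolyXn mcoeffX eqxx mulr1.
rewrite mcoeffZ mpolyXn mcoeffX; case: eqP => [/(congr1 (fun m : 'X_{1..n + r} => m (rshift n a)))|].
  by rewrite !mulmnE !mnm1E eqxx (inj_eq (@rshift_inj _ _)) (negPf ba).
by rewrite mulr0.
Qed.

(** All cubics in [x] are hit, and on quadrics in [e] the kernel is spanned by the [r] squares. *)
Lemma rank_qb2 : (\dim (limg (qb 2)) + r = 'C(3 + n', 3) + 'C(2 + r', 2))%N.
Proof.
rewrite limg_qb2 dim_add_bispace; last first.
  by move=> _ /memv_imgP[c cB ->]; exact: bipart_ne (bispace_image cB) _.
rewrite dim_bispace_x -(dim_bispace_e n' r') -(limg_ker_dim (qb 2) (B 2 0 2)) dim_squares.
by rewrite -addnA [(_ + r)%N]addnC.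
Qed.

(** ['C(5 + n', 5)] is the rank of [qbar] from the forms cubic in [x] and linear in [e] onto the
    quintics in [x]; removing it from [r * 'C(3 + n', 3)] counts the cycles there. *)
Lemma rank_qb3 :
  (\dim (limg (qb 3)) + 'C(5 + n', 5) = 'C(4 + n', 4) + r * 'C(3 + n', 3) + 'C(3 + r', 3))%N.
Proof.
rewrite limg_qb3 dim_add_bispace; last first.
  move=> _ /memv_addP[w1 /mem_capP[/bispaceP w1h _] [_ /memv_imgP[c cB ->] ->]].
  rewrite linearD /= bipartD (bipart_ne _ w1h) // (bipart_ne _ (bispace_image cB)) //.
  exact: addr0.
rewrite dimv_disjoint_sum; last first.
  apply/eqP; rewrite -subv0; apply/subvP => w /mem_capP[/mem_capP[/bispaceP wh _]].
  case/memv_imgP => c cB wE; have := bispace_image cB; rewrite -wE => wh'.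
  rewrite (_ : w = 0) ?mem0v //; apply: pol_inj; rewrite linear0 -(bipart_id wh).
  exact: bipart_ne wh' _.
rewrite qb_inj // dim_bispace_x dim_bispace_e.
have -> : 'C(5 + n', 5) = \dim (qb 4 @: B 4 3 1).
  rewrite -(dim_bispace_x n' r'); congr (\dim _); apply/vspaceP => c.
  apply/bispaceP/memv_imgP => [/(qbar_surj C)[d dh dE]|[d dB ->]]; last exact: bispace_image.
  have dE' : pol (mkpol 4 d) = d by rewrite mkpolK // (bihom_homog dh).
  by exists (mkpol 4 d); [apply/bispaceP | apply: pol_inj; rewrite qbE]; rewrite dE'.
rewrite -(dim_bispace_xe n' r') -(limg_ker_dim (qb 4) (B 4 3 1)).
move: 'C(4 + n', 4) 'C(3 + r', 3) => s4 e3; by rewrite !addnA addnAC.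
Qed.

Lemma dim_kernel q : (\dim (lker (qb q)) + \dim (limg (qb q)) = 'C(q + (n' + r), q))%N.
Proof. by rewrite -(dim_poly_space n' r q) -dimvf -(limg_ker_dim (qb q) fullv) capfv. Qed.
End Ranks.

(** * The relatively free group *)

Section Model.
Variables (n r : nat) (lo hi : 'I_r -> 'I_n).

(** Indexing the type by the two maps lets each choice of them carry its own group law. *)
Definition model (l h : 'I_r -> 'I_n) : Type := ({ffun 'I_n -> 'F_2} * {ffun 'I_r -> 'F_2})%type.
Local Notation M := (model lo hi).
HB.instance Definition _ := Finite.on M.

Definition pairing (x y : {ffun 'I_n -> 'F_2}) : {ffun 'I_r -> 'F_2} :=
  [ffun a => x (lo a) * y (hi a)].
(** The central extension of [F_2^n] by [F_2^r] whose cocycle is the bilinear map [pairing]. *)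
Definition model_mul (g h : M) : M := (g.1 + h.1, g.2 + h.2 + pairing g.1 h.1).
Definition model_one : M := (0, 0).
Definition model_inv (g : M) : M := (g.1, g.2 + pairing g.1 g.1).

Lemma pairingDl x y z : pairing (x + y) z = pairing x z + pairing y z.
Proof. by apply/ffunP => a; rewrite !ffunE mulrDl. Qed.
Lemma pairingDr x y z : pairing x (y + z) = pairing x y + pairing x z.
Proof. by apply/ffunP => a; rewrite !ffunE mulrDr. Qed.
Lemma addff (I : finType) (x : {ffun I -> 'F_2}) : x + x = 0.
Proof. by apply/ffunP => i; rewrite !ffunE addF2. Qed.
Lemma pairing0l y : pairing 0 y = 0.
Proof. by apply/ffunP => a; rewrite !ffunE mul0r. Qed.
Lemma pairing0r x : pairing x 0 = 0.
Proof. by apply/ffunP => a; rewrite !ffunE mulr0. Qed.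

Lemma model_mulA : associative model_mul.
Proof.
move=> g h k; rewrite /model_mul /= pairingDl pairingDr addrA; congr (_, _).
by apply/ffunP => a; rewrite !ffunE; ring.
Qed.
Lemma model_mul1 : left_id model_one model_mul.
Proof. by case=> x e; rewrite /model_mul /= !add0r pairing0l addr0. Qed.
Lemma model_mulV : left_inverse model_one model_inv model_mul.
Proof. by case=> x e; rewrite /model_mul /= -addrA !addff. Qed.
HB.instance Definition _ := Finite_isGroup.Build M model_mulA model_mul1 model_mulV.

Lemma model_mulE (g h : M) : (g * h)%g = (g.1 + h.1, g.2 + h.2 + pairing g.1 h.1) :> M.
Proof. by []. Qed.

Lemma model_sq (g : M) : (g ^+ 2)%g = (0, pairing g.1 g.1) :> M.
Proof. by rewrite expgS expg1 model_mulE !addff add0r. Qed.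

Lemma model_laws : W_laws M.
Proof.
move=> g h; split; first by rewrite -[4%N]/(2 * 2)%N expgM model_sq model_sq pairing0l.
by rewrite /commute !model_mulE model_sq /= pairing0l pairing0r addrC [X in (_, X + _)]addrC.
Qed.
End Model.

Section CentralProducts.
Variables (gT : finGroupType) (r : nat) (w : 'I_r -> gT).
Hypothesis wC : forall a g, commute (w a) g.
Hypothesis w2 : forall a, (w a * w a = 1)%g.

Definition cprod (e : 'I_r -> 'F_2) : gT := (\prod_a w a ^+ (e a != 0%R))%g.

Lemma cprod_commute e g : commute (cprod e) g.
Proof.
rewrite /cprod; elim/big_rec: _ => [|a z _ zg]; first exact: commute_sym (commute1 g).
apply: commute_sym; apply: commuteM; last exact: commute_sym.
by apply: commuteX; apply: commute_sym.
Qed.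

Lemma pow_add a (x y : 'F_2) : (w a ^+ (x + y != 0)%R = w a ^+ (x != 0)%R * w a ^+ (y != 0)%R)%g.
Proof.
have [->|->] := F2_cases x; first by rewrite add0r eqxx mul1g.
have [->|->] := F2_cases y; first by rewrite addr0 eqxx mulg1.
by rewrite addF2 eqxx expg1 w2.
Qed.

Lemma cprodD e e' : cprod (fun a => e a + e' a) = (cprod e * cprod e')%g.
Proof.
suff: forall s : seq 'I_r, (\prod_(a <- s) w a ^+ (e a + e' a != 0)%R =
    (\prod_(a <- s) w a ^+ (e a != 0)%R) * \prod_(a <- s) w a ^+ (e' a != 0)%R)%g by exact.
elim=> [|a s IHs]; rewrite ?big_nil ?mulg1 // !big_cons IHs pow_add !mulgA; congr (_ * _)%g.
rewrite -!mulgA; congr (_ * _)%g; case: (_ != 0); last by rewrite mul1g mulg1.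
exact: wC.
Qed.

Lemma cprod0 : cprod (fun=> 0) = 1%g.
Proof. by apply: big1 => a _; rewrite eqxx. Qed.

Lemma cprod1 b (x : 'F_2) : cprod (fun a => x * (a == b)%:R) = (w b ^+ (x != 0)%R)%g.
Proof.
rewrite /cprod (eq_bigr (fun a => if a == b then w b ^+ (x != 0)%R else 1)%g) => [|a _].
  by rewrite -big_mkcond big_pred1_eq.
by have [->|_] := eqVneq a b; rewrite ?mulr1 // mulr0 eqxx.
Qed.
End CentralProducts.

(** * Collecting words in a group of the variety *)

Section NormalForm.
Variables (gT : finGroupType) (n r : nat) (lo hi : 'I_r -> 'I_n) (idx : 'I_n -> 'I_n -> 'I_r).
Hypothesis lo_hi : forall a, (lo a <= hi a)%N.
Hypothesis idxP : forall i j : 'I_n, (i <= j)%N -> lo (idx i j) = i /\ hi (idx i j) = j.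
Hypothesis idxK : forall a, idx (lo a) (hi a) = a.
Variable u : 'I_n -> gT.
Hypothesis laws : W_laws gT.

Lemma sq_commute (g h : gT) : commute (g ^+ 2)%g h. Proof. by case: (laws g h). Qed.
Lemma sq_sq (g : gT) : (g ^+ 2 * g ^+ 2 = 1)%g.
Proof. by have [<- _] := laws g g; rewrite -expgD. Qed.

(** Off the diagonal the product collapses to the commutator of [u_lo] and [u_hi]. Written with
    squares, it is visibly central and of order at most 2. *)
Definition basic_square a : gT :=
  if lo a == hi a then (u (lo a) ^+ 2)%g
  else ((u (lo a))^-1 ^+ 2 * (u (lo a) * (u (hi a))^-1) ^+ 2 * u (hi a) ^+ 2)%g.
Local Notation w := basic_square.

Lemma basic_square_commute a g : commute (w a) g.
Proof.
rewrite /w; case: eqP => _; first exact: sq_commute.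
by apply: commute_sym; apply: commuteM; [apply: commuteM|]; exact/commute_sym/sq_commute.
Qed.

Lemma basic_square_sq a : (w a * w a = 1)%g.
Proof.
rewrite /w; case: eqP => _; first exact: sq_sq.
have sqM (p h : gT) : (p ^+ 2 = 1 -> (p * h ^+ 2) ^+ 2 = 1)%g.
  move=> p2; rewrite expgMn; first by rewrite p2 mul1g expgS expg1 sq_sq.
  exact/commute_sym/sq_commute.
by rewrite -[LHS]/(_ ^+ 2)%g; do 2!apply: (sqM); rewrite expgS expg1 sq_sq.
Qed.

Lemma w_diag i : w (idx i i) = (u i ^+ 2)%g.
Proof. by have [l h] := idxP (leqnn i); rewrite /w l h eqxx. Qed.

Lemma w_offdiag (i j : 'I_n) : (i < j)%N -> (u i * u j = u j * u i * w (idx i j))%g.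
Proof.
move=> ij; have [l h] := idxP (ltnW ij); rewrite /w l h.
have /negPf-> : i != j by apply: contraTneq ij => ->; rewrite ltnn.
by rewrite !expgS !expg0 !mulg1 !mulgA !(mulgK, mulgKV, mulgV, mul1g).
Qed.

Local Notation cprod := (cprod w).
Definition uprod (s : seq 'I_n) (x : 'I_n -> 'F_2) : gT := (\prod_(i <- s) u i ^+ (x i != 0%R))%g.

(** Each [u_i] with [i < j] that [u_j] passes on its way to the left leaves one factor
    [w (idx i j)]. *)
Lemma uprod_left (s : seq 'I_n) x (j : 'I_n) : all (fun i : 'I_n => i < j)%N s ->
  (uprod s x * u j = u j * uprod s x * cprod (fun a => \sum_(i <- s) x i * (a == idx i j)%:R))%g.
Proof.
elim: s => [_|i s IHs /= /andP[ij /IHs{}IHs]].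
  rewrite /uprod /cprod big_nil mul1g mulg1 big1 ?mulg1 // => a _.
  by rewrite big_nil eqxx.
rewrite /uprod big_cons -/(uprod s x) -mulgA IHs.
have -> : cprod (fun a => \sum_(k <- i :: s) x k * (a == idx k j)%:R)
    = (w (idx i j) ^+ (x i != 0)%R * cprod (fun a => \sum_(k <- s) x k * (a == idx k j)%:R))%g.
  rewrite -(cprod1 w) -(cprodD basic_square_commute basic_square_sq) /cprod; apply: eq_bigr => a _.
  by rewrite big_cons.
have [->|->] := F2_cases (x i); rewrite ?eqxx ?expg0 ?mul1g //= !expg1 !mulgA.
rewrite w_offdiag // -!mulgA; congr (_ * (_ * _))%g; rewrite !mulgA; congr (_ * _)%g.
exact: basic_square_commute.
Qed.

(** In decreasing order [u_j] passes only smaller indices before reaching its own place, where a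
    second [u_j] is turned into [w (idx j j)]. *)
Lemma uprod_right (s : seq 'I_n) x (j : 'I_n) : sorted (fun i k : 'I_n => k < i)%N s -> j \in s ->
  (uprod s x * u j = uprod s (fun i => (x i + (i == j)%:R)%R)
     * cprod (fun a => \sum_(i <- s | (i <= j)%N) x i * (a == idx i j)%:R))%g.
Proof.
elim: s => [//|i s IHs] si; have s_lt : all (fun k : 'I_n => k < i)%N s.
  by apply: (order_path_min _ si) => y z k /= yz ky; apply: ltn_trans yz.
have s_neq k : k \in s -> k != i by move/(allP s_lt) => ki; rewrite neq_ltn ki.
rewrite /uprod !big_cons -!/(uprod s _) inE.
have [->|ji] /= := eqVneq j i.
  move=> _; have -> : uprod s (fun k => x k + (k == i)%:R) = uprod s x.
    rewrite /uprod big_seq [RHS]big_seq; apply: eq_bigr => k /s_neq/negPf->.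
    by rewrite addr0.
  rewrite -mulgA (uprod_left _ s_lt).
  have -> : cprod (fun a => \sum_(k <- i :: s | (k <= i)%N) x k * (a == idx k i)%:R)
    = (w (idx i i) ^+ (x i != 0)%R * cprod (fun a => \sum_(k <- s) x k * (a == idx k i)%:R))%g.
    rewrite -(cprod1 w) -(cprodD basic_square_commute basic_square_sq) /cprod; apply: eq_bigr => a _.
    rewrite big_cons leqnn; congr (_ ^+ (_ + _ != _))%g; rewrite big_seq_cond [RHS]big_seq.
    by apply: eq_bigl => k; case: (boolP (k \in s)) => //= /(allP s_lt)/ltnW->.
  have [->|->] := F2_cases (x i); rewrite ?add0r ?addF2 ?eqxx ?expg0 ?mul1g //= ?expg1 ?mulgA //.
  by rewrite w_diag -(sq_commute (u i) (uprod s x)) expgS expg1.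
move=> js; rewrite -mulgA IHs ?(path_sorted si) // mulgA addr0; congr (_ * _)%g.
rewrite /cprod; apply: eq_bigr => a _; rewrite big_cons.
by rewrite leqNgt (allP s_lt _ js).
Qed.

Definition normal_form (x : 'I_n -> 'F_2) (e : 'I_r -> 'F_2) : gT :=
  (uprod (rev (enum 'I_n)) x * cprod e)%g.

Lemma eq_normal_form x x' e e' : x =1 x' -> e =1 e' -> normal_form x e = normal_form x' e'.
Proof.
by move=> xx' ee'; congr (_ * _)%g; apply: eq_bigr => i _; rewrite ?xx' ?ee'.
Qed.

Lemma normal_form0 : normal_form (fun=> 0) (fun=> 0) = 1%g.
Proof. by rewrite /normal_form cprod0 mulg1; apply: big1 => i _; rewrite eqxx. Qed.

(** The new exponents are those of multiplication by the [j]-th generator in [model], which is why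
    decreasing order was chosen. *)
Lemma normal_form_mul x e j : (normal_form x e * u j)%g
  = normal_form (fun i => x i + (i == j)%:R) (fun a => e a + x (lo a) * (hi a == j)%:R).
Proof.
rewrite /normal_form -mulgA (cprod_commute basic_square_commute) mulgA uprod_right; last first.
- by rewrite mem_rev mem_enum.
- rewrite rev_sorted; have := iota_ltn_sorted 0 n; rewrite -val_enum_ord sorted_map.
  by apply: sub_sorted => i k.
rewrite -mulgA -(cprodD basic_square_commute basic_square_sq) /cprod.
congr (_ * _)%g; apply: eq_bigr => a _; congr (_ ^+ (_ != _))%g; rewrite addrC; congr (_ + _).
rewrite (perm_big (enum 'I_n)) ?perm_rev // big_enum_cond /=.
have [hj|hj] := eqVneq (hi a) j; last first.
  rewrite mulr0 big1 // => i ij; case: eqP => [aE|_]; last by rewrite mulr0.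
  by have [_ h] := idxP ij; rewrite aE h eqxx in hj.
rewrite mulr1 (bigD1 (lo a)) /= -?hj ?lo_hi // idxK eqxx mulr1 big1 ?addr0 // => i /andP[ij ia].
case: eqP => [aE|_]; last by rewrite mulr0.
by have [l _] := idxP ij; rewrite aE l eqxx in ia.
Qed.
End NormalForm.

Lemma card_pairs n : #|[set p : 'I_n * 'I_n | (p.1 <= p.2)%N]| = 'C(n.+1, 2).
Proof.
rewrite -sum1_card (eq_bigl (fun p : 'I_n * 'I_n => (p.1 <= p.2)%N)) => [|p]; last by rewrite inE.
rewrite -(pair_big_dep xpredT (fun i j : 'I_n => (i <= j)%N) (fun _ _ => 1%N)) /=.
rewrite (exchange_big_dep xpredT) //= -bin2_sum big_mkord big_ord_recl add0n.
apply: eq_bigr => j _; rewrite sum1_card.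
have <- : #|[set widen_ord (ltn_ord j : j.+1 <= n)%N i | i : 'I_j.+1]| = (lift ord0 j).
  by rewrite card_imset ?card_ord // => i k /(congr1 val) ik; apply: val_inj.
apply: eq_card => i; rewrite unfold_in; apply/idP/imsetP => [ij|[k _ ->]]; last exact: ltn_ord k.
by exists (Ordinal (ij : (i < j.+1)%N)) => //; apply: val_inj.
Qed.

Lemma pair_indexing n r : 'C(n.+2, 2) = r ->
  exists lo hi : 'I_r -> 'I_n.+1, exists idx : 'I_n.+1 -> 'I_n.+1 -> 'I_r,
  [/\ forall a, (lo a <= hi a)%N,
      forall i j : 'I_n.+1, (i <= j)%N -> lo (idx i j) = i /\ hi (idx i j) = j
    & forall a, idx (lo a) (hi a) = a].
Proof.
rewrite -card_pairs => <-; set A := finset _.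
have A0 : (ord0, ord0) \in A by rewrite inE.
exists (fun a => (enum_val a).1), (fun a => (enum_val a).2), (fun i j => enum_rank_in A0 (i, j)).
split=> [a|i j ij|a]; first by have := enum_valP a; rewrite inE.
  by rewrite enum_rankK_in ?inE.
by rewrite -surjective_pairing enum_valK_in.
Qed.

(** The universal property gives a morphism [f] to the model. By induction on words, the normal form
    with exponents [f g] is [g] again, so [f] is injective and the model's coordinates pull back. *)
Theorem W_coordinates n r (gT : finGroupType) (x : 'I_n.+1 -> gT) :
  'C(n.+2, 2) = r -> is_W x -> inhabited (coordinates gT n.+1 r).
Proof.
case/pair_indexing=> lo [hi [idx [lo_hi idxP idxK]]] [laws gen univ].
pose d j : {ffun 'I_n.+1 -> 'F_2} := [ffun i => (i == j)%:R].
have [f fx] := univ _ (fun j => (d j, 0) : model lo hi) (@model_laws _ _ lo hi).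
have fM g h : f (g * h)%g = (f g * f h)%g by rewrite morphM ?inE.
have nfK g : normal_form lo hi x (f g).1 (f g).2 = g.
  have /gen_prodgP[m [c cx ->]] : g \in <<[set x i | i : 'I_n.+1]>>%g by rewrite gen inE.
  elim: m c cx => [|m IHm] c cx.
    rewrite big_ord0 morph1 -[RHS](normal_form0 lo hi x).
    by apply: eq_normal_form => i; rewrite ffunE.
  rewrite big_ord_recr /=; have /imsetP[j _ ->] := cx ord_max.
  set p := (\prod_(i < m) _)%g; have {}IHm : normal_form lo hi x (f p).1 (f p).2 = p.
    exact: (IHm (fun i => c (widen_ord (leqnSn m) i))).
  rewrite -[p in RHS]IHm (normal_form_mul lo_hi idxP idxK _ laws) fM fx.
  by apply: eq_normal_form => [i|a]; rewrite /= !ffunE ?addr0.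
pose w := basic_square lo hi x.
have fw a : f (w a) = (0, [ffun b => (b == a)%:R]) :> model lo hi.
  have idx_eq b : (b == a) = (lo b == lo a) && (hi b == hi a).
    by apply/eqP/andP => [->|[/eqP lb /eqP hb]]; rewrite // -[b]idxK lb hb idxK.
  have [lh|lh] := eqVneq (lo a) (hi a).
    rewrite /w /basic_square lh eqxx morphX ?inE // fx model_sq; congr (_, _).
    by apply/ffunP => b; rewrite !ffunE idx_eq lh; do 2!case: (_ == _); apply: val_inj.
  have lt_lh : (lo a < hi a)%N by rewrite ltn_neqAle lh lo_hi.
  (* Multiplying by a common left factor replaces the definition of [w a], with its inverses, by the
     relation [w_offdiag]. *)
  apply: (mulgI (f (x (hi a)) * f (x (lo a)))%g); have wE : w a = w (idx (lo a) (hi a)) by rewrite idxK.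
  rewrite wE -!fM /w -(w_offdiag idxP) //.
  rewrite !fM !fx !model_mulE /= pairing0r !addr0 add0r; congr (_, _); first exact: addrC.
  apply/ffunP => b; rewrite !ffunE idx_eq.
  have -> : (lo b == hi a)%:R * (hi b == lo a)%:R = 0 :> 'F_2.
    have [lb|_] := eqVneq (lo b) (hi a); last by rewrite mul0r.
    have [hb|_] := eqVneq (hi b) (lo a); last by rewrite mulr0.
    by have := lo_hi b; rewrite lb hb leqNgt lt_lh.
  by rewrite !add0r; do 2!case: (_ == _); apply: val_inj.
constructor; apply: (@Coordinates gT n.+1 r lo hi idx (fun i g => (f g).1 i) (fun a g => (f g).2 a) x w) => //.
- by move=> i g h; rewrite fM ffunE.
- by move=> a g h; rewrite fM !ffunE.
- move=> g h Xgh Egh; rewrite -[g]nfK -[h]nfK; exact: eq_normal_form.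
- by move=> i j; rewrite fx ffunE.
- by move=> a j; rewrite fx ffunE.
- by move=> i a; rewrite fw ffunE.
- by move=> a b; rewrite fw ffunE.
Qed.

(** * Coefficients of the numerator and the final computation *)

Lemma coef_one_sub_sqX r (p := (1 - 'X^2 : {poly int}) ^+ r) :
  [/\ p`_0 = 1, p`_1 = 0, p`_2 = - r%:Z & p`_3 = 0].
Proof.
rewrite {}/p; elim: r => [|r [p0 p1 p2 p3]]; first by rewrite expr0 !coef1.
rewrite exprSr mulrBr mulr1 !coefB !coefMXn /= p0 p1 p2 p3; split=> //; lia.
Qed.

Lemma qcoefE r h :
  qcoef r h 2 = (h 2%N)%:Z - r%:Z * (h 0%N)%:Z /\ qcoef r h 3 = (h 3%N)%:Z - r%:Z * (h 1%N)%:Z.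
Proof.
have [p0 p1 p2 p3] := coef_one_sub_sqX r.
rewrite /qcoef !big_ord_recr !big_ord0 /= p0 p1 p2 p3; split; ring.
Qed.

Section Binomials.
Variable m : nat.
Local Notation M := (m%:R : rat).
Lemma natr_binS k : ('C(k.+1 + m, k.+1))%:R = (M + k.+1%:R) * ('C(k + m, k))%:R / k.+1%:R :> rat.
Proof.
have k0 : k.+1%:R != 0 :> rat by rewrite Num.Theory.pnatr_eq0.
apply: (mulIf k0); rewrite mulfVK //.
have /(congr1 (fun i => i%:R : rat)) := mul_bin_diag (k.+1 + m) k.
by rewrite !natrM natrD [_ + M]addrC mulrC [X in _ = X]mulrC => <-; rewrite mulrC.
Qed.
Lemma natr_bin2 : ('C(2 + m, 2))%:R = (M + 2) * (M + 1) / 2 :> rat.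
Proof. by rewrite !natr_binS bin0; field. Qed.
Lemma natr_bin3 : ('C(3 + m, 3))%:R = (M + 3) * (M + 2) * (M + 1) / 6 :> rat.
Proof. by rewrite !natr_binS bin0; field. Qed.
Lemma natr_bin4 : ('C(4 + m, 4))%:R = (M + 4) * (M + 3) * (M + 2) * (M + 1) / 24 :> rat.
Proof. by rewrite !natr_binS bin0; field. Qed.
Lemma natr_bin5 : ('C(5 + m, 5))%:R = (M + 5) * (M + 4) * (M + 3) * (M + 2) * (M + 1) / 120 :> rat.
Proof. by rewrite !natr_binS bin0; field. Qed.
End Binomials.

Theorem theorem6p14 (n : nat) (gT : finGroupType) (x : 'I_n -> gT) :
  (1 <= n)%N -> is_W x ->
  let r := 'C(n.+1, 2) in
  let N : rat := n%:R in
  (qcoef r (coh_dim gT) 2)%:~R = N * (N + 1) * (N - 1) / 3 /\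
  (qcoef r (coh_dim gT) 3)%:~R
    = N * (N ^+ 2 - 1) * (3 * N - 4) * (N + 3) / 60.
Proof.
case: n x => // m x _ Wx r N.
(* The rank lemmas count forms in [r'+1] variables, so [r] is exhibited as a successor. *)
have [k rE] : exists k, r = k.+1.
  by exists r.-1; rewrite prednK // bin_gt0.
have [C] := W_coordinates (erefl : 'C(m.+2, 2) = r) Wx.
rewrite rE in C.
have [c1 c2 c3] := cohomology_dims C.
have d1 := dim_kernel C 1; have d2 := dim_kernel C 2; have d3 := dim_kernel C 3.
have r1 := rank_qb1 C; have r2 := rank_qb2 C; have r3 := rank_qb3 C.
have [-> ->] := qcoefE r (coh_dim gT).
move: c1 c2 c3 d1 d2 d3 r1 r2 r3; rewrite coh_dim0.
move: (\dim (lker _)) (\dim (lker _)) (\dim (lker _)) (\dim (limg _)) (\dim (limg _)) (\dim (limg _)).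
move=> k3 k2 k1 i3 i2 i1.
have cast (a b : nat) : a = b -> a%:R = b%:R :> rat by move->.
have sE : (m + k.+1)%:R = m%:R + k%:R + 1 :> rat by rewrite natrD -natr1 addrA.
(* [k] is [r - 1]; from here on everything is a rational function of [m = n - 1]. *)
have K1 : k%:R = (m%:R + 2) * (m%:R + 1) / 2 - 1 :> rat.
  by rewrite -natr_bin2 -[X in X%:R - _]/r rE -natr1 addrK.
have rR : (r%:Z)%:~R = (m%:R + 2) * (m%:R + 1) / 2 :> rat by rewrite -natr_bin2.
have NE : N = m%:R + 1 by rewrite /N -natr1.
rewrite !bin1; have := natr_bin2 k; have := natr_bin3 k.
have := natr_bin3 m; have := natr_bin4 m; have := natr_bin5 m.
have := natr_bin2 (m + k.+1); have := natr_bin3 (m + k.+1); rewrite sE.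
move: 'C(2 + k, 2) 'C(3 + k, 3) 'C(3 + m, 3) 'C(4 + m, 4) 'C(5 + m, 5)
  'C(2 + (m + k.+1), 2) 'C(3 + (m + k.+1), 3) => bk2 bk3 bm3 bm4 bm5 b2 b3.
move=> B3 B2 M5 M4 M3 Q3 Q2.
move=> -> /cast h2 /cast h3 /cast e1 /cast e2 /cast e3 /cast f1 /cast f2 /cast f3.
rewrite !(natrD, natrM) -?natr1 ?(B2, B3, M3, M4, M5, Q2, Q3, K1) in h2 h3 e1 e2 e3 f1 f2 f3.
have isolate (a b c : rat) : a + b = c -> a = c - b by move=> <-; rewrite addrK.
rewrite !intrB !intrM rR NE -!pmulrn.
move: h2 h3 e1 e2 e3 f1 f2 f3.
move: (coh_dim gT 2)%:R (coh_dim gT 3)%:R k3%:R k2%:R k1%:R i3%:R i2%:R i1%:R (m%:R : rat).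
move=> h2 h3 {}k3 {}k2 {}k1 {}i3 {}i2 {}i1 M.
(* The relations are triangular: cohomology dimensions in terms of kernels, kernels in terms of
   ranks, ranks in terms of polynomials in [M]. *)
move=> /isolate-> /isolate-> /isolate-> /isolate-> /isolate-> -> /isolate-> /isolate->.
by split; field.
Qed.
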